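(* There exist universal constants $C>c>0$ such that the following holds. Let $\boldsymbol\theta^*\in\mathbb{R}^d$ with $R:=\|\boldsymbol\theta^*\|_2\ge1$, let $(\mathbf x_1,y_1),\dots,(\mathbf x_n,y_n)$ be i.i.d. with $\mathbf x_i\sim N(\mathbf 0,\mathbf I_d)$ and $y_i\mid\mathbf x_i\sim\mathrm{Bernoulli}(s(\mathbf x_i^\top\boldsymbol\theta^* ))$, let $m_1,m_2,m_3$ be positive integers with $m_1+m_2+m_3=n$, and let $\hat R_{\mathrm{DB}}$ be the output of the debiased norm estimator (defined in the context) run on these data with $(m_1,m_2,m_3)$. Given any $t\ge1$, if $\min\{m_1,m_2,m_3\}\ge cn$ and $n\ge CR(d+t)$, then with probability at least $1-C\exp(-ct)$, $$|\hat R_{\mathrm{DB}}-R|\le C\sqrt{\frac{R^3t}{n}}.$$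
   Context: $s(a)=(1+e^{-a})^{-1}$; $q(r)=\mathbb{E}_{g\sim N(0,1)}[g\,s(rg)]$ for $r\ge0$, which is strictly increasing, and $q^{-1}$ is its inverse. $\Pi_{[a,b]}(x)=\min\{\max\{x,a\},b\}$ and $[x]_+=\max\{x,0\}$. ''Universal constant'' means a constant not depending on $n,d,\boldsymbol\theta^*,t,m_1,m_2,m_3$. Debiased norm estimator. Input: data $\{(\mathbf x_i,y_i)\}_{i=1}^n$ and positive integers $m_1+m_2+m_3=n$; set $\mathcal I_1=\{1,\dots,m_1\}$, $\mathcal I_2=\{m_1+1,\dots,m_1+m_2\}$, $\mathcal I_3=\{m_1+m_2+1,\dots,n\}$. Step 1: compute $\breve{\boldsymbol\theta}\in\arg\min_{\boldsymbol\theta\in\mathbb{R}^d}\frac1{m_1}\sum_{i\in\mathcal I_1}[\log(1+e^{\mathbf x_i^\top\boldsymbol\theta})-y_i\mathbf x_i^\top\boldsymbol\theta]$; let $\breve{\mathbf v}=\breve{\boldsymbol\theta}/\|\breve{\boldsymbol\theta}\|_2$, $\breve R=\|\breve{\boldsymbol\theta}\|_2$. Step 2: compute $\hat r\in\arg\min_{r\in[0,4\breve R]}\frac1{m_2}\sum_{i\in\mathcal I_2}[\log(1+e^{r\mathbf x_i^\top\breve{\mathbf v}})-y_ir\mathbf x_i^\top\breve{\mathbf v}]$. Step 3: with $\mathbf P^\perp_{\breve{\mathbf v}}=\mathbf I_d-\breve{\mathbf v}\breve{\mathbf v}^\top$, for $i\in\mathcal I_3$ let $\mathbf w_i=\mathbf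 P^\perp_{\breve{\mathbf v}}[y_i-s(\hat r\,\mathbf x_i^\top\breve{\mathbf v})]\mathbf x_i$; let $\hat B=\frac1{m_3(m_3-1)}\sum_{i,j\in\mathcal I_3,\,i\ne j}\langle\mathbf w_i,\mathbf w_j\rangle$, $\hat S=q(\hat r)^2+\hat B$, $\hat q=\Pi_{[q(\hat r/2),\,q(2\hat r)]}\big(\sqrt{[\hat S]_+}\big)$. Output: $\hat R_{\mathrm{DB}}=q^{-1}(\hat q)$. If the minimizer in Step 1 does not exist, the output is undefined and the error bound is regarded as failing. *)

(* Defs.v *)
From HB Require Import structures.
From mathcomp Require Import all_boot all_order all_algebra.
From mathcomp Require Import all_classical all_reals all_analysis.

Set Implicit Arguments.
Unset Strict Implicit.
Unset Printing Implicit Defensive.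

Import Order.TTheory GRing.Theory Num.Theory.
Import numFieldNormedType.Exports.

Local Open Scope classical_set_scope.
Local Open Scope ring_scope.

(* 'cV[R]_d carries the product of the Borel sigma-algebras of its
   coordinates, as the library does for n.-tuple. *)
Definition colvec_display : measure_display. Proof. exact: default_measure_display. Qed.

Section colvec_measurable.
Context {R : realType} {d : nat}.

Let coors : 'I_d -> 'cV[R]_d -> R := fun j v => v j 0.

Let colvec_set0 : g_sigma_preimage coors set0.
Proof. exact: sigma_algebra0. Qed.

Let colvec_setC A : g_sigma_preimage coors A -> g_sigma_preimage coors (~` A).
Proof. exact: sigma_algebraC. Qed.

Let colvec_bigcup (F : _^nat) : (forall i, g_sigma_preimage coors (F i)) ->
  g_sigma_preimage coors (\bigcup_i (F i)).
Proof. exact: sigma_algebra_bigcup. Qed.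

HB.instance Definition _ := @isMeasurable.Build colvec_display
  'cV[R]_d (g_sigma_preimage coors) colvec_set0 colvec_setC colvec_bigcup.

End colvec_measurable.

Section euclidean.
Context {R : realType} {d : nat}.

Definition dot (u v : 'cV[R]_d) : R := \sum_(j < d) u j 0 * v j 0.

(* The library's norm on matrices is the sup norm. *)
Definition l2norm (u : 'cV[R]_d) : R := Num.sqrt (dot u u).

End euclidean.

Section link.
Context {R : realType}.

Definition sigmoid (a : R) : R := (1 + expR (- a))^-1.

Definition q (r : R) : R :=
  fine ('E_(normal_prob 0 1)[fun g : R => (g * sigmoid (r * g))%R])%E.

(* Inverse of q on [0, +oo[; the junk value 0 is taken only outside of
   q @` [0, +oo[. *)
Definition qinv (x : R) : R := xget 0 [set r : R | 0 <= r /\ q r = x].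

Definition clip (a b x : R) : R := Num.min (Num.max x a) b.

Definition pospart (x : R) : R := Num.max x 0.

Definition logistic_loss (a : R) (y : bool) : R := ln (1 + expR a) - y%:R * a.

End link.

Definition is_argmin {R : realType} {T : Type} (D : set T) (f : T -> R) (x : T) :=
  D x /\ forall z, D z -> f x <= f z.

Section estimator.
Context {R : realType} {n d : nat}.
Variables (X : 'I_n -> 'cV[R]_d) (Y : 'I_n -> bool) (m1 m2 m3 : nat).

(* The index blocks, shifted to start at 0. *)
Definition in_I1 (i : 'I_n) : bool := (i < m1)%N.
Definition in_I2 (i : 'I_n) : bool := (m1 <= i < m1 + m2)%N.
Definition in_I3 (i : 'I_n) : bool := (m1 + m2 <= i)%N.

Definition loss1 (th : 'cV[R]_d) : R :=
  m1%:R^-1 * \sum_(i < n | in_I1 i) logistic_loss (dot (X i) th) (Y i).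

Definition loss2 (v : 'cV[R]_d) (r : R) : R :=
  m2%:R^-1 * \sum_(i < n | in_I2 i) logistic_loss (r * dot (X i) v) (Y i).

Definition residual (v : 'cV[R]_d) (r : R) (i : 'I_n) : 'cV[R]_d :=
  (1%:M - v *m v^T) *m (((Y i)%:R - sigmoid (r * dot (X i) v)) *: X i).

Definition Bhat (v : 'cV[R]_d) (r : R) : R :=
  (m3%:R * (m3%:R - 1))^-1 *
  \sum_(i < n | in_I3 i) \sum_(j < n | in_I3 j && (i != j))
    dot (residual v r i) (residual v r j).

Definition Shat (v : 'cV[R]_d) (r : R) : R := q r ^+ 2 + Bhat v r.

Definition qhat (v : 'cV[R]_d) (r : R) : R :=
  clip (q (r / 2)) (q (2 * r)) (Num.sqrt (pospart (Shat v r))).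

(* Rhat is a possible output of the estimator. The minimizers of the first two
   steps need not be unique a priori, hence a relation. When th = 0 the
   direction th / |th| is undefined, and so is the output. *)
Definition debiased_output (Rhat : R) : Prop :=
  exists (th : 'cV[R]_d) (r : R),
    let v := (l2norm th)^-1 *: th in
    [/\ is_argmin setT loss1 th, th != 0,
        is_argmin `[0, 4 * l2norm th] (loss2 v) r
      & Rhat = qinv (qhat v r)].

End estimator.

Section model.
Context {R : realType} {disp : measure_display} {T : measurableType disp}.
Variable P : probability T R.

(* Taking B i = setT for i outside of a subfamily gives the product rule for
   that subfamily. *)
Definition mutually_independent {disp' : measure_display}
    {T' : measurableType disp'} {I : finType} (Z : I -> T -> T') : Prop :=
  forall B : I -> set T', (forall i, measurable (B i)) ->
    P [set w | forall i, B i (Z i w)] = (\prod_(i : I) P (Z i @^-1` B i))%E.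

(* x ~ N(0, I_d): the coordinates are independent N(0, 1). *)
Definition std_gaussian_vec {d : nat} (x : T -> 'cV[R]_d) : Prop :=
  mutually_independent (fun (j : 'I_d) w => x w j 0) /\
  forall (j : 'I_d) (A : set R), measurable A ->
    P [set w | A (x w j 0)] = normal_prob 0 1 A.

(* y | x ~ Bernoulli(s(x^T theta)): s(x^T theta) is a version of the conditional
   probability of {y = 1} given the sigma-algebra generated by x. *)
Definition logistic_response {d : nat} (theta : 'cV[R]_d)
    (x : T -> 'cV[R]_d) (y : T -> bool) : Prop :=
  forall A : set 'cV[R]_d, measurable A ->
    P [set w | A (x w) /\ y w] =
    (\int[P]_(w in x @^-1` A) (sigmoid (dot (x w) theta))%:E)%E.

Definition logistic_sample {n d : nat} (theta : 'cV[R]_d)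
    (x : 'I_n -> T -> 'cV[R]_d) (y : 'I_n -> T -> bool) : Prop :=
  [/\ forall i, measurable_fun setT (x i),
      forall i, measurable_fun setT (y i),
      mutually_independent (fun i w => (x i w, y i w)),
      forall i, std_gaussian_vec (x i)
    & forall i, logistic_response theta (x i) (y i)].

End model.

(* Main.v *)
(* Write R = |theta| >= 1 and u = theta / R.  When v is close to u and r is
   comparable to R, the residual y - s(r x.v) is of order one only on the event
   |x.v| = O(1/R), and it decays like exp(-R|x.v|/2) off it.  Hence its product with x.a, for
   |a.v| <= R and |a - (a.v)v| <= 1, satisfies a Bernstein bound with variance
   proxy O(1/R), and every deviation is governed by the effective sample size
   L = n / R, which is at least a large multiple of d + t.

   Step 1.  In the coordinates theta + D + (R-1)(u.D)u the score is O(lambda L)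
   and the curvature is of order L on a sphere |D| = c0, both uniformly by a net
   argument.  By convexity the minimiser exists, is unique and lies inside the
   sphere, so its direction v satisfies |v - (v.u)u| = O(1/R) with a small
   constant.

   Steps 2 and 3 use fresh samples, so v, and then (v, r), may be treated as
   fixed and no net over directions is needed.  The second step finds r with
   |q(r) - q(R)(u.v)| = O(sqrt(t/(L R^4))).  In the third one the U-statistic
   estimates q(R)^2 (1 - (u.v)^2): its linear part obeys the Bernstein bound, and its
   degenerate part is the martingale sum of <w_j, S_(j-1)>, where the partial
   sums S_j are O(L) by a maximal inequality over a net.  The two pieces add up to
   q(R)^2 with error O(sqrt(t/(L R^4))), and since q increases at rate at least
   of order 1/R^3 up to 3R, inverting q costs a factor R^3. *)

Require Import Defs.
From HB Require Import structures.
From mathcomp Require Import all_boot all_order all_algebra.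
From mathcomp Require Import all_classical all_reals all_analysis.
From mathcomp Require Import measurable_realfun.
From mathcomp Require Import ring lra.

Set Implicit Arguments.
Unset Strict Implicit.
Unset Printing Implicit Defensive.

Import Order.TTheory GRing.Theory Num.Theory.
Import numFieldNormedType.Exports.

Local Open Scope classical_set_scope.
Local Open Scope ring_scope.

(** * Sequential Chernoff bounds for independent samples *)

(** The direction found in the first step needs only a small constant accuracy on the scale 1/R,
    with no rate in t: q(R)^2 (u.v)^2 from the radial fit and q(R)^2 (1 - (u.v)^2) from the
    U-statistic sum exactly to q(R)^2, so the angle cancels. What remains is R^3 sqrt(t/(L R^4)) = R
    sqrt(t/L), which is the claimed sqrt(R^3 t/n) because L is of order n/R. The obstacle is to use
    v and r as if they were constants, without conditional laws. Every estimate is a measurable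
    function of the whole sample tuple that ignores the coordinates of later index, and conditioning
    is replaced by drawing one coordinate afresh. This asks for two things that are silent in the
    informal argument: the minimisers must be measurable selections, and the bounds on v and r must
    hold for every sample. Hence each selection is replaced by the true parameter off its good
    event, where the bounds are immediate, and the good events are intersected only at the end. *)

Section measurable_big.
Context {R : realType} {d : measure_display} {T : measurableType d} {I : eqType}.

Lemma measurable_sum_cond (s : seq I) (p : pred I) (h : I -> T -> R) :
  (forall i, p i -> measurable_fun setT (h i)) ->
  measurable_fun setT (fun x => \sum_(i <- s | p i) h i x).
Proof.
move=> mh; under eq_fun do rewrite big_mkcond.
apply: measurable_sum => i.
by have [pi|_] := boolP (p i); [exact: mh|exact: measurable_cst].
Qed.

Lemma measurable_prod_cond (s : seq I) (p : pred I) (h : I -> T -> R) :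
  (forall i, p i -> measurable_fun setT (h i)) ->
  measurable_fun setT (fun x => \prod_(i <- s | p i) h i x).
Proof.
move=> mh; under eq_fun do rewrite big_mkcond.
apply: measurable_prod => i _.
by have [pi|_] := boolP (p i); [exact: mh|exact: measurable_cst].
Qed.

End measurable_big.

Lemma le_integral_EFin {R : realType} {d : measure_display}
    {T : measurableType d} (m : {measure set T -> \bar R}) (f g : T -> R) :
  measurable_fun setT f -> measurable_fun setT g ->
  (forall x, 0 <= f x) -> (forall x, f x <= g x) ->
  (\int[m]_x (f x)%:E <= \int[m]_x (g x)%:E)%E.
Proof.
move=> mf mg f0 fg.
apply: ge0_le_integral => //.
- by move=> x _; rewrite lee_fin.
- exact/measurable_EFinP.
- exact/measurable_EFinP.
- by move=> x _; rewrite lee_fin.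
Qed.

Lemma le_integralT {R : realType} {d : measure_display}
    {T : measurableType d} (m : {measure set T -> \bar R}) (f g : T -> \bar R) :
  measurable_fun setT f -> measurable_fun setT g ->
  (forall x, 0 <= f x)%E -> (forall x, f x <= g x)%E ->
  (\int[m]_x f x <= \int[m]_x g x)%E.
Proof. by move=> mf mg f0 fg; apply: ge0_le_integral. Qed.

Lemma integral_prob_cst {R : realType} {d : measure_display}
    {T : measurableType d} (P : probability T R) (c : \bar R) :
  (\int[P]_x c = c)%E.
Proof.
rewrite integral_cst// [X in (_ * X)%E](_ : _ = 1%E) ?mule1//.
exact: probability_setT.
Qed.

Section tuple_law.
Context {R : realType} {d d' : measure_display} {T : measurableType d}
  {T' : measurableType d'} (P : probability T R) {n : nat}.
Variable Z : 'I_n -> T -> T'.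
Hypothesis mZ : forall i, measurable_fun setT (Z i).
Hypothesis indep : mutually_independent P Z.

(** Replacing one coordinate by a fresh draw and integrating over the draw plays the role of the
    conditional expectation given the other coordinates. *)
Definition upd (W : n.-tuple T') (j : 'I_n) (z : T') : n.-tuple T' :=
  [tuple if i == j then z else tnth W i | i < n].

Definition data (w : T) : n.-tuple T' := [tuple Z i w | i < n].

Lemma tnth_data w i : tnth (data w) i = Z i w.
Proof. by rewrite tnth_mktuple. Qed.

Lemma tnth_upd W j z i : tnth (upd W j z) i = if i == j then z else tnth W i.
Proof. by rewrite tnth_mktuple. Qed.

Lemma measurable_data : measurable_fun setT data.
Proof.
apply/measurable_fun_tnthP => i.
by rewrite (_ : _ \o _ = Z i)//; apply/funext => w /=; rewrite tnth_data.
Qed.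

Lemma measurable_upd j :
  measurable_fun setT (fun p : n.-tuple T' * T' => upd p.1 j p.2).
Proof.
apply/measurable_fun_tnthP => i.
have [->|ij] := eqVneq i j.
  rewrite (_ : _ \o _ = snd)//; apply/funext => w /=.
  by rewrite tnth_upd eqxx.
rewrite (_ : _ \o _ = (fun W => tnth W i) \o fst).
  by apply: measurableT_comp => //; exact: measurable_tnth.
by apply/funext => w /=; rewrite tnth_upd (negbTE ij).
Qed.

Let updZ (j : 'I_n) (p : T * T) := upd (data p.1) j (Z j p.2).

Lemma measurable_updZ j : measurable_fun setT (updZ j).
Proof.
apply: (measurableT_comp (g := fun p : T * T => (data p.1, Z j p.2)) (measurable_upd j)).
apply/measurable_fun_pairP; split => /=.
  exact: (measurableT_comp measurable_data).
exact: (measurableT_comp (mZ j)).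
Qed.

Let rect : set (set (n.-tuple T')) :=
  [set A | exists B : 'I_n -> set T', (forall i, measurable (B i)) /\
     A = [set W | forall i, B i (tnth W i)]].

Let rectI : setI_closed rect.
Proof.
move=> _ _ [B [mB ->]] [C [mC ->]]; exists (fun i => B i `&` C i); split.
  by move=> i; exact: measurableI.
apply/seteqP; split => W /=.
  by move=> [h1 h2] i; split.
by move=> h; split => i; case: (h i).
Qed.

Let rect_gen : @measurable _ (n.-tuple T') = <<s rect >>.
Proof.
apply/seteqP; split.
  apply: smallest_sub; first exact: smallest_sigma_algebra.
  rewrite -bigcup_seq => A [i /= _ [B mB <-]].
  apply: sub_sigma_algebra.
  exists (fun k => if k == i then B else setT); split.
    by move=> k; case: ifP.
  apply/seteqP; split => W /=.
    by move=> [_ BW] k; case: eqP => [->|].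
  by move=> /(_ i); rewrite eqxx.
apply: smallest_sub; first exact: sigma_algebra_measurable.
move=> _ [B [mB ->]].
rewrite (_ : [set W | _] = \bigcap_(i in [set: 'I_n]) ((fun W => tnth W i) @^-1` B i)).
  apply: fin_bigcap_measurable; first exact: finite_finset.
  move=> i _; rewrite -[X in measurable X]setTI.
  exact: measurable_tnth.
apply/seteqP; split => W /=; first by move=> h i _; exact: h.
by move=> h i; exact: h.
Qed.

Let P_rect (B : 'I_n -> set T') : (forall i, measurable (B i)) ->
  P [set w | forall i, B i (Z i w)] = (\prod_(i < n) P (Z i @^-1` B i))%E.
Proof. by move=> mB; exact: indep. Qed.

(** Both laws agree on measurable rectangles, where independence factors them into the same product;
    rectangles form a pi-system generating the product sigma-algebra. *)
Lemma data_resample j (A : set (n.-tuple T')) : measurable A ->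
  pushforward P data A = pushforward (P \x P)%E (updZ j) A.
Proof.
move=> mA.
pose m1 : {measure set (n.-tuple T') -> \bar R} :=
  measure_function_pushforward__canonical__measure_function_Measure P measurable_data.
pose m2 : {measure set (n.-tuple T') -> \bar R} :=
  measure_function_pushforward__canonical__measure_function_Measure
    (P \x P)%E (measurable_updZ j).
have P1 : P setT = 1%E by exact: probability_setT.
have rectm B : (forall i, measurable (B i)) ->
    measurable [set w | forall i, B i (Z i w)].
  move=> mB.
  rewrite (_ : [set w | _] = \bigcap_(i in [set: 'I_n]) (Z i @^-1` B i)).
    apply: fin_bigcap_measurable; first exact: finite_finset.
    by move=> i _; rewrite -[X in measurable X]setTI; exact: mZ.
  by apply/seteqP; split => W /= h i; [move=> _; exact: h|exact: h].
apply: (@measure_unique _ _ _ rect (fun=> setT) rect_gen rectI _ _ m1 m2) => //.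
- by move=> _; exists (fun=> setT); split => //; apply/seteqP; split.
- by rewrite bigcup_const.
- move=> _ [B [mB ->]].
  rewrite /m1 /m2 /= /pushforward.
  pose B' (i : 'I_n) := if i == j then setT else B i.
  have mB' i : measurable (B' i) by rewrite /B'; case: ifP.
  rewrite (_ : updZ j @^-1` _ = [set w | forall i, B' i (Z i w)] `*` (Z j @^-1` B j)).
    rewrite product_measure1E//; first last.
    - by rewrite -[X in measurable X]setTI; exact: mZ.
    - exact: rectm.
    rewrite [X in _ = (X * _)%E](P_rect mB').
    rewrite (_ : data @^-1` _ = [set w | forall i, B i (Z i w)]); last first.
      by apply/seteqP; split => w /= h i; move: (h i); rewrite tnth_data.
    rewrite [X in X = _](P_rect mB) (bigD1 j)//= [in RHS](bigD1 j)//= /B' eqxx preimage_setT P1 mul1e.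
    rewrite muleC; congr (_ * _)%E.
    by apply: eq_bigr => i /negbTE ->.
  apply/seteqP; split => [[w w']|[w w']] /=.
    move=> h; split => [i|].
      rewrite /B'; case: ifPn => // ij; move: (h i).
      by rewrite /updZ/= tnth_upd (negbTE ij) tnth_data.
    by move: (h j); rewrite /updZ/= tnth_upd eqxx.
  move=> [h1 h2] i; rewrite /updZ/= tnth_upd; case: eqVneq => [->//|ij].
  by move: (h1 i); rewrite /B' (negbTE ij) tnth_data.
- move=> _; rewrite /m1/= /pushforward preimage_setT P1.
  exact: ltry.
Qed.

Lemma integral_resample (j : 'I_n) (G : n.-tuple T' -> \bar R) :
  measurable_fun setT G -> (forall W, 0 <= G W)%E ->
  (\int[P]_w G (data w) = \int[P]_w \int[P]_w' G (upd (data w) j (Z j w')))%E.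
Proof.
move=> mG G0.
pose m1 : {measure set (n.-tuple T') -> \bar R} :=
  measure_function_pushforward__canonical__measure_function_Measure P measurable_data.
pose m2 : {measure set (n.-tuple T') -> \bar R} :=
  measure_function_pushforward__canonical__measure_function_Measure
    (P \x P)%E (measurable_updZ j).
transitivity (\int[m1]_W G W)%E.
  rewrite /m1 ge0_integral_pushforward//.
  exact: measurable_data.
transitivity (\int[m2]_W G W)%E.
  by apply: eq_measure_integral => A mA _; exact: data_resample.
rewrite /m2 ge0_integral_pushforward//; last exact: measurable_updZ.
rewrite preimage_setT fubini_tonelli1//.
by apply: measurableT_comp => //; exact: measurable_updZ.
by move=> p; exact: G0.
Qed.

(* [h] depends on the coordinates of index < k only. *)
Definition indep_of_ge (k : nat) {U : Type} (h : n.-tuple T' -> U) :=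
  forall W (j : 'I_n) z, (k <= j)%N -> h (upd W j z) = h W.

Lemma indep_of_geW k l {U : Type} (h : n.-tuple T' -> U) : (k <= l)%N ->
  indep_of_ge k h -> indep_of_ge l h.
Proof. by move=> kl hh W j z lj; apply: hh; exact: leq_trans lj. Qed.

(** Induction on l. Neither [h] nor the factors of index < l see coordinate l, so resampling it and
    integrating it out removes the last factor at no cost. The factors may depend on the past, which
    is what adaptive estimates require. *)
Lemma supermartingale (k l : nat) (h : n.-tuple T' -> R)
    (H : 'I_n -> n.-tuple T' -> R) :
  measurable_fun setT h -> (forall W, 0 <= h W) -> indep_of_ge k h ->
  (forall j : 'I_n, measurable_fun setT (H j)) -> (forall j W, 0 <= H j W) ->
  (forall j : 'I_n, indep_of_ge j.+1 (H j)) ->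
  (forall (j : 'I_n) W, (k <= j < l)%N ->
     (\int[P]_w' (H j (upd W j (Z j w')))%:E <= 1)%E) ->
  (\int[P]_w (h (data w) * \prod_(j < n | (k <= j < l)%N) H j (data w))%:E
     <= \int[P]_w (h (data w))%:E)%E.
Proof.
move=> mh h0 hk mH H0 Hk H1.
elim: l H1 => [|l IH] H1.
  rewrite (eq_integral (fun w => (h (data w))%:E))// => w _.
  by rewrite big_pred0 ?mulr1// => i; rewrite ltn0 andbF.
have {}IH : (\int[P]_w (h (data w) * \prod_(j < n | (k <= j < l)%N) H j (data w))%:E <= \int[P]_w (h (data w))%:E)%E.
  by apply: IH => j W /andP[kj jl]; apply: H1; rewrite kj ltnS ltnW.
case: (ltnP l n) => [ln|nl]; last first.
  rewrite (eq_integral (fun w => (h (data w) * \prod_(j < n | (k <= j < l)%N) H j (data w))%:E))//.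
  move=> w _; congr (_ * _)%:E; apply: eq_bigl => i.
  by rewrite ltnS !(ltnW (leq_trans (ltn_ord i) nl)) (leq_trans (ltn_ord i) nl).
case: (leqP k l) => [kl|lk]; last first.
  rewrite (eq_integral (fun w => (h (data w) * \prod_(j < n | (k <= j < l)%N) H j (data w))%:E))//.
  move=> w _; congr (_ * _)%:E; apply: eq_bigl => i.
  case: (leqP k i) => //= ki; rewrite ltnS.
  by rewrite leqNgt (leq_trans lk ki) ltnNge (ltnW (leq_trans lk ki)).
apply: le_trans IH.
pose j := Ordinal ln.
pose K W := h W * \prod_(i < n | (k <= i < l)%N) H i W.
have mK : measurable_fun setT K.
  apply: measurable_funM => //.
  by apply: measurable_prod_cond => i _; exact: mH.
have K0 W : 0 <= K W by rewrite mulr_ge0// prodr_ge0.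
have Kj W z : K (upd W j z) = K W.
  rewrite /K hk//; congr (_ * _); apply: eq_bigr => i /andP[_ il].
  by apply: Hk.
have split w : h (data w) * \prod_(i < n | (k <= i < l.+1)%N) H i (data w) = K (data w) * H j (data w).
  rewrite /K (bigD1 j) /=; last by rewrite kl ltnSn.
  rewrite mulrCA mulrC; congr (_ * _ * _); apply: eq_bigl => i.
  rewrite ltnS -andbA; congr andb; rewrite ltn_neqAle andbC.
  by congr andb.
under eq_integral do rewrite split.
rewrite (@integral_resample j (fun W => (K W * H j W)%:E)); first last.
  - by move=> W; rewrite lee_fin mulr_ge0.
  - by apply/measurable_EFinP; apply: measurable_funM.
apply: ge0_le_integral => //.
- by move=> w _; apply: integral_ge0 => w' _; rewrite lee_fin mulr_ge0.
- apply: (@measurable_fun_fubini_tonelli_F _ _ _ _ _ P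
    (fun p : T * T => (K (updZ j p) * H j (updZ j p))%:E)).
  + apply/measurable_EFinP; apply: measurable_funM.
      by apply: (measurableT_comp mK); exact: measurable_updZ.
    by apply: (measurableT_comp (mH j)); exact: measurable_updZ.
  + by move=> p; rewrite lee_fin mulr_ge0.
- by apply/measurable_EFinP; apply: (measurableT_comp mK); exact: measurable_data.
- move=> w _.
  under eq_integral do rewrite Kj EFinM.
  rewrite ge0_integralZl//.
  + rewrite -[leRHS]mule1; apply: lee_wpmul2l; first by rewrite lee_fin.
    by apply: H1; rewrite /= kl ltnSn.
  + apply/measurable_EFinP; apply: (measurableT_comp (mH j)).
    apply: (measurableT_comp (g := fun z => (data w, Z j z)) (measurable_upd j)).
    exact: measurable_fun_pair.
  + by move=> z _; rewrite lee_fin.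
  + by rewrite lee_fin.
Qed.

(** Markov's inequality for the indicator of [A] times the product of the exp (X_j - a), whose mean
    is controlled by [supermartingale]. As [A] is settled by the coordinates of index < k, its
    probability survives as a factor. *)
Lemma tuple_chernoff (k l : nat) (a : R) (s : R) (A : set (n.-tuple T'))
    (X : 'I_n -> n.-tuple T' -> R) :
  measurable A -> indep_of_ge k A ->
  (forall j : 'I_n, measurable_fun setT (X j)) ->
  (forall j : 'I_n, indep_of_ge j.+1 (X j)) ->
  (forall (j : 'I_n) W, (k <= j < l)%N ->
     (\int[P]_w' (expR (X j (upd W j (Z j w'))))%:E <= (expR a)%:E)%E) ->
  (P [set w | A (data w) /\ (s <= \sum_(j < n | (k <= j < l)%N) (X j (data w) - a))%R]
     <= (expR (- s))%:E * P (data @^-1` A))%E.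
Proof.
move=> mA Ak mX Xk Xa.
have mdA : measurable (data @^-1` A).
  by rewrite -[X in measurable X]setTI; exact: measurable_data.
pose H j W := expR (X j W - a).
have mH j : measurable_fun setT (H j).
  by apply: measurableT_comp => //; apply: measurable_funB.
have H0 j W : 0 <= H j W by exact: expR_ge0.
have := @supermartingale k l (\1_A) H.
have m1A : measurable_fun setT (\1_A : n.-tuple T' -> R) by exact: measurable_indic.
have h1A W : 0 <= (\1_A : n.-tuple T' -> R) W by rewrite indicE ler0n.
move=> /(_ m1A h1A).
have ik : indep_of_ge k (\1_A : n.-tuple T' -> R).
  move=> W j z kj; rewrite !indicE; congr (_%:R : R).
  by apply: congr1; apply/idP/idP; rewrite !inE Ak.
move=> /(_ ik mH H0).
have Hk (j : 'I_n) : indep_of_ge j.+1 (H j) by move=> W i z ji; rewrite /H Xk.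
move=> /(_ Hk).
have H1 (j : 'I_n) W : (k <= j < l)%N ->
     (\int[P]_w' (H j (upd W j (Z j w')))%:E <= 1)%E.
  move=> kjl; rewrite /H.
  under eq_integral do rewrite expRD EFinM.
  rewrite ge0_integralZr//.
  - apply: (@le_trans _ _ ((expR a)%:E * (expR (- a))%:E)%E).
      by apply: lee_wpmul2r; [rewrite lee_fin expR_ge0|exact: Xa].
    by rewrite -EFinM -expRD subrr expR0.
  - apply/measurable_EFinP; apply: measurableT_comp => //.
    apply: (measurableT_comp (mX j)).
    apply: (measurableT_comp (g := fun z => (W, Z j z)) (measurable_upd j)).
    exact: measurable_fun_pair.
move=> /(_ H1) SM.
have mS : measurable [set w | A (data w) /\ s <= \sum_(j < n | (k <= j < l)%N) (X j (data w) - a)].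
  apply: measurableI => //.
  rewrite -[X in measurable X]setTI.
  apply: (measurable_fun_le (f := fun=> s) (g := fun w => \sum_(j < n | (k <= j < l)%N) (X j (data w) - a))) => //.
  apply: measurable_sum_cond => j _; apply: measurable_funB => //.
  by apply: (measurableT_comp (mX j)); exact: measurable_data.
set S := [set w | _] in mS *.
have -> : P S = ((expR (- s))%:E * ((expR s)%:E * P S))%E.
  by rewrite muleA -EFinM -expRD addNr expR0 mul1e.
apply: lee_wpmul2l; first by rewrite lee_fin expR_ge0.
have -> : P (data @^-1` A) = (\int[P]_w (\1_A (data w))%:E)%E.
  by rewrite -(setIT (_ @^-1` _)) -(@integral_indic _ _ _ P setT)//; apply: eq_integral.
apply: le_trans SM.
rewrite -(setIT S) -(@integral_indic _ _ _ P setT)// -ge0_integralZl//; last first.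
  by apply/measurable_EFinP; exact: measurable_indic.
have m1S : measurable_fun setT (fun w => ((expR s)%:E * (\1_S w)%:E)%E).
  by apply: emeasurable_funM => //; apply/measurable_EFinP; exact: measurable_indic.
apply: ge0_le_integral => //.
- apply/measurable_EFinP; apply: measurable_funM.
    by apply: measurableT_comp; [exact: measurable_indic|exact: measurable_data].
  apply: measurable_prod_cond => j _.
  by apply: (measurableT_comp (mH j)); exact: measurable_data.
- move=> w _; rewrite -EFinM lee_fin indicE.
  case: (boolP (w \in _)) => [|_]; last by rewrite mulr0 mulr_ge0// ?indicE ?ler0n// prodr_ge0.
  rewrite inE /S /= => -[Aw sw].
  rewrite mulr1 indicE mem_set//= mul1r /H -expR_sum ler_expR.
  exact: sw.
Qed.

End tuple_law.

(** * Rotation invariance of the Gaussian law *)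

Section density.
Context {R : realType} {d : measure_display} {T : measurableType d}.
Import HBNNSimple.

(** Checked on simple functions, then passed to the limit by monotone convergence on both sides. *)
Lemma ge0_integral_density (m n : {measure set T -> \bar R}) (p : T -> R)
    (f : T -> \bar R) :
  measurable_fun setT p -> (forall x, 0 <= p x) ->
  (forall A, measurable A -> n A = \int[m]_(x in A) (p x)%:E)%E ->
  measurable_fun setT f -> (forall x, 0 <= f x)%E ->
  (\int[n]_x f x = \int[m]_x (f x * (p x)%:E))%E.
Proof.
move=> mp p0 np mf f0.
pose g : {nnsfun T >-> R}^nat := nnsfun_approx measurableT mf.
have gf k x : (0 <= (g k x)%:E)%E by rewrite lee_fin.
transitivity (limn (fun k => \int[n]_x (g k x)%:E))%E.
  rewrite -monotone_convergence//=.
  - apply: eq_integral => x _; apply/esym/cvg_lim => //.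
    exact: cvg_nnsfun_approx.
  - by move=> k; apply/measurable_EFinP.
  - by move=> x _ a b ab; rewrite lee_fin; exact/lefP/nd_nnsfun_approx.
transitivity (limn (fun k => \int[m]_x ((g k x)%:E * (p x)%:E)))%E; last first.
  rewrite -monotone_convergence//=.
  - apply: eq_integral => x _; apply/cvg_lim => //.
    apply: cvgeZr => //.
    exact: cvg_nnsfun_approx.
  - by move=> k; apply: emeasurable_funM; exact/measurable_EFinP.
  - by move=> k x _; rewrite -EFinM lee_fin mulr_ge0.
  - move=> x _ a b ab; apply: lee_wpmul2r; first by rewrite lee_fin.
    by rewrite lee_fin; exact/lefP/nd_nnsfun_approx.
congr (limn _); apply/funext => k; set h := g k.
rewrite integralT_nnsfun sintegralE fsbig_finite//=.
have term0 y x : 0 <= y * \1_(h @^-1` [set y]) x.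
  rewrite indicE; case: (boolP (x \in _)) => [|_]; last by rewrite mulr0.
  by rewrite inE/= => <-; rewrite mulr1.
under [RHS]eq_integral => x _.
  rewrite fimfunE fsbig_finite//= -EFinM big_distrl/= -sumEFin.
  over.
rewrite ge0_integral_sum//; first last.
- by move=> y x _; rewrite lee_fin mulr_ge0.
- by move=> y; apply/measurable_EFinP; apply: measurable_funM => //; apply: measurable_funM.
apply: eq_bigr => y _.
have [y0|y0] := ltP y 0.
  rewrite (_ : h @^-1` [set y] = set0); last by rewrite preimage_nnfun0.
  rewrite measure0 mule0; apply/esym/integral0_eq => x _.
  by rewrite indic0 mulr0 mul0r.
rewrite np// integral_mkcond.
rewrite -ge0_integralZl//.
- apply: eq_integral => x _; rewrite patchE indicE.
  by case: (x \in _); rewrite ?mulr1 ?mulr0 ?mul0r ?mule0.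
- apply/measurable_restrict => //.
  by rewrite setTI; apply: measurable_funTS; exact/measurable_EFinP.
- by move=> x _; rewrite patchE; case: ifP => // _; rewrite lee_fin.
Qed.
End density.

Section gaussian_plane.
Context {R : realType}.
Local Notation mu := (@lebesgue_measure R).
Local Notation N01 := (@normal_prob R 0 1).
Local Notation pdf := (@normal_pdf R 0 1).

Let addr_set (c : R) (b1 b2 : R) (B1 B2 : bool):
  (fun x : R => x + c) @^-1` [set` Interval (BSide B1 b1) (BSide B2 b2)] =
  [set` Interval (BSide B1 (b1 - c)) (BSide B2 (b2 - c))].
Proof.
apply/seteqP; split => x /=; rewrite !in_itv/=;
  by case: B1; case: B2; rewrite /= ?lerBlDr ?ltrBlDr ?ltrBrDr ?lerBrDr.
Qed.

Lemma lebesgue_measureD (c : R) (A : set R) : measurable A ->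
  pushforward mu ((fun x : R => x + c) : measurableTypeR R -> measurableTypeR R) A = mu A.
Proof.
move=> mA.
have mf : measurable_fun setT ((fun x : R => x + c) : measurableTypeR R -> measurableTypeR R).
  by apply: measurable_funD.
apply/esym/(@lebesgue_measure_unique _
  (measure_function_pushforward__canonical__measure_function_Measure mu mf)) => //= _ [[a b]] _ <-.
rewrite /pushforward addr_set/= !lebesgue_measure_itv/=.
rewrite !lte_fin ltrD2r; case: ifPn => // _.
by rewrite -!EFinD; congr (_%:E); ring.
Qed.

Lemma ge0_integralD_shift (c : R) (f : R -> \bar R) :
  measurable_fun setT f -> (forall r, 0 <= f r)%E ->
  (\int[mu]_r f (r + c)%R = \int[mu]_r f r)%E.
Proof.
move=> mf f0.
have mg : measurable_fun setT ((fun x : R => x + c) : measurableTypeR R -> measurableTypeR R).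
  by apply: measurable_funD.
transitivity (\int[pushforward mu ((fun x : R => x + c)%R : measurableTypeR R -> measurableTypeR R)]_r f r)%E.
  by rewrite ge0_integral_pushforward.
by apply: (@eq_measure_integral _ _ _ setT mu
  (measure_function_pushforward__canonical__measure_function_Measure mu mg)) => A mA _; exact: lebesgue_measureD.
Qed.

Lemma ge0_integral_normal (f : R -> \bar R) :
  measurable_fun setT f -> (forall r, 0 <= f r)%E ->
  (\int[N01]_x f x = \int[mu]_x (f x * (pdf x)%:E))%E.
Proof.
move=> mf f0.
apply: ge0_integral_density => //.
- exact: measurable_normal_pdf.
- by move=> x; exact: normal_pdf_ge0.
Qed.

Lemma normal_pdf01E x : pdf x = normal_peak 1 * expR (- x ^+ 2 / 2).
Proof. by rewrite normal_pdfE// /normal_fun subr0 expr1n. Qed.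

Definition plane_integral (m : set R -> \bar R) (f : R -> R -> \bar R) : \bar R :=
  (\int[m]_x \int[m]_y f x y)%E.

Definition measurable2 (f : R -> R -> \bar R) :=
  measurable_fun setT (fun p : R * R => f p.1 p.2).

Lemma measurable2_comp (f : R -> R -> \bar R) (g h : R -> R -> R) :
  measurable2 f ->
  measurable_fun setT (fun p : R * R => g p.1 p.2) ->
  measurable_fun setT (fun p : R * R => h p.1 p.2) ->
  measurable2 (fun x y => f (g x y) (h x y)).
Proof.
move=> mf mg mh.
exact: (measurableT_comp (g := fun p : R * R => (g p.1 p.2, h p.1 p.2)) mf
  (measurable_fun_pair mg mh)).
Qed.

Lemma measurable_lin2 (u v : R) :
  measurable_fun setT (fun p : R * R => u * p.1 + v * p.2).
Proof. by apply: measurable_funD; apply: measurable_funM. Qed.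

Lemma measurable2_lin (f : R -> R -> \bar R) (a b c d : R) : measurable2 f ->
  measurable2 (fun x y => f (a * x + b * y) (c * x + d * y)).
Proof.
move=> mf; exact: (measurable2_comp mf (measurable_lin2 a b) (measurable_lin2 c d)).
Qed.

Lemma measurable2_l (f : R -> R -> \bar R) y : measurable2 f ->
  measurable_fun setT (fun x => f x y).
Proof.
move=> mf; apply: (measurableT_comp (g := fun x : R => (x, y)) mf).
exact: measurable_fun_pair.
Qed.

Lemma measurable2_r (f : R -> R -> \bar R) x : measurable2 f ->
  measurable_fun setT (fun y => f x y).
Proof.
move=> mf; apply: (measurableT_comp (g := fun y : R => (x, y)) mf).
exact: measurable_fun_pair.
Qed.

Section abstract_rotation.
Variables (lam : {sigma_finite_measure set R -> \bar R}) (N : probability R R).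
Hypothesis shift : forall c (f : R -> \bar R),
  measurable_fun setT f -> (forall r, 0 <= f r)%E ->
  (\int[lam]_r f (r + c)%R = \int[lam]_r f r)%E.
Hypothesis dens : forall f : R -> \bar R,
  measurable_fun setT f -> (forall r, 0 <= f r)%E ->
  (\int[N]_x f x = \int[lam]_x (f x * (pdf x)%:E))%E.

Let lam_swap (f : R -> R -> \bar R) : measurable2 f -> (forall x y, 0 <= f x y)%E ->
  plane_integral lam f = (\int[lam]_y \int[lam]_x f x y)%E.
Proof.
move=> mf f0.
exact: (@fubini_tonelli _ _ _ _ _ lam lam (fun p => f p.1 p.2) mf (fun p => f0 p.1 p.2)).
Qed.

(* A rotation is a product of three shears, and shears preserve Lebesgue
   measure on the plane by Fubini and translation invariance. *)
Let shear1 (a : R) (f : R -> R -> \bar R) :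
  measurable2 f -> (forall x y, 0 <= f x y)%E ->
  plane_integral lam (fun x y => f (1 * x + a * y) (0 * x + 1 * y)) = plane_integral lam f.
Proof.
move=> mf f0.
rewrite lam_swap//; last exact: measurable2_lin.
rewrite lam_swap//.
apply: eq_integral => y _ /=.
rewrite -(shift (a * y) (measurable2_l y mf))//.
by apply: eq_integral => x _; rewrite mul1r mul0r add0r mul1r.
Qed.

Let shear2 (a : R) (f : R -> R -> \bar R) :
  measurable2 f -> (forall x y, 0 <= f x y)%E ->
  plane_integral lam (fun x y => f (1 * x + 0 * y) (a * x + 1 * y)) = plane_integral lam f.
Proof.
move=> mf f0.
apply: eq_integral => x _ /=.
rewrite -(shift (a * x) (measurable2_r x mf))//.
by apply: eq_integral => y _; rewrite mul1r mul0r addr0 mul1r addrC.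
Qed.

Lemma lebesgue_rotation (c s : R) (f : R -> R -> \bar R) :
  c ^+ 2 + s ^+ 2 = 1 -> 0 <= c ->
  measurable2 f -> (forall x y, 0 <= f x y)%E ->
  plane_integral lam (fun x y => f (c * x + s * y) (- s * x + c * y)) =
  plane_integral lam f.
Proof.
move=> cs c0 mf f0.
have c1 : 1 + c != 0 by rewrite gt_eqF// ltr_wpDr.
(* The tangent of half the angle: the shears by a, - s and a compose to the rotation. The sign of c
   keeps 1 + c away from 0. *)
pose a := s / (1 + c).
have ac : a * (1 + c) = s by rewrite /a divfK.
have as_ : 1 - a * s = c.
  apply: (mulIf c1); rewrite mulrBl mul1r mulrAC ac -expr2 -[1 in LHS]cs.
  by rewrite -[1 in RHS]mulr1; ring: cs.
have m1 := measurable2_lin 1 a 0 1 mf.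
have m2 := measurable2_lin 1 0 (- s) 1 m1.
rewrite -(shear1 a mf f0).
rewrite -(shear2 (- s) m1 (fun x y => f0 _ _)).
rewrite -(shear1 a m2 (fun x y => f0 _ _)).
apply: eq_integral => x _; apply: eq_integral => y _; congr f.
  transitivity ((1 - a * s) * x + (a + a * (1 - a * s)) * y); last by ring.
  by rewrite as_ -[X in X + a * c]mulr1 -mulrDr ac.
by rewrite -as_; ring.
Qed.

Let normal2 (g : R -> R -> \bar R) : measurable2 g -> (forall x y, 0 <= g x y)%E ->
  plane_integral N g = plane_integral lam (fun x y => g x y * (pdf x * pdf y)%:E)%E.
Proof.
move=> mg g0.
have mG := @measurable_fun_fubini_tonelli_F _ _ _ _ _ N (fun p => g p.1 p.2) mg (fun p => g0 p.1 p.2).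
rewrite /plane_integral dens//; last by move=> x; apply: integral_ge0.
apply: eq_integral => x _.
have mgx := measurable2_r x mg.
rewrite dens// -ge0_integralZr//.
- by apply: eq_integral => y _; rewrite -muleA -EFinM mulrC.
- apply: emeasurable_funM => //; apply/measurable_EFinP; exact: measurable_normal_pdf.
- by move=> y _; rewrite mule_ge0// lee_fin normal_pdf_ge0.
- by rewrite lee_fin normal_pdf_ge0.
Qed.

(** The product density is a function of x^2 + y^2, so the rotation invariance of Lebesgue measure
    carries over. *)
Lemma normal_rotation (c s : R) (f : R -> R -> \bar R) :
  c ^+ 2 + s ^+ 2 = 1 -> 0 <= c ->
  measurable2 f -> (forall x y, 0 <= f x y)%E ->
  plane_integral N (fun x y => f (c * x + s * y) (- s * x + c * y)) =
  plane_integral N f.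
Proof.
move=> cs c0 mf f0.
rewrite (normal2 (measurable2_lin c s (- s) c mf) (fun x y => f0 _ _)) (normal2 mf f0).
pose h x y := (f x y * (pdf x * pdf y)%:E)%E.
have mh : measurable2 h.
  apply: emeasurable_funM => //; apply/measurable_EFinP; apply: measurable_funM.
    by apply: measurableT_comp => //; exact: measurable_normal_pdf.
  by apply: measurableT_comp => //; exact: measurable_normal_pdf.
have h0 x y : (0 <= h x y)%E by rewrite mule_ge0// lee_fin mulr_ge0 ?normal_pdf_ge0.
rewrite -[RHS](lebesgue_rotation cs c0 mh h0).
apply: eq_integral => x _; apply: eq_integral => y _; congr (_ * _%:E)%E.
rewrite !normal_pdf01E mulrACA [RHS]mulrACA -!expRD; congr (_ * expR _).
have : x ^+ 2 + y ^+ 2 = (c ^+ 2 + s ^+ 2) * (x ^+ 2 + y ^+ 2) by rewrite cs mul1r.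
by move=> E; rewrite -!mulrDl; congr (_ / 2); rewrite -!opprD E; congr (- _); ring.
Qed.

Lemma plane_integralC (f : R -> R -> \bar R) : measurable2 f -> (forall x y, 0 <= f x y)%E ->
  plane_integral N (fun x y => f y x) = plane_integral N f.
Proof.
move=> mf f0.
exact: (esym (@fubini_tonelli _ _ _ _ _ N N (fun p => f p.1 p.2) mf (fun p => f0 p.1 p.2))).
Qed.

End abstract_rotation.

Let idR : measurableTypeR R -> R := idfun.

Let measurable_idR : measurable_fun setT idR.
Proof. exact: measurable_id. Qed.

(* [normal_prob] and [lebesgue_measure] live on [measurableTypeR R], whose
   display differs from the one of the canonical structure of R. *)
Definition gauss (A : set R) : \bar R := N01 A.

Let gaussm := measure_function_pushforward__canonical__measure_function_Measure N01 measurable_idR.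
HB.instance Definition _ := isMeasure.Build _ R R gauss
  (measure0 gaussm) (measure_ge0 gaussm) (@measure_semi_sigma_additive _ _ _ gaussm).

Let gaussT : gauss setT = 1%E. Proof. exact: probability_setT. Qed.
HB.instance Definition _ := @Measure_isProbability.Build _ R R gauss gaussT.

Definition lebR (A : set R) : \bar R := mu A.

Let lebm := measure_function_pushforward__canonical__measure_function_Measure mu measurable_idR.
HB.instance Definition _ := isMeasure.Build _ R R lebR
  (measure0 lebm) (measure_ge0 lebm) (@measure_semi_sigma_additive _ _ _ lebm).

Let leb_sf : sigma_finite setT lebR.
Proof. exact: (@sigma_finiteT _ _ _ mu). Qed.
HB.instance Definition _ := @Measure_isSigmaFinite.Build _ R R lebR leb_sf.

Lemma integral_gaussE (f : R -> \bar R) :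
  measurable_fun setT f -> (forall r, 0 <= f r)%E ->
  (\int[gauss]_x f x = \int[N01]_x f x)%E.
Proof.
move=> mf f0; exact: (ge0_integral_pushforward measurable_idR N01 measurableT mf (fun y _ => f0 y)).
Qed.

Lemma integral_lebRE (f : R -> \bar R) :
  measurable_fun setT f -> (forall r, 0 <= f r)%E ->
  (\int[lebR]_x f x = \int[mu]_x f x)%E.
Proof.
move=> mf f0; exact: (ge0_integral_pushforward measurable_idR mu measurableT mf (fun y _ => f0 y)).
Qed.

Let shiftR c (f : R -> \bar R) :
  measurable_fun setT f -> (forall r, 0 <= f r)%E ->
  (\int[lebR]_r f (r + c)%R = \int[lebR]_r f r)%E.
Proof.
move=> mf f0; rewrite !integral_lebRE//; first exact: ge0_integralD_shift.
by apply: measurableT_comp => //; apply: measurable_funD.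
Qed.

Lemma gauss_density (f : R -> \bar R) :
  measurable_fun setT f -> (forall r, 0 <= f r)%E ->
  (\int[gauss]_x f x = \int[lebR]_x (f x * (pdf x)%:E))%E.
Proof.
move=> mf f0; rewrite integral_gaussE// ge0_integral_normal// integral_lebRE//.
  by apply: emeasurable_funM => //; apply/measurable_EFinP; exact: measurable_normal_pdf.
by move=> r; rewrite mule_ge0// lee_fin normal_pdf_ge0.
Qed.

Definition plane := plane_integral gauss.

Lemma plane_rotation (c s : R) (f : R -> R -> \bar R) :
  c ^+ 2 + s ^+ 2 = 1 -> 0 <= c ->
  measurable2 f -> (forall x y, 0 <= f x y)%E ->
  plane (fun x y => f (c * x + s * y) (- s * x + c * y)) = plane f.
Proof.
move=> cs c0 mf f0.
have := @normal_rotation (lebR : {sigma_finite_measure set R -> \bar R})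
  (gauss : probability R R) shiftR gauss_density c s f cs c0 mf f0.
exact.
Qed.

Lemma planeC (f : R -> R -> \bar R) : measurable2 f -> (forall x y, 0 <= f x y)%E ->
  plane (fun x y => f y x) = plane f.
Proof. exact: plane_integralC. Qed.

End gaussian_plane.

(* Joint law of (x.a, x.b): by induction on the coordinates it is the law of
   (al g, ga g + de h), the lower triangular square root of the Gram matrix;
   adding a coordinate costs two plane rotations. *)
Section gaussian_pairs.
Context {R : realType} {disp : measure_display} {T : measurableType disp}
  (P : probability T R) {n : nat}.
Variable X : 'I_n -> T -> R.
Hypothesis mX : forall i, measurable_fun setT (X i).
Hypothesis iX : mutually_independent P X.
Hypothesis gX : forall i (A : set R), measurable A -> P (X i @^-1` A) = normal_prob 0 1 A.
Variables a b : 'I_n -> R.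

Lemma integral_gauss_coord i (f : R -> \bar R) :
  measurable_fun setT f -> (forall r, 0 <= f r)%E ->
  (\int[P]_w f (X i w) = \int[gauss]_x f x)%E.
Proof.
move=> mf f0.
transitivity (\int[pushforward P (X i)]_x f x)%E.
  by rewrite ge0_integral_pushforward.
apply: (@eq_measure_integral _ _ _ setT gauss
  (measure_function_pushforward__canonical__measure_function_Measure P (mX i))).
by move=> A mA _; rewrite /= /pushforward gX.
Qed.

(** Polar form of (p, q). At the origin the angle is arbitrary and is taken to be 0. *)
Lemma rotate_pair (p q : R) : exists c s m : R,
  [/\ c ^+ 2 + s ^+ 2 = 1, 0 <= p -> 0 <= c, 0 <= m,
      p = m * c & q = m * s].
Proof.
have [pq0|pq0] := eqVneq (p ^+ 2 + q ^+ 2) 0.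
  exists 1, 0, 0; split => //; rewrite ?expr1n ?expr0n ?addr0//=.
  - by move/eqP: pq0; rewrite paddr_eq0 ?sqr_ge0// !sqrf_eq0 mul0r => /andP[/eqP].
  - by move/eqP: pq0; rewrite paddr_eq0 ?sqr_ge0// !sqrf_eq0 mul0r => /andP[_ /eqP].
pose m := Num.sqrt (p ^+ 2 + q ^+ 2).
have m2 : m ^+ 2 = p ^+ 2 + q ^+ 2 by rewrite sqr_sqrtr// addr_ge0 ?sqr_ge0.
have m0 : m != 0 by rewrite -sqrf_eq0 m2.
exists (p / m), (q / m), m; split => //.
- by rewrite !expr_div_n -mulrDl -m2 divff// sqrf_eq0.
- by move=> p0; rewrite divr_ge0// sqrtr_ge0.
- by rewrite sqrtr_ge0.
- by rewrite mulrC divfK.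
- by rewrite mulrC divfK.
Qed.

Let Sa (k : nat) (w : T) := \sum_(i < n | (i < k)%N) a i * X i w.
Let Sb (k : nat) (w : T) := \sum_(i < n | (i < k)%N) b i * X i w.

Let partial_law (k : nat) : exists al ga de : R,
  [/\ 0 <= al /\ 0 <= de, al ^+ 2 = \sum_(i < n | (i < k)%N) a i ^+ 2,
      al * ga = \sum_(i < n | (i < k)%N) a i * b i,
      ga ^+ 2 + de ^+ 2 = \sum_(i < n | (i < k)%N) b i ^+ 2 &
      forall f : R -> R -> \bar R, measurable2 f -> (forall x y, 0 <= f x y)%E ->
      (\int[P]_w f (Sa k w) (Sb k w))%E = plane (fun g h => f (al * g) (ga * g + de * h))].
Proof.
elim: k => [|k [al [ga [de [[al0 de0] Ha Hab Hb IH]]]]].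
  exists 0, 0, 0; split; rewrite ?expr0n ?mul0r ?addr0 ?big_pred0//.
  move=> f mf f0; rewrite /plane /plane_integral.
  rewrite (eq_integral (fun=> f 0 0)); last by move=> w _; rewrite /Sa /Sb !big_pred0.
  rewrite [RHS](eq_integral (fun=> f 0 0)).
    by rewrite (integral_prob_cst P) (integral_prob_cst gauss).
  move=> x _; rewrite (eq_integral (fun=> f 0 0)); last by move=> y _; rewrite !mul0r addr0.
  exact: (integral_prob_cst gauss).
have [kn|nk] := ltnP k n; last first.
  have E (F : 'I_n -> R) : \sum_(i < n | (i < k.+1)%N) F i = \sum_(i < n | (i < k)%N) F i.
    by apply: eq_bigl => i; rewrite ltnS (leq_trans (ltn_ord i) nk) (ltnW (leq_trans (ltn_ord i) nk)).
  exists al, ga, de; rewrite !E; split => // f mf f0.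
  by rewrite -IH//; apply: eq_integral => w _; rewrite /Sa /Sb !E.
pose j := Ordinal kn.
have E (F : 'I_n -> R) : \sum_(i < n | (i < k.+1)%N) F i = F j + \sum_(i < n | (i < k)%N) F i.
  rewrite (bigD1 j)//=; congr (_ + _); apply: eq_bigl => i.
  by rewrite ltnS [RHS]ltn_neqAle andbC.
(* The first rotation merges the new coordinate and the first Gaussian into one of scale m; p and r
   are the coefficients of the second form in the rotated frame. The leftover r z + de h is merged
   in turn by the second rotation. *)
have [c [s [m [cs c0 m0 alE aE]]]] := rotate_pair al (a j).
have {}c0 := c0 al0.
pose p := ga * c + b j * s.
pose r := b j * c - ga * s.
have [c' [s' [m' [cs' c0' m0' deE rE]]]] := rotate_pair de r.
have {}c0' := c0' de0.
have m2 : m ^+ 2 = al ^+ 2 + a j ^+ 2.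
  by rewrite alE aE !exprMn -mulrDr cs mulr1.
have m2' : m' ^+ 2 = de ^+ 2 + r ^+ 2.
  by rewrite deE [in RHS]rE !exprMn -mulrDr cs' mulr1.
exists m, p, m'; rewrite !E; split => //; last 1 first.
  move=> f mf f0.
have mS (F : 'I_n -> R) l : measurable_fun setT (fun w => \sum_(i < n | (i < l)%N) F i * X i w).
  by apply: measurable_sum_cond => i _; apply: measurable_funM.
pose G (W : n.-tuple R) := f (\sum_(i < n | (i < k.+1)%N) a i * tnth W i)
   (\sum_(i < n | (i < k.+1)%N) b i * tnth W i).
have mlinW (F : 'I_n -> R) l : measurable_fun setT (fun W : n.-tuple R => \sum_(i < n | (i < l)%N) F i * tnth W i).
  apply: measurable_sum_cond => i _; apply: measurable_funM => //.
  exact: measurable_tnth.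
have mG : measurable_fun setT G.
  exact: (measurableT_comp (g := fun W => (_, _)) mf (measurable_fun_pair (mlinW a k.+1) (mlinW b k.+1))).
transitivity (\int[P]_w G (data X w))%E.
  by apply: eq_integral => w _; rewrite /G /Sa /Sb; congr f; apply: eq_bigr => i _; rewrite tnth_data.
rewrite (integral_resample mX iX j mG (fun W => f0 _ _)).
transitivity (\int[P]_w \int[P]_w' f (a j * X j w' + Sa k w)%R (b j * X j w' + Sb k w)%R)%E.
  apply: eq_integral => w _; apply: eq_integral => w' _; rewrite /G !E !tnth_upd eqxx.
  congr f; congr (_ + _); apply: eq_bigr => i ik.
    by rewrite tnth_upd ifF ?tnth_data//; apply/eqP => ij; rewrite ij ltnn in ik.
  by rewrite tnth_upd ifF ?tnth_data//; apply/eqP => ij; rewrite ij ltnn in ik.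
pose g3 (p : T * T) := f (a j * X j p.2 + Sa k p.1) (b j * X j p.2 + Sb k p.1).
have mg3 : measurable_fun setT g3.
  apply: (measurableT_comp (g := fun p : T * T => (a j * X j p.2 + Sa k p.1, b j * X j p.2 + Sb k p.1)) mf).
  apply: measurable_fun_pair; apply: measurable_funD.
  - by apply: measurable_funM => //; exact: (measurableT_comp (mX j)).
  - exact: (measurableT_comp (mS a k)).
  - by apply: measurable_funM => //; exact: (measurableT_comp (mX j)).
  - exact: (measurableT_comp (mS b k)).
rewrite (@fubini_tonelli _ _ _ _ _ P P g3 mg3 (fun p => f0 _ _)) /g3/=.
pose f' z x y := f (a j * z + x) (b j * z + y).
have mf' z : measurable2 (f' z).
  by apply: (measurable2_comp mf); apply: measurable_funD.
transitivity (\int[P]_w' plane (fun g h => f' (X j w') (al * g)%R (ga * g + de * h)%R))%E.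
  by apply: eq_integral => w' _; rewrite -(IH (f' (X j w')) (mf' _) (fun x y => f0 _ _)).
pose F3 (p : R * (R * R)) := f' p.1 (al * p.2.1) (ga * p.2.1 + de * p.2.2).
have m1 : measurable_fun setT (fun p : R * (R * R) => p.2.1) by exact: measurableT_comp.
have m2s : measurable_fun setT (fun p : R * (R * R) => p.2.2) by exact: measurableT_comp.
have mF3 : measurable_fun setT F3.
  apply: (measurableT_comp (g := fun p : R * (R * R) => (a j * p.1 + al * p.2.1, b j * p.1 + (ga * p.2.1 + de * p.2.2))) mf).
  apply: measurable_fun_pair; apply: measurable_funD.
  - exact: measurable_funM.
  - exact: measurable_funM.
  - exact: measurable_funM.
  - by apply: measurable_funD; exact: measurable_funM.
  pose Phi z := plane (fun g h => F3 (z, (g, h))).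
  have mPhi2 : measurable_fun setT (fun q : R * R => \int[gauss]_h F3 (q.1, (q.2, h)))%E.
    have n1 : measurable_fun setT (fun q : (R * R) * R => q.1.1) by exact: measurableT_comp.
    have n2 : measurable_fun setT (fun q : (R * R) * R => q.1.2) by exact: measurableT_comp.
    have mF3' : measurable_fun setT (fun q : (R * R) * R => F3 (q.1.1, (q.1.2, q.2))).
      apply: (measurableT_comp (g := fun q : (R * R) * R => (q.1.1, (q.1.2, q.2))) mF3).
      by apply: measurable_fun_pair => //; exact: measurable_fun_pair.
    exact: (@measurable_fun_fubini_tonelli_F _ _ _ _ _ gauss _ mF3' (fun p => f0 _ _)).
  have Phi20 (q : R * R) : (0 <= \int[gauss]_h F3 (q.1, (q.2, h)))%E.
    by apply: integral_ge0 => h _; exact: f0.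
  have mPhi : measurable_fun setT Phi.
    exact: (@measurable_fun_fubini_tonelli_F _ _ _ _ _ gauss _ mPhi2 Phi20).
  have Phi0 z : (0 <= Phi z)%E.
    by apply: integral_ge0 => g _; exact: (Phi20 (z, g)).
  transitivity (\int[P]_w' Phi (X j w'))%E; first by [].
  rewrite (integral_gauss_coord j mPhi Phi0).
  pose k' g z := (\int[gauss]_h f (m * g)%R (p * g + (r * z + de * h))%R)%E.
  have mk' : measurable2 k'.
    have n1 : measurable_fun setT (fun q : (R * R) * R => q.1.1) by exact: measurableT_comp.
    have n2 : measurable_fun setT (fun q : (R * R) * R => q.1.2) by exact: measurableT_comp.
    apply: (@measurable_fun_fubini_tonelli_F _ _ _ _ _ gauss
      (fun q : (R * R) * R => f (m * q.1.1) (p * q.1.1 + (r * q.1.2 + de * q.2)))) => //.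
    apply: (measurableT_comp (g := fun q : (R * R) * R => (m * q.1.1, p * q.1.1 + (r * q.1.2 + de * q.2))) mf).
    apply: measurable_fun_pair; first exact: measurable_funM.
    apply: measurable_funD; first exact: measurable_funM.
    by apply: measurable_funD; exact: measurable_funM.
  have k'0 x y : (0 <= k' x y)%E by apply: integral_ge0.
  transitivity (plane (fun z g => k' (c * g + s * z) (- s * g + c * z))).
    apply: eq_integral => z _; apply: eq_integral => g _; apply: eq_integral => h _.
    rewrite /F3 /f'/=; congr f.
      by rewrite alE aE; ring.
    transitivity ((c ^+ 2 + s ^+ 2) * (b j * z + ga * g) + de * h); first by rewrite cs; ring.
    by rewrite /p /r; ring.
  rewrite (planeC (measurable2_lin c s (- s) c mk') (fun x y => k'0 _ _)).
  rewrite (plane_rotation cs c0 mk' k'0).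
  apply: eq_integral => g _.
  pose u (h z : R) := f (m * g) (p * g + m' * h).
  have mu_ : measurable2 u.
    by apply: (measurable2_comp mf) => //; apply: measurable_funD => //; apply: measurable_funM.
  transitivity (plane (fun z h => u (c' * h + s' * z) (- s' * h + c' * z))).
    apply: eq_integral => z _; apply: eq_integral => h _; rewrite /u; congr f; congr (_ + _).
    by rewrite deE rE; ring.
  rewrite (planeC (measurable2_lin c' s' (- s') c' mu_) (fun x y => f0 _ _)).
  rewrite (plane_rotation cs' c0' mu_ (fun x y => f0 _ _)).
  apply: eq_integral => h _; rewrite /u.
  exact: (integral_prob_cst gauss).
- by rewrite m2 Ha addrC.
- rewrite -Hab alE aE /p; transitivity (m * (ga * c + b j * s)) => //; ring.
- rewrite m2' -Hb; transitivity ((c ^+ 2 + s ^+ 2) * (ga ^+ 2 + b j ^+ 2) + de ^+ 2).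
    by rewrite /p /r; ring.
  by rewrite cs; ring.
Qed.

(** For orthogonal forms the triangular factor is diagonal, with entries 1 and the norm of b. *)
Lemma integral_gauss_lin (f : R -> R -> \bar R) :
  \sum_i a i ^+ 2 = 1 -> \sum_i a i * b i = 0 ->
  measurable2 f -> (forall x y, 0 <= f x y)%E ->
  (\int[P]_w f (\sum_i a i * X i w)%R (\sum_i b i * X i w)%R)%E =
  plane (fun g h => f g (Num.sqrt (\sum_i b i ^+ 2) * h)).
Proof.
move=> a1 ab0 mf f0.
have [al [ga [de [[al0 de0] Ha Hab Hb IH]]]] := partial_law n.
have E (F : 'I_n -> R) : \sum_(i < n | (i < n)%N) F i = \sum_i F i.
  by apply: eq_bigl => i; rewrite ltn_ord.
rewrite !E a1 in Ha Hab Hb; rewrite ab0 in Hab.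
have al1 : al = 1 by apply/eqP; rewrite -(eqrXn2 (n := 2))// Ha expr1n.
rewrite al1 mul1r in Hab.
rewrite Hab expr0n add0r in Hb.
rewrite -Hb sqrtr_sqr ger0_norm//.
transitivity (\int[P]_w f (Sa n w) (Sb n w))%E.
  by apply: eq_integral => w _; rewrite /Sa /Sb !E.
rewrite IH// al1 Hab.
by apply: eq_integral => g _; apply: eq_integral => h _; rewrite mul1r mul0r add0r.
Qed.

End gaussian_pairs.

(** * The sigmoid and the logistic loss *)

Section scalar.
Context {R : realType}.
Implicit Types a b x y r g : R.

Lemma expR_ge_sqr x : 0 <= x -> 1 + x + x ^+ 2 / 4 <= expR x.
Proof.
move=> x0.
have h : 1 + x / 2 <= expR (x / 2) by exact: expR_ge1Dx.
have -> : expR x = expR (x / 2) ^+ 2 by rewrite -expRM_natl; congr expR; field.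
have -> : 1 + x + x ^+ 2 / 4 = (1 + x / 2) ^+ 2 by field.
by rewrite lerXn2r// nnegrE ?expR_ge0// addr_ge0// divr_ge0.
Qed.

Lemma sqr_le_expR x : 0 <= x -> x ^+ 2 <= 4 * expR x.
Proof. by move=> x0; have := expR_ge_sqr x0; lra. Qed.

Lemma expR_sub1_le x : 0 <= x -> expR x - 1 <= x * expR x.
Proof.
move=> x0; have h := expR_ge1Dx (- x).
have : (1 - x) * expR x <= expR (- x) * expR x by rewrite ler_wpM2r// expR_ge0.
by rewrite -expRD addNr expR0 mulrBl mul1r; lra.
Qed.

(** The factor exp |x| makes the bound valid for both signs; in [bernstein] it is absorbed by the
    exponential decay of the residual. *)
Lemma expR_le_quad x : expR x <= 1 + x + x ^+ 2 * expR `|x|.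
Proof.
have [x0|x0] := leP 0 x.
  rewrite ger0_norm//; have h := expR_sub1_le x0.
  have : x * (expR x - 1) <= x * (x * expR x) by rewrite ler_wpM2l.
  by rewrite expr2 -mulrA; lra.
have [y y0 ->] : exists2 y, 0 < y & x = - y.
  by exists (- x); rewrite ?oppr_gt0 ?opprK.
rewrite normrN gtr0_norm//.
have h := expR_ge1Dx y.
have h1 : expR (- y) <= (1 + y)^-1.
  by rewrite expRN lef_pV2 ?posrE ?expR_gt0 ?addr_gt0.
have h2 : (1 + y)^-1 <= 1 - y + y ^+ 2.
  rewrite -[leLHS]mul1r ler_pdivrMr ?addr_gt0//.
  have : 0 <= y ^+ 3 by rewrite exprn_ge0// ltW.
  have -> : (1 - y + y ^+ 2) * (1 + y) = 1 + y ^+ 3 by ring.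
  lra.
have h3 : y ^+ 2 <= (- y) ^+ 2 * expR y.
  have e1 : 1 <= expR y by rewrite -[leLHS]expR0 ler_expR ltW.
  by have := ler_wpM2l (sqr_ge0 y) e1; rewrite mulr1 sqrrN.
lra.
Qed.

Lemma sigmoid_gt0 a : 0 < sigmoid a.
Proof. by rewrite invr_gt0 addr_gt0 ?expR_gt0. Qed.

Lemma sigmoidN a : sigmoid (- a) = 1 - sigmoid a.
Proof.
rewrite /sigmoid opprK expRN; have e0 := expR_gt0 a.
by field; rewrite !gt_eqF ?addr_gt0.
Qed.

Lemma sigmoid_lt1 a : sigmoid a < 1.
Proof. by have := sigmoid_gt0 (- a); rewrite sigmoidN; lra. Qed.

Lemma sigmoid_ge0 a : 0 <= sigmoid a. Proof. exact/ltW/sigmoid_gt0. Qed.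

Lemma sigmoid_le1 a : sigmoid a <= 1. Proof. exact/ltW/sigmoid_lt1. Qed.

Lemma sigmoid_le_exp a : sigmoid a <= expR a.
Proof.
rewrite -[expR a]invrK -expRN /sigmoid lef_pV2 ?posrE ?expR_gt0 ?addr_gt0 ?expR_gt0//.
by rewrite lerDr.
Qed.

Lemma sigmoidC_le_exp a : 1 - sigmoid a <= expR (- a).
Proof. by rewrite -sigmoidN sigmoid_le_exp. Qed.

Lemma sigmoid_ndecr a b : a <= b -> sigmoid a <= sigmoid b.
Proof.
move=> ab; rewrite /sigmoid lef_pV2 ?posrE ?addr_gt0 ?expR_gt0//.
by rewrite lerD2l ler_expR lerN2.
Qed.

Lemma sigmoid_diff a b : sigmoid b - sigmoid a =
  (expR (- a) - expR (- b)) * (sigmoid a * sigmoid b).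
Proof.
rewrite /sigmoid; have e0 := expR_gt0 (- a); have e1 := expR_gt0 (- b).
by field; rewrite !gt_eqF ?addr_gt0.
Qed.

Lemma sigmoid_incr a b : a < b -> sigmoid a < sigmoid b.
Proof.
move=> ab; rewrite -subr_gt0 sigmoid_diff mulr_gt0// ?mulr_gt0 ?sigmoid_gt0//.
by rewrite subr_gt0 ltr_expR ltrN2.
Qed.

Lemma sigmoid_ge_half a : 0 <= a -> 2^-1 <= sigmoid a.
Proof.
move=> a0; rewrite /sigmoid lef_pV2 ?posrE ?addr_gt0 ?expR_gt0//.
by rewrite -[leRHS]/(1 + 1) lerD2l -expR0 ler_expR oppr_le0.
Qed.

Lemma sigmoid_diff_ub a b : 0 <= a <= b ->
  sigmoid b - sigmoid a <= (b - a) * expR (- a).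
Proof.
move=> /andP[a0 ab]; rewrite sigmoid_diff.
have h : expR (- a) - expR (- b) <= (b - a) * expR (- a).
  have := expR_ge1Dx (a - b); have -> : expR (- b) = expR (a - b) * expR (- a).
    by rewrite -expRD; congr expR; ring.
  have e0 := expR_gt0 (- a); nra.
have h0 : 0 <= expR (- a) - expR (- b) by rewrite subr_ge0 ler_expR lerN2.
apply: le_trans h; rewrite ler_piMr// mulr_ile1 ?sigmoid_ge0 ?sigmoid_le1//.
Qed.

Lemma sigmoid_diff_lb a b : 0 <= a <= b ->
  (b - a) * expR (- b) / 4 <= sigmoid b - sigmoid a.
Proof.
move=> /andP[a0 ab]; rewrite sigmoid_diff.
have h : (b - a) * expR (- b) <= expR (- a) - expR (- b).
  have := expR_ge1Dx (b - a); have -> : expR (- a) = expR (b - a) * expR (- b).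
    by rewrite -expRD; congr expR; ring.
  have e0 := expR_gt0 (- b); nra.
have h0 : 0 <= (b - a) * expR (- b) by rewrite mulr_ge0 ?expR_ge0// subr_ge0.
apply: ler_pM => //.
have h1 := sigmoid_ge_half a0; have h2 := sigmoid_ge_half (le_trans a0 ab).
have : 2^-1 * 2^-1 <= sigmoid a * sigmoid b by apply: ler_pM.
by apply: le_trans; lra.
Qed.

(** As s - 1/2 is odd, only |g| matters. This reduces the bounds on the increments of q to
    nonnegative arguments. *)
Lemma gs_even r r' g : g * (sigmoid (r' * g) - sigmoid (r * g)) =
  `|g| * (sigmoid (r' * `|g|) - sigmoid (r * `|g|)).
Proof.
have [g0|g0] := leP 0 g; first by rewrite ger0_norm.
by rewrite ltr0_norm// !mulrN !sigmoidN; ring.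
Qed.

Lemma gs_ub r r' g : 0 <= r <= r' ->
  g * (sigmoid (r' * g) - sigmoid (r * g)) <= (r' - r) * (g ^+ 2 * expR (- (r * `|g|))).
Proof.
move=> /andP[r0 rr']; rewrite gs_even.
have : sigmoid (r' * `|g|) - sigmoid (r * `|g|) <= (r' * `|g| - r * `|g|) * expR (- (r * `|g|)).
  by apply: sigmoid_diff_ub; rewrite mulr_ge0//= ler_wpM2r.
move=> /(ler_wpM2l (normr_ge0 g)) /le_trans; apply.
by rewrite -mulrBl -(real_normK (num_real g)) expr2 le_eqVlt; apply/orP; left; apply/eqP; ring.
Qed.

Lemma gs_lb r r' g : 0 <= r <= r' ->
  (r' - r) * (g ^+ 2 * expR (- (r' * `|g|))) / 4 <= g * (sigmoid (r' * g) - sigmoid (r * g)).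
Proof.
move=> /andP[r0 rr']; rewrite gs_even.
have : (r' * `|g| - r * `|g|) * expR (- (r' * `|g|)) / 4 <= sigmoid (r' * `|g|) - sigmoid (r * `|g|).
  by apply: sigmoid_diff_lb; rewrite mulr_ge0//= ler_wpM2r.
move=> /(ler_wpM2l (normr_ge0 g)); apply: le_trans.
by rewrite -mulrBl -(real_normK (num_real g)) expr2 le_eqVlt; apply/orP; left; apply/eqP; ring.
Qed.

Lemma continuous_sigmoid : continuous (@sigmoid R).
Proof.
move=> a; apply: cvgV; first by rewrite gt_eqF// addr_gt0// expR_gt0.
apply: cvgD; first exact: cvg_cst.
by apply: (continuous_comp (f := -%R) (g := expR)); [exact: opp_continuous|exact: continuous_expR].
Qed.

Lemma measurable_sigmoid : measurable_fun setT (@sigmoid R).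
Proof. exact: continuous_measurable_fun continuous_sigmoid. Qed.

(** The Bregman divergence of log (1 + e^a), that is, the second-order remainder of the logistic
    loss, which is the same for both labels. *)
Definition bregman a b := ln (1 + expR (a + b)) - ln (1 + expR a) - sigmoid a * b.

Lemma bregmanE a b : bregman a b =
  ln ((1 - sigmoid a) * expR (- (sigmoid a * b)) + sigmoid a * expR ((1 - sigmoid a) * b)).
Proof.
have ea := expR_gt0 a; have eab := expR_gt0 (a + b).
have sE : sigmoid a = expR a / (1 + expR a).
  by rewrite /sigmoid expRN; field; rewrite !gt_eqF ?addr_gt0.
rewrite /bregman -[X in _ - X = _](expRK (sigmoid a * b)) -ln_div ?posrE ?addr_gt0//.
rewrite -ln_div ?posrE ?expR_gt0 ?divr_gt0 ?addr_gt0//; congr ln.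
have -> : expR ((1 - sigmoid a) * b) = expR b * expR (- (sigmoid a * b)).
  by rewrite -expRD; congr expR; ring.
rewrite mulrA -mulrDl -expRN; congr (_ * _).
by rewrite sE expRD; field; rewrite gt_eqF// addr_gt0.
Qed.

(** One of the two exponents is nonnegative: it receives the quadratic bound of [expR_ge_sqr], the
    other one only 1 + x, and the linear terms cancel. *)
Lemma bregman_arg_ge a b :
  1 + (sigmoid a * (1 - sigmoid a)) ^+ 2 / 4 * b ^+ 2 <=
  (1 - sigmoid a) * expR (- (sigmoid a * b)) + sigmoid a * expR ((1 - sigmoid a) * b).
Proof.
set s := sigmoid a.
have s0 : 0 < s := sigmoid_gt0 a; have s1 : 0 < 1 - s by rewrite subr_gt0 sigmoid_lt1.
have h1 := expR_ge1Dx (- (s * b)); have h2 := expR_ge1Dx ((1 - s) * b).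
have b2 := sqr_ge0 b.
have [b0|b0] := leP 0 b.
  have h3 := expR_ge_sqr (mulr_ge0 (ltW s1) b0).
  have k1 := ler_wpM2l (ltW s1) h1; have k2 := ler_wpM2l (ltW s0) h3.
  have k3 : (s * (1 - s)) ^+ 2 * b ^+ 2 <= s * ((1 - s) * b) ^+ 2.
    have -> : s * ((1 - s) * b) ^+ 2 = s * ((1 - s) ^+ 2 * b ^+ 2) by ring.
    have -> : (s * (1 - s)) ^+ 2 * b ^+ 2 = s * (s * ((1 - s) ^+ 2 * b ^+ 2)) by ring.
    by rewrite ler_wpM2l ?(ltW s0)// ler_piMl ?mulr_ge0 ?sqr_ge0//; lra.
  nra.
have nb : 0 <= - (s * b) by rewrite -mulrN mulr_ge0 ?(ltW s0)// oppr_ge0 ltW.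
have h3 := expR_ge_sqr nb.
have k1 := ler_wpM2l (ltW s1) h3; have k2 := ler_wpM2l (ltW s0) h2.
have k3 : (s * (1 - s)) ^+ 2 * b ^+ 2 <= (1 - s) * (- (s * b)) ^+ 2.
  have -> : (1 - s) * (- (s * b)) ^+ 2 = (1 - s) * (s ^+ 2 * b ^+ 2) by ring.
  have -> : (s * (1 - s)) ^+ 2 * b ^+ 2 = (1 - s) * ((1 - s) * (s ^+ 2 * b ^+ 2)) by ring.
  rewrite ler_wpM2l ?(ltW s1)//; apply: ler_piMl; first by rewrite mulr_ge0 ?sqr_ge0.
  by rewrite gerBl ltW.
nra.
Qed.

Lemma ln1D_ge x : 0 <= x <= 1 -> x / 2 <= ln (1 + x).
Proof.
move=> /andP[x0 x1].
have h := expR_ge1Dx (- (x / 2)).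
rewrite -[leLHS]expRK ler_ln ?posrE ?expR_gt0 ?ltr_wpDr//.
rewrite -[expR (x / 2)]invrK -expRN -[leRHS]invrK lef_pV2 ?posrE ?expR_gt0 ?invr_gt0 ?ltr_wpDr//.
apply: le_trans h; rewrite -[leLHS]mul1r ler_pdivrMr ?ltr_wpDr//; nra.
Qed.

Lemma bregman_ge0 a b : 0 <= bregman a b.
Proof.
rewrite bregmanE -ln1 ler_ln ?posrE//.
  by apply: le_trans (bregman_arg_ge a b); rewrite lerDl mulr_ge0 ?divr_ge0 ?sqr_ge0.
by apply: lt_le_trans (bregman_arg_ge a b); rewrite ltr_wpDr// mulr_ge0 ?divr_ge0 ?sqr_ge0.
Qed.

Lemma bregman_gt0 a b : b != 0 -> 0 < bregman a b.
Proof.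
move=> b0; rewrite bregmanE ln_gt0//.
apply: lt_le_trans (bregman_arg_ge a b); rewrite ltrDl mulr_gt0 ?divr_gt0//.
  by rewrite exprn_gt0// mulr_gt0 ?subr_gt0 ?sigmoid_gt0 ?sigmoid_lt1.
by rewrite exprn_even_gt0.
Qed.

Lemma sigmoid_ge_fifth a : `|a| <= 1 -> 5^-1 <= sigmoid a.
Proof.
move=> a1; apply: (@le_trans _ _ (sigmoid (-1))); last first.
  by apply: sigmoid_ndecr; move: a1; rewrite ler_norml => /andP[].
rewrite /sigmoid opprK lef_pV2 ?posrE ?addr_gt0 ?expR_gt0//.
have h := expR_ge1Dx (- 2^-1 : R).
have e1 : expR 1 * expR (- 2^-1) ^+ 2 = 1 :> R.
  by rewrite -expRM_natl -expRD -[RHS]expR0; congr expR; field.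
have h2 : 4^-1 <= expR (- 2^-1) ^+ 2 :> R by nra.
have := ler_wpM2l (expR_ge0 1) h2; rewrite e1; lra.
Qed.

(** For |a| <= 1 both s(a) and 1 - s(a) are at least 1/5, which gives (1/25)^2 / 4 = 1/2500 inside
    the logarithm; ln (1 + x) >= x / 2 costs the last factor 2. The truncation reflects the merely
    linear growth for large b. *)
Lemma bregman_lb a b : `|a| <= 1 -> Num.min 1 (b ^+ 2) / 5000 <= bregman a b.
Proof.
move=> a1; have s1 := sigmoid_ge_fifth a1.
have s2 : 5^-1 <= 1 - sigmoid a by rewrite -sigmoidN sigmoid_ge_fifth// normrN.
set m := Num.min 1 (b ^+ 2).
have m0 : 0 <= m by rewrite le_min ler01 sqr_ge0.
have m1 : m <= 1 by rewrite ge_min lexx.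
have mb : m <= b ^+ 2 by rewrite ge_min lexx orbT.
have k : 2500^-1 <= (sigmoid a * (1 - sigmoid a)) ^+ 2 / 4.
  have h : 5^-1 * 5^-1 <= sigmoid a * (1 - sigmoid a) by apply: ler_pM.
  move: h; set u := sigmoid a * _ => h; clear -h; nra.
rewrite bregmanE.
apply: (@le_trans _ _ (ln (1 + m / 2500))).
  have h : 0 <= m / 2500 <= 1 by clear -m0 m1; lra.
  have := ln1D_ge h; apply: le_trans; clear -m0; lra.
have h3 : m / 2500 <= (sigmoid a * (1 - sigmoid a)) ^+ 2 / 4 * b ^+ 2.
  apply: (@le_trans _ _ ((sigmoid a * (1 - sigmoid a)) ^+ 2 / 4 * m)).
    by rewrite [leLHS]mulrC; exact: ler_wpM2r.
  by apply: ler_wpM2l => //; rewrite divr_ge0// sqr_ge0.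
have h4 := bregman_arg_ge a b.
rewrite ler_ln ?posrE.
- by apply: le_trans h4; rewrite lerD2l.
- by clear -m0; lra.
- by apply: lt_le_trans h4; rewrite ltr_wpDr// mulr_ge0 ?divr_ge0 ?sqr_ge0.
Qed.

Lemma logistic_lossD a b (y : bool) :
  logistic_loss (a + b) y = logistic_loss a y + (sigmoid a - y%:R) * b + bregman a b.
Proof. by rewrite /logistic_loss /bregman; ring. Qed.

End scalar.

(** * Exponential moments of the standard Gaussian and lower bounds on its mass near 0 *)

Section gaussian_integrals.
Context {R : realType}.
Local Notation mu := (@lebesgue_measure R).
Local Notation pdf := (@normal_pdf R 0 1).

Lemma integral_lebRN (f : R -> \bar R) :
  measurable_fun setT f -> (forall r, 0 <= f r)%E ->
  (\int[mu]_r f (- r)%R = \int[mu]_r f r)%E.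
Proof.
move=> mf f0.
have mN : measurable_fun setT (-%R : measurableTypeR R -> measurableTypeR R).
  exact: oppr_measurable.
transitivity (\int[pushforward mu (-%R : measurableTypeR R -> measurableTypeR R)]_r f r)%E.
  by rewrite ge0_integral_pushforward.
by apply: (@eq_measure_integral _ _ _ setT mu
  (measure_function_pushforward__canonical__measure_function_Measure mu mN)) => A mA _; exact: lebesgue_measureN.
Qed.

Lemma integral_mu_expRNabs (k : R) : 0 < k ->
  (\int[mu]_x (expR (- (k * `|x|)))%:E <= (2 / k)%:E)%E.
Proof.
move=> k0.
have mE := @measurable_exponential_pdf R k.
have E0 (x : R) : (0 <= (exponential_pdf k x)%:E)%E by rewrite lee_fin exponential_pdf_ge0// ltW.
have mEN : measurable_fun setT (fun x : R => (exponential_pdf k (- x))%:E).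
  by apply/measurable_EFinP; apply: (measurableT_comp mE).
have mE' : measurable_fun setT (fun x : R => (exponential_pdf k x)%:E) by apply/measurable_EFinP.
have mexp : measurable_fun setT (fun x : R => (expR (- (k * `|x|)))%:E).
  apply/measurable_EFinP; apply: measurableT_comp => //.
  by apply: measurableT_comp => //; apply: measurable_funM => //; exact: measurableT_comp.
apply: (@le_trans _ _ (\int[mu]_x (k^-1%:E * ((exponential_pdf k x)%:E + (exponential_pdf k (- x))%:E)))%E).
  apply: le_integralT => //.
  - by apply: emeasurable_funM => //; exact: emeasurable_funD.
  - move=> x; rewrite -EFinD -EFinM lee_fin [leRHS]mulrC ler_pdivlMr//.
    have [x0|x0] := leP 0 x.
      rewrite ger0_norm// (exponential_pdfE _ x0) mulNr mulrC lerDl.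
      by rewrite exponential_pdf_ge0// ltW.
    rewrite ltr0_norm// [exponential_pdf k (- x)]exponential_pdfE ?oppr_ge0 ?(ltW x0)// mulNr mulrC lerDr.
    by rewrite exponential_pdf_ge0// ltW.
rewrite ge0_integralZl//; last 3 first.
- exact: emeasurable_funD.
- by move=> x _; rewrite adde_ge0.
- by rewrite lee_fin invr_ge0 ltW.
rewrite ge0_integralD//.
rewrite (integral_lebRN mE' E0) integral_exponential_pdf// -EFinD -EFinM lee_fin.
by rewrite mulrC.
Qed.

Lemma normal_pdf01_le1 x : pdf x <= 1.
Proof.
apply: le_trans (normal_pdf_ub _ _ _) _ => //.
rewrite /normal_peak invf_le1 ?sqrtr_gt0; last first.
  by rewrite expr1n mul1r mulrn_wgt0// pi_gt0.
rewrite -[leLHS]sqrtr1 ler_sqrt; last by rewrite expr1n mul1r mulrn_wge0// pi_ge0.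
rewrite expr1n mul1r; have := pi_ge2 R; lra.
Qed.

(** The density is at most 1, so the weight exp (- k |g|) leaves a mass O(1/k). With k of order R
    this is the source of the factor 1/R in the variance proxy. *)
Lemma gauss_expRNabs (k : R) : 0 < k ->
  (\int[gauss]_x (expR (- (k * `|x|)))%:E <= (2 / k)%:E)%E.
Proof.
move=> k0; apply: le_trans (integral_mu_expRNabs k0).
have mexp : measurable_fun setT (fun x : R => (expR (- (k * `|x|)))%:E).
  apply/measurable_EFinP; apply: measurableT_comp => //.
  by apply: measurableT_comp => //; apply: measurable_funM => //; exact: measurableT_comp.
have e0 (x : R) : (0 <= (expR (- (k * `|x|)))%:E)%E by rewrite lee_fin expR_ge0.
rewrite integral_gaussE// ge0_integral_normal//.
apply: le_integralT => //.
- by apply: emeasurable_funM => //; apply/measurable_EFinP; exact: measurable_normal_pdf.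
- by move=> x; rewrite mule_ge0// lee_fin normal_pdf_ge0.
- by move=> x; rewrite -EFinM lee_fin ler_piMr ?expR_ge0// normal_pdf01_le1.
Qed.

Lemma gauss_expR (c : R) : (\int[gauss]_x (expR (c * x))%:E = (expR (c ^+ 2 / 2))%:E)%E.
Proof.
have mexp : measurable_fun setT (fun x : R => (expR (c * x))%:E).
  apply/measurable_EFinP; apply: measurableT_comp => //.
have e0 (x : R) : (0 <= (expR (c * x))%:E)%E by rewrite lee_fin expR_ge0.
have mp : measurable_fun setT (fun x : R => (pdf x)%:E).
  by apply/measurable_EFinP; exact: measurable_normal_pdf.
have p0 (x : R) : (0 <= (pdf x)%:E)%E by rewrite lee_fin normal_pdf_ge0.
rewrite integral_gaussE// ge0_integral_normal//.
under eq_integral => x _.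
  have -> : ((expR (c * x))%:E * (pdf x)%:E)%E = ((expR (c ^+ 2 / 2))%:E * (pdf (x + - c)%R)%:E)%E.
    rewrite -!EFinM !normal_pdf01E mulrCA [in RHS]mulrCA -!expRD; congr (_ * expR _)%:E.
    by field.
  over.
rewrite ge0_integralZl//.
- by rewrite (ge0_integralD_shift (- c) mp p0) integral_normal_pdf mule1.
- by apply: (measurableT_comp mp) => //; apply: measurable_funD.
Qed.

Lemma gauss_expRabs (c : R) : (\int[gauss]_x (expR (c * `|x|))%:E <= (2 * expR (c ^+ 2 / 2))%:E)%E.
Proof.
have mexp (b : R) : measurable_fun setT (fun x : R => (expR (b * x))%:E).
  apply/measurable_EFinP; apply: measurableT_comp => //.
apply: (@le_trans _ _ (\int[gauss]_x ((expR (c * x))%:E + (expR ((- c) * x))%:E))%E).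
  apply: le_integralT.
  - apply/measurable_EFinP; apply: measurableT_comp => //.
    by apply: measurable_funM => //; exact: measurableT_comp.
  - by apply: emeasurable_funD.
  - by move=> x; rewrite lee_fin expR_ge0.
  - move=> x; rewrite -EFinD lee_fin; have [x0|x0] := leP 0 x.
      by rewrite ger0_norm// lerDl expR_ge0.
    by rewrite ltr0_norm// mulrN -mulNr lerDr expR_ge0.
rewrite ge0_integralD//.
by rewrite !gauss_expR sqrrN -EFinD lee_fin mulr2n mulrDl mul1r.
Qed.

(** The minimum of the standard normal density over [-1, 1]. *)
Definition pdf1 : R := pdf 1.

Lemma pdf1_gt0 : 0 < pdf1.
Proof. by rewrite /pdf1 normal_pdf01E mulr_gt0 ?expR_gt0// normal_peak_gt0. Qed.

Lemma gauss_itv (a b : R) : - 1 <= a -> a <= b -> b <= 1 ->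
  ((pdf1 * (b - a))%:E <= gauss `[a, b])%E.
Proof.
move=> a1 ab b1.
have -> : gauss `[a, b] = (\int[mu]_(x in `[a, b]) (pdf x)%:E)%E by [].
apply: (@le_trans _ _ (\int[mu]_(x in `[a, b]) (pdf1)%:E)%E).
  have muE : mu `[a, b] = (b - a)%:E.
    rewrite lebesgue_measure_itv/= lte_fin; case: ltP => ab'; first by rewrite -EFinD.
    by have -> : b = a; [apply/eqP; rewrite eq_le ab ab'|rewrite subrr].
  by rewrite integral_cst// [X in (_ * X)%E]muE -EFinM.
apply: ge0_le_integral => //.
- by move=> x _; rewrite lee_fin ltW// pdf1_gt0.
- by apply: measurable_funTS; apply/measurable_EFinP; exact: measurable_normal_pdf.
- move=> x; rewrite /= in_itv/= => /andP[ax xb]; rewrite lee_fin /pdf1 !normal_pdf01E.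
  rewrite ler_wpM2l ?normal_peak_ge0// ler_expR; nra.
Qed.

End gaussian_integrals.

(** * Euclidean geometry and the link function q *)

Section dot_product.
Context {R : realType} {d : nat}.
Implicit Types u v w : 'cV[R]_d.

Lemma dotC u v : dot u v = dot v u.
Proof. by apply: eq_bigr => i _; rewrite mulrC. Qed.

Lemma dotDl u v w : dot (u + v) w = dot u w + dot v w.
Proof. by rewrite -big_split; apply: eq_bigr => i _; rewrite mxE mulrDl. Qed.

Lemma dotZl (a : R) u v : dot (a *: u) v = a * dot u v.
Proof. by rewrite mulr_sumr; apply: eq_bigr => i _; rewrite mxE mulrA. Qed.

Lemma dotDr u v w : dot u (v + w) = dot u v + dot u w.
Proof. by rewrite dotC dotDl !(dotC u). Qed.

Lemma dotZr (a : R) u v : dot u (a *: v) = a * dot u v.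
Proof. by rewrite dotC dotZl dotC. Qed.

Lemma dotNl u v : dot (- u) v = - dot u v.
Proof. by rewrite -scaleN1r dotZl mulN1r. Qed.

Lemma dotNr u v : dot u (- v) = - dot u v.
Proof. by rewrite dotC dotNl dotC. Qed.

Lemma dotBl u v w : dot (u - v) w = dot u w - dot v w.
Proof. by rewrite dotDl dotNl. Qed.

Lemma dotBr u v w : dot u (v - w) = dot u v - dot u w.
Proof. by rewrite dotDr dotNr. Qed.

Lemma dot0l v : dot 0 v = 0.
Proof. by rewrite -[0](scale0r 0) dotZl mul0r. Qed.

Lemma dot0r v : dot v 0 = 0.
Proof. by rewrite dotC dot0l. Qed.

Lemma dot_suml (I : Type) (s : seq I) (p : pred I) (F : I -> 'cV[R]_d) v :
  dot (\sum_(i <- s | p i) F i) v = \sum_(i <- s | p i) dot (F i) v.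
Proof.
elim/big_rec2: _ => [|i x y _ <-]; first by rewrite dot0l.
by rewrite dotDl.
Qed.

Lemma dot_ge0 u : 0 <= dot u u.
Proof. by apply: sumr_ge0 => i _; rewrite -expr2 sqr_ge0. Qed.

Lemma dot_eq0 u : (dot u u == 0) = (u == 0).
Proof.
apply/eqP/eqP => [u0|->]; last by rewrite dot0l.
apply/matrixP => i j; rewrite ord1 mxE; apply/eqP.
move/eqP: u0; rewrite psumr_eq0; last by move=> k _; rewrite -expr2 sqr_ge0.
by move=> /allP/(_ i (mem_index_enum _))/=; rewrite -expr2 sqrf_eq0.
Qed.

Lemma l2norm_ge0 u : 0 <= l2norm u. Proof. exact: sqrtr_ge0. Qed.

Lemma l2norm_sqr u : l2norm u ^+ 2 = dot u u.
Proof. by rewrite sqr_sqrtr// dot_ge0. Qed.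

Lemma l2norm_eq0 u : (l2norm u == 0) = (u == 0).
Proof. by rewrite -sqrf_eq0 l2norm_sqr dot_eq0. Qed.

Lemma l2norm0 : l2norm (0 : 'cV[R]_d) = 0.
Proof. by apply/eqP; rewrite l2norm_eq0. Qed.

Lemma l2norm_gt0 u : (0 < l2norm u) = (u != 0).
Proof. by rewrite lt_def l2norm_ge0 andbT l2norm_eq0. Qed.

Lemma l2normZ (a : R) u : l2norm (a *: u) = `|a| * l2norm u.
Proof. by rewrite /l2norm dotZl dotZr mulrA -expr2 sqrtrM ?sqr_ge0// sqrtr_sqr. Qed.

Lemma l2normN u : l2norm (- u) = l2norm u.
Proof. by rewrite -scaleN1r l2normZ normrN1 mul1r. Qed.

Lemma cauchy_schwarz u v : `|dot u v| <= l2norm u * l2norm v.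
Proof.
have [->|v0] := eqVneq v 0; first by rewrite dot0r l2norm0 normr0 mulr0.
have nv : 0 < l2norm v by rewrite l2norm_gt0.
have := dot_ge0 (u - (dot u v / dot v v) *: v).
rewrite dotBl !dotBr !dotZl !dotZr (dotC v u) -!l2norm_sqr => h.
have {}h : (dot u v) ^+ 2 <= (l2norm u * l2norm v) ^+ 2.
  have nv2 : 0 < l2norm v ^+ 2 by rewrite exprn_gt0.
  have : 0 <= (l2norm u ^+ 2 - (dot u v) ^+ 2 / l2norm v ^+ 2).
    apply: le_trans h _; rewrite le_eqVlt; apply/orP; left; apply/eqP.
    by field; rewrite gt_eqF.
  rewrite subr_ge0 ler_pdivrMr// exprMn; exact.
by rewrite -ler_sqr ?nnegrE ?mulr_ge0 ?l2norm_ge0// real_normK ?num_real.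
Qed.

Lemma dot_le u v : dot u v <= l2norm u * l2norm v.
Proof. exact: le_trans (ler_norm _) (cauchy_schwarz u v). Qed.

Lemma l2normD u v : l2norm (u + v) <= l2norm u + l2norm v.
Proof.
rewrite -ler_sqr ?nnegrE ?addr_ge0 ?l2norm_ge0// l2norm_sqr dotDl !dotDr (dotC v u).
by rewrite sqrrD -!l2norm_sqr; have := dot_le u v; lra.
Qed.

Lemma l2norm_coord u i : `|u i 0| <= l2norm u.
Proof.
rewrite -ler_sqr ?nnegrE ?l2norm_ge0// l2norm_sqr real_normK ?num_real//.
by rewrite /dot (bigD1 i)//= -expr2 lerDl sumr_ge0// => j _; rewrite -expr2 sqr_ge0.
Qed.

Lemma l2norm_unit u : u != 0 -> dot ((l2norm u)^-1 *: u) ((l2norm u)^-1 *: u) = 1.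
Proof.
rewrite -l2norm_gt0 => u0; rewrite dotZl dotZr -l2norm_sqr.
by field; rewrite gt_eqF.
Qed.

Definition perp v u := u - dot v u *: v.

Lemma perpE v u : u = dot v u *: v + perp v u.
Proof. by rewrite /perp addrC subrK. Qed.

Lemma dot_perp v u : dot v v = 1 -> dot v (perp v u) = 0.
Proof. by move=> v1; rewrite dotBr dotZr v1 mulr1 subrr. Qed.

Lemma dot_perp_sym v u w : dot v v = 1 -> dot (perp v u) w = dot u (perp v w).
Proof. by move=> v1; rewrite /perp dotBl dotBr dotZl dotZr (dotC u v); ring. Qed.

Lemma pythagoras v u : dot v v = 1 -> l2norm u ^+ 2 = dot v u ^+ 2 + l2norm (perp v u) ^+ 2.
Proof.
move=> v1; rewrite !l2norm_sqr; move: (perpE v u) (dot_perp u v1).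
move: (perp v u) (dot v u) => p c E o.
by rewrite E dotDl !dotDr !dotZl !dotZr v1 (dotC p v) o; ring.
Qed.

Lemma l2norm_perp v u : dot v v = 1 -> l2norm (perp v u) <= l2norm u.
Proof.
move=> v1; rewrite -ler_sqr ?nnegrE ?l2norm_ge0// (pythagoras u v1).
by rewrite lerDr sqr_ge0.
Qed.

Lemma mulmx_perp v u : (1%:M - v *m v^T) *m u = perp v u.
Proof.
rewrite mulmxBl mul1mx /perp -mulmxA; congr (_ - _).
apply/matrixP => i j; rewrite !mxE big_ord1 !mxE (ord1 j) mulrC; congr (_ * _).
by apply: eq_bigr => k _; rewrite mxE.
Qed.

Lemma measurable_coord i : measurable_fun setT (fun u : 'cV[R]_d => u i 0).
Proof.
move=> _ Y mY; rewrite setTI; apply: sub_sigma_algebra => /=.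
rewrite -bigcup_seq/=; exists i => /=; first by rewrite mem_index_enum.
by exists Y => //; rewrite setTI.
Qed.

Lemma measurable_dot2 disp (T : measurableType disp) (f g : T -> 'cV[R]_d) :
  measurable_fun setT f -> measurable_fun setT g ->
  measurable_fun setT (fun t => dot (f t) (g t)).
Proof.
move=> mf mg; apply: measurable_sum => i; apply: measurable_funM.
  exact: (measurableT_comp (measurable_coord i) mf).
exact: (measurableT_comp (measurable_coord i) mg).
Qed.

Lemma measurable_dot disp (T : measurableType disp) (f : T -> 'cV[R]_d) v :
  measurable_fun setT f -> measurable_fun setT (fun t => dot (f t) v).
Proof. by move=> mf; apply: measurable_dot2. Qed.

End dot_product.

Section integral_parts.
Context {R : realType} {d1 d2 : measure_display} {T1 : measurableType d1}
  {T2 : measurableType d2}.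
Variables (m1 : {measure set T1 -> \bar R}) (m2 : {measure set T2 -> \bar R}).
Variables (f : T1 -> R) (g : T2 -> R).

(** Transfers identities known for nonnegative integrands to signed ones, through positive and
    negative parts and without integrability. *)
Lemma integral_eq_parts :
  (\int[m1]_x (Num.max (f x) 0)%:E = \int[m2]_x (Num.max (g x) 0)%:E)%E ->
  (\int[m1]_x (Num.max (- f x) 0)%:E = \int[m2]_x (Num.max (- g x) 0)%:E)%E ->
  (\int[m1]_x (f x)%:E = \int[m2]_x (g x)%:E)%E.
Proof.
move=> hp hn; rewrite integralE [RHS]integralE; congr (_ - _)%E.
  transitivity (\int[m1]_x (Num.max (f x) 0)%:E)%E; first by apply: eq_integral => x _; rewrite funeposE EFin_max.
  by rewrite hp; apply: eq_integral => x _; rewrite funeposE EFin_max.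
transitivity (\int[m1]_x (Num.max (- f x) 0)%:E)%E; first by apply: eq_integral => x _; rewrite funenegE EFin_max.
by rewrite hn; apply: eq_integral => x _; rewrite funenegE EFin_max.
Qed.

End integral_parts.

Section q_function.
Context {R : realType}.
Local Notation mu := (@lebesgue_measure R).
Local Notation pdf := (@normal_pdf R 0 1).

Lemma integral_gaussE_signed (f : R -> R) : measurable_fun setT f ->
  (\int[gauss]_x (f x)%:E = \int[normal_prob 0 1]_x (f x)%:E)%E.
Proof.
move=> mf; apply: integral_eq_parts; apply: integral_gaussE => //.
- by apply/measurable_EFinP; apply: measurable_maxr.
- by move=> r; rewrite lee_fin le_max lexx orbT.
- by apply/measurable_EFinP; apply: measurable_maxr => //; exact: measurableT_comp.
- by move=> r; rewrite lee_fin le_max lexx orbT.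
Qed.

Implicit Types r k : R.

Let qf (r g : R) := g * sigmoid (r * g).

Let mqf r : measurable_fun setT (qf r).
Proof.
apply: measurable_funM => //; apply: measurableT_comp; first exact: measurable_sigmoid.
exact: measurable_funM.
Qed.

Lemma qE r : q r = fine (\int[gauss]_g (g * sigmoid (r * g))%:E).
Proof. by rewrite /q unlock (integral_gaussE_signed (mqf r)). Qed.

Lemma norm_le_expR (x : R) : `|x| <= expR `|x|.
Proof. by apply: le_trans (expR_ge1Dx _); rewrite lerDr. Qed.

Lemma expR_half_le2 : expR (1 / 2) <= 2 :> R.
Proof.
have h := expR_ge1Dx (- (1 / 2) : R).
have e1 : expR (1 / 2) * expR (- (1 / 2)) = 1 :> R by rewrite -expRD subrr expR0.
have e0 := expR_ge0 (1 / 2 : R); nra.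
Qed.

Lemma gauss_expRabs1 : (\int[gauss]_x (expR `|x : R|)%:E <= 4%:E)%E.
Proof.
have := gauss_expRabs (1 : R); under eq_integral do rewrite mul1r.
move=> /le_trans; apply; rewrite lee_fin expr1n.
by have := expR_half_le2; lra.
Qed.

Lemma integrable_le_gauss (f : R -> R) (C : R) : measurable_fun setT f -> 0 <= C ->
  (forall x, `|f x| <= C * expR `|x|) -> gauss.-integrable setT (EFin \o f).
Proof.
move=> mf C0 fe; apply/integrableP; split; first exact/measurable_EFinP.
have mE : measurable_fun setT (fun x : R => expR `|x|).
  by apply: measurableT_comp => //; exact: measurableT_comp.
apply: (@le_lt_trans _ _ (\int[gauss]_x (C%:E * (expR `|x|)%:E))%E).
  apply: le_integralT.
  - by apply: measurableT_comp => //; exact/measurable_EFinP.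
  - by apply: emeasurable_funM => //; exact/measurable_EFinP.
  - by move=> x; exact: abse_ge0.
  - by move=> x; rewrite /= -EFinM lee_fin.
rewrite ge0_integralZl//.
- apply: (@le_lt_trans _ _ (C%:E * 4%:E)%E); last by rewrite -EFinM ltry.
  by apply: lee_wpmul2l; rewrite ?lee_fin// gauss_expRabs1.
exact/measurable_EFinP.
Qed.

Lemma integrable_qf r : gauss.-integrable setT (EFin \o (fun g => g * sigmoid (r * g))).
Proof.
apply: (integrable_le_gauss (mqf r) ler01) => x; rewrite mul1r.
apply: le_trans (norm_le_expR x); rewrite normrM ler_piMr//.
by rewrite ger0_norm ?sigmoid_ge0// sigmoid_le1.
Qed.

Lemma qB r r' : (q r' - q r)%:E =
  (\int[gauss]_g (g * (sigmoid (r' * g) - sigmoid (r * g)))%:E)%E.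
Proof.
have i1 := integrable_qf r; have i2 := integrable_qf r'.
rewrite !qE EFinB !fineK; first last.
- exact: integrable_fin_num.
- exact: integrable_fin_num.
rewrite -integralB_EFin//.
by apply: eq_integral => g _; rewrite -EFinB mulrBr.
Qed.

Let mdiff r r' : measurable_fun setT (fun g : R => g * (sigmoid (r' * g) - sigmoid (r * g))).
Proof.
apply: measurable_funM => //; apply: measurable_funB; apply: measurableT_comp;
  try exact: measurable_sigmoid; exact: measurable_funM.
Qed.

Let diff_ge0 r r' g : 0 <= r <= r' -> 0 <= g * (sigmoid (r' * g) - sigmoid (r * g)).
Proof.
move=> rr; apply: le_trans (gs_lb g rr); move/andP: rr => [r0 rr'].
by rewrite divr_ge0// mulr_ge0 ?subr_ge0// mulr_ge0 ?sqr_ge0 ?expR_ge0.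
Qed.

(** The constant is 4 times 4: g^2 <= 4 exp |g|, and exp |g| has mean at most 4. The bound provides
    the continuity behind [q_IVT]. *)
Lemma q_lip (r r' : R) : 0 <= r -> r <= r' -> q r' - q r <= 16 * (r' - r).
Proof.
move=> r0 rr'; rewrite -lee_fin qB.
have r01 : 0 <= r <= r' by rewrite r0.
have mE : measurable_fun setT (fun x : R => expR `|x|).
  by apply: measurableT_comp => //; exact: measurableT_comp.
apply: (@le_trans _ _ (\int[gauss]_g ((4 * (r' - r))%:E * (expR `|g|)%:E))%E).
  apply: le_integralT.
  - by apply/measurable_EFinP; exact: mdiff.
  - by apply: emeasurable_funM => //; exact/measurable_EFinP.
  - by move=> g; rewrite lee_fin diff_ge0.
  - move=> g; rewrite -EFinM lee_fin; apply: le_trans (gs_ub g r01) _.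
    have h := sqr_le_expR (normr_ge0 g); rewrite real_normK ?num_real// in h.
    have e1 : expR (- (r * `|g|)) <= 1 by rewrite -expR0 ler_expR oppr_le0 mulr_ge0.
    have : g ^+ 2 * expR (- (r * `|g|)) <= 4 * expR `|g|.
      by apply: le_trans h; rewrite ler_piMr ?sqr_ge0.
    have rr0 : 0 <= r' - r by rewrite subr_ge0.
    move=> /(ler_wpM2l rr0) /le_trans; apply.
    by rewrite le_eqVlt; apply/orP; left; apply/eqP; ring.
have c0 : 0 <= 4 * (r' - r) by rewrite mulr_ge0 ?subr_ge0.
rewrite ge0_integralZl//; last exact/measurable_EFinP.
apply: (@le_trans _ _ ((4 * (r' - r))%:E * 4%:E)%E).
  by apply: lee_wpmul2l; rewrite ?lee_fin// gauss_expRabs1.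
by rewrite -EFinM lee_fin le_eqVlt; apply/orP; left; apply/eqP; ring.
Qed.

(** The mass that matters is g in [1/(2K), 1/K], where r' g <= 1: its probability is of order 1/K,
    and the integrand there is of order (r' - r) / K^2. Hence the rate K^-3. *)
Lemma q_lb (K r r' : R) : 1 <= K -> 0 <= r -> r <= r' -> r' <= K ->
  pdf1 * (r' - r) / (128 * K ^+ 3) <= q r' - q r.
Proof.
move=> K1 r0 rr' rK; rewrite -lee_fin qB.
have r01 : 0 <= r <= r' by rewrite r0.
have K0 : 0 < K by rewrite (lt_le_trans _ K1).
pose I : set R := `[(2 * K)^-1, K^-1]%classic.
(* The product of the 1/4 in [gs_lb], of g^2 >= 1 / (4 K^2) and of exp (- r' g) >= 1/4 on the
   interval. *)
pose c := (r' - r) / (64 * K ^+ 2).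
have c0 : 0 <= c by rewrite divr_ge0 ?subr_ge0// mulr_ge0// sqr_ge0.
have mI : measurable I by exact: measurable_itv.
apply: (@le_trans _ _ (\int[gauss]_g (c%:E * (\1_I g)%:E))%E); last first.
  apply: le_integralT.
  - by apply: emeasurable_funM => //; apply/measurable_EFinP; exact: measurable_indic.
  - by apply/measurable_EFinP; exact: mdiff.
  - by move=> g; rewrite -EFinM lee_fin mulr_ge0// indicE.
  - move=> g; rewrite -EFinM lee_fin indicE.
    case: (boolP (g \in _)) => [|_]; last by rewrite mulr0 diff_ge0.
    rewrite inE /I/= in_itv/= mulr1 => /andP[g1 g2].
    apply: le_trans (gs_lb g r01).
    have gp : 0 < g by apply: lt_le_trans g1; rewrite invr_gt0 mulr_gt0.
    rewrite gtr0_norm//.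
    have e1 : 4^-1 <= expR (- (r' * g)).
      have : r' * g <= 1.
        have h1 : r' * g <= K * K^-1 by apply: ler_pM => //; [exact: le_trans rr'|exact: ltW].
        by rewrite divff ?gt_eqF// in h1.
      move=> h1; apply: (@le_trans _ _ (expR (- 1))); last by rewrite ler_expR lerN2.
      have h := expR_ge1Dx (- (1 / 2) : R).
      have -> : expR (- 1) = expR (- (1 / 2)) ^+ 2 :> R by rewrite -expRM_natl; congr expR; field.
      by nra.
    have g3 : (4 * K ^+ 2)^-1 <= g ^+ 2.
      have : (2 * K)^-1 ^+ 2 <= g ^+ 2.
        by rewrite ler_sqr ?nnegrE ?invr_ge0 ?(ltW gp)// mulr_ge0// ltW.
      by apply: le_trans; rewrite exprVn exprMn; lra.
    have : (4 * K ^+ 2)^-1 * 4^-1 <= g ^+ 2 * expR (- (r' * g)).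
      by apply: ler_pM => //; rewrite invr_ge0// mulr_ge0// sqr_ge0.
    have rr0 : 0 <= (r' - r) by rewrite subr_ge0.
    move=> /(ler_wpM2l rr0) h; rewrite ler_pdivlMr//; apply: le_trans h.
    rewrite /c le_eqVlt; apply/orP; left; apply/eqP.
    by field; rewrite gt_eqF.
rewrite ge0_integralZl//; last by apply/measurable_EFinP; exact: measurable_indic.
rewrite integral_indic// setIT.
have iK : K^-1 <= 1 by rewrite invf_le1.
have iK2 : (2 * K)^-1 <= K^-1 by rewrite lef_pV2 ?posrE ?mulr_gt0//; lra.
have h := @gauss_itv R (2 * K)^-1 K^-1 _ iK2 iK.
have i0 : 0 <= (2 * K)^-1 by rewrite invr_ge0 mulr_ge0// ltW.
have {}h := h (le_trans (lerN10 R) i0).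
apply: (@le_trans _ _ (c%:E * (pdf1 * (K^-1 - (2 * K)^-1))%:E)%E).
  rewrite -EFinM lee_fin le_eqVlt; apply/orP; left; apply/eqP.
  by rewrite /c; field; rewrite gt_eqF.
by apply: lee_wpmul2l => //; rewrite lee_fin.
Qed.

Lemma gaussN (f : R -> \bar R) : measurable_fun setT f -> (forall x, 0 <= f x)%E ->
  (\int[gauss]_x f (- x)%R = \int[gauss]_x f x)%E.
Proof.
move=> mf f0.
have mfN : measurable_fun setT (fun x : R => f (- x)) by exact: measurableT_comp.
have mp : measurable_fun setT (fun x : R => (pdf x)%:E).
  by apply/measurable_EFinP; exact: measurable_normal_pdf.
rewrite !integral_gaussE// !ge0_integral_normal//.
rewrite -[RHS]integral_lebRN.
- by apply: eq_integral => x _; congr (_ * _%:E)%E; rewrite !normal_pdf01E sqrrN.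
- exact: emeasurable_funM.
- by move=> x; rewrite mule_ge0// lee_fin normal_pdf_ge0.
Qed.

(** At r = 0 the sigmoid is constant, so the integrand is odd and the integral equals its
    opposite. *)
Lemma q0 : q 0 = 0 :> R.
Proof.
have E : (\int[gauss]_g (g * sigmoid (0 * g))%:E = \int[gauss]_g (- (g * sigmoid (0 * g)))%:E :> \bar R)%E.
  have E1 (g : R) : sigmoid (0 * (- g)) = sigmoid (0 * g) by rewrite !mul0r.
  have mm (f : R -> R) : measurable_fun setT f -> measurable_fun setT (fun x => (Num.max (f x) 0)%:E).
    by move=> mf; apply/measurable_EFinP; apply: measurable_maxr.
  apply: integral_eq_parts.
  - rewrite -gaussN; last 2 first.
      by apply: mm; exact: (mqf 0).
      by move=> x; rewrite lee_fin le_max lexx orbT.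
    by apply: eq_integral => g _; rewrite E1 mulNr.
  - rewrite -gaussN; last 2 first.
      by apply: mm; apply: measurableT_comp => //; exact: (mqf 0).
      by move=> x; rewrite lee_fin le_max lexx orbT.
    by apply: eq_integral => g _; rewrite E1 mulNr.
have fin := integrable_fin_num measurableT (integrable_qf 0).
move: E; rewrite qE; under [in RHS]eq_integral do rewrite EFinN.
rewrite integralN//; last exact: integrable_add_def (integrable_qf 0).
by move: fin => /=; case: (\int[gauss]_g _)%E => // r _ [] /=; lra.
Qed.

Lemma q_ge0 r : 0 <= r -> 0 <= q r.
Proof.
move=> r0; have := qB 0 r; rewrite q0 subr0 => E.
rewrite -lee_fin E; apply: integral_ge0 => g _.
by rewrite lee_fin diff_ge0// lexx.
Qed.

Lemma q_ndecr r r' : 0 <= r -> r <= r' -> q r <= q r'.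
Proof.
move=> r0 rr'; rewrite -subr_ge0 -lee_fin qB; apply: integral_ge0 => g _.
by rewrite lee_fin diff_ge0// r0.
Qed.

Lemma q_incr r r' : 0 <= r -> r < r' -> q r < q r'.
Proof.
move=> r0 rr'; rewrite -subr_gt0.
apply: lt_le_trans (@q_lb (Num.max 1 r') r r' _ r0 (ltW rr') _).
- apply: divr_gt0; first by rewrite mulr_gt0 ?pdf1_gt0 ?subr_gt0.
  by rewrite mulr_gt0// exprn_gt0// lt_max ltr01.
- by rewrite le_max lexx.
- by rewrite le_max lexx orbT.
Qed.

Lemma q_le4 r : q r <= 4.
Proof.
rewrite -lee_fin qE fineK; last exact: (integrable_fin_num measurableT (integrable_qf r)).
apply: le_trans gauss_expRabs1; apply: le_integral => //.
- exact: integrable_qf.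
- apply: (@integrable_le_gauss _ 1) => //.
    by apply: measurableT_comp => //; exact: measurableT_comp.
  by move=> x; rewrite mul1r ger0_norm ?expR_ge0.
- move=> g _; rewrite lee_fin; apply: le_trans (norm_le_expR g).
  apply: le_trans (ler_norm _) _; rewrite normrM ler_piMr//.
  by rewrite ger0_norm ?sigmoid_ge0// sigmoid_le1.
Qed.

Lemma q_IVT (a b y : R) : 0 <= a -> a <= b -> q a <= y <= q b ->
  exists2 r, a <= r <= b & q r = y.
Proof.
move=> a0 ab /andP[ya yb].
(* The Lipschitz bound is available on the half-line only; this extension is continuous
   everywhere. *)
pose f (x : R) := q (Num.max x 0).
have fc : continuous f.
  move=> x; apply/cvgrPdist_le => e e0; near=> z.
  have lip (u v : R) : 0 <= u -> 0 <= v -> `|q u - q v| <= 16 * `|u - v|.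
    move=> u0 v0; have [uv|vu] := leP u v.
      rewrite distrC [X in 16 * X]distrC !ger0_norm ?subr_ge0 ?q_ndecr//.
      exact: q_lip.
    rewrite !ger0_norm ?subr_ge0 ?q_ndecr ?(ltW vu)//.
    exact: q_lip (ltW vu).
  apply: le_trans (lip _ _ _ _) _; rewrite ?le_max ?lexx ?orbT//.
  apply: (@le_trans _ _ (16 * `|x - z|)).
    rewrite ler_wpM2l//; have [x0|x0] := leP x 0; have [z0|z0] := leP z 0.
    - by rewrite subrr normr0.
    - rewrite sub0r normrN gtr0_norm// ler0_norm; lra.
    - rewrite subr0 gtr0_norm// ger0_norm; lra.
    - by [].
  rewrite -ler_pdivlMl// mulrC; near: z.
  by apply: cvgr_dist_le => //; rewrite divr_gt0.
have fab : Num.min (f a) (f b) <= y <= Num.max (f a) (f b).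
  have fa : f a = q a by rewrite /f max_l.
  have fb : f b = q b by rewrite /f max_l// (le_trans a0).
  by rewrite fa fb ge_min ya le_max yb orbT.
have [c] := IVT ab (continuous_subspaceT fc) fab.
rewrite in_itv/= => /andP[ac cb] fcy; exists c; first by rewrite ac.
by rewrite -fcy /f max_l// (le_trans a0).
Unshelve. all: by end_near.
Qed.

Lemma qinvE r : 0 <= r -> qinv (q r) = r.
Proof.
move=> r0; rewrite /qinv; case: xgetP => [s _ [s0 qs]|/(_ r)/=]; last by move=> /(_ (conj r0 erefl)).
apply/eqP; rewrite eq_le; apply/andP; split; rewrite leNgt; apply/negP => rs.
  by have := q_incr r0 rs; rewrite qs ltxx.
by have := q_incr s0 rs; rewrite qs ltxx.
Qed.

End q_function.

(** * One observation: conditional expectations *)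

Section conditional_law.
Context {R : realType} {d d' : measure_display} {T : measurableType d}
  {S : measurableType d'} (P : {measure set T -> \bar R}).

Lemma integral_mrestr (D : set T) (mD : measurable D) (F : T -> \bar R) :
  measurable_fun setT F -> (forall w, 0 <= F w)%E ->
  (\int[mrestr P mD]_w F w = \int[P]_w (F w * (\1_D w)%:E))%E.
Proof.
move=> mF F0; apply: ge0_integral_density => //.
move=> A mA; rewrite integral_indic//.
by rewrite /mrestr/= setIC.
Qed.

(** The left side integrates F against the law of x restricted to D, which by hypothesis has density
    p with respect to the law of x. *)
Lemma integral_conditional (x : T -> S) (D : set T) (p : S -> R) (F : S -> \bar R) :
  measurable_fun setT x -> measurable D -> measurable_fun setT p ->
  (forall s, 0 <= p s) ->
  (forall A, measurable A -> P (x @^-1` A `&` D) = \int[P]_(w in x @^-1` A) (p (x w))%:E)%E ->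
  measurable_fun setT F -> (forall s, 0 <= F s)%E ->
  (\int[P]_w (F (x w) * (\1_D w)%:E) = \int[P]_w (F (x w) * (p (x w))%:E))%E.
Proof.
move=> mx mD mp p0 PA mF F0.
have mFx : measurable_fun setT (F \o x) by exact: measurableT_comp.
rewrite -(integral_mrestr mD mFx)//; last by move=> w; exact: F0.
pose n1 : {measure set S -> \bar R} :=
  measure_function_pushforward__canonical__measure_function_Measure (mrestr P mD) mx.
pose m1 : {measure set S -> \bar R} :=
  measure_function_pushforward__canonical__measure_function_Measure P mx.
transitivity (\int[n1]_s F s)%E; first by rewrite /n1 ge0_integral_pushforward.
rewrite (@ge0_integral_density _ _ _ m1 n1 p F)//; last first.
  move=> A mA; rewrite /n1 /m1 /= /pushforward /mrestr/=.
  rewrite ge0_integral_pushforward//; first exact: PA.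
  - by apply: measurable_funTS; exact/measurable_EFinP.
  - by move=> s _; rewrite lee_fin.
rewrite /m1 ge0_integral_pushforward//.
- by apply: emeasurable_funM => //; exact/measurable_EFinP.
- by move=> s _; rewrite mule_ge0// lee_fin.
Qed.

End conditional_law.

Section one_sample.
Context {R : realType} {disp : measure_display} {T : measurableType disp}
  (P : probability T R) {d : nat}.
Variables (theta : 'cV[R]_d) (x : T -> 'cV[R]_d) (y : T -> bool).
Hypothesis mx : measurable_fun setT x.
Hypothesis my : measurable_fun setT y.
Hypothesis gx : std_gaussian_vec P x.
Hypothesis ly : logistic_response P theta x y.

Let mxv v : measurable_fun setT (fun w => dot (x w) v) := measurable_dot v mx.

Let mcoord i : measurable_fun setT (fun w => x w i 0).
Proof. exact: (measurableT_comp (measurable_coord i) mx). Qed.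

Lemma gauss_pair (v b : 'cV[R]_d) (f : R -> R -> \bar R) :
  dot v v = 1 -> dot v b = 0 -> measurable2 f -> (forall s t, 0 <= f s t)%E ->
  (\int[P]_w f (dot (x w) v) (dot (x w) b))%E = plane (fun g h => f g (l2norm b * h)).
Proof.
move=> v1 vb mf f0; have [iX gX] := gx.
rewrite /l2norm -(_ : \sum_i b i 0 ^+ 2 = dot b b); last first.
  by apply: eq_bigr => i _; rewrite expr2.
rewrite -(integral_gauss_lin mcoord iX gX (a := fun i => v i 0) (b := fun i => b i 0))//.
by apply: eq_integral => w _; congr f; apply: eq_bigr => i _; rewrite mulrC.
Qed.

Lemma gauss_single (v : 'cV[R]_d) (f : R -> \bar R) :
  dot v v = 1 -> measurable_fun setT f -> (forall s, 0 <= f s)%E ->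
  (\int[P]_w f (dot (x w) v) = \int[gauss]_g f g)%E.
Proof.
move=> v1 mf f0.
rewrite (@gauss_pair v 0 (fun s _ => f s))// ?dot0r//; last exact: measurableT_comp.
by apply: eq_integral => g _; exact: (integral_prob_cst gauss).
Qed.

Lemma gauss_single_signed (v : 'cV[R]_d) (f : R -> R) :
  dot v v = 1 -> measurable_fun setT f ->
  (\int[P]_w (f (dot (x w) v))%:E = \int[gauss]_g (f g)%:E)%E.
Proof.
move=> v1 mf; apply: integral_eq_parts.
- apply: (gauss_single v1 (f := fun s => (Num.max (f s) 0)%:E)).
    by apply/measurable_EFinP; apply: measurable_maxr.
  by move=> s; rewrite lee_fin le_max lexx orbT.
- apply: (gauss_single v1 (f := fun s => (Num.max (- f s) 0)%:E)).
    by apply/measurable_EFinP; apply: measurable_maxr => //; exact: measurableT_comp.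
  by move=> s; rewrite lee_fin le_max lexx orbT.
Qed.

Lemma integrable_dot (a : 'cV[R]_d) : P.-integrable setT (fun w => (dot (x w) a)%:E).
Proof.
have [->|a0] := eqVneq a 0.
  apply: (eq_integrable measurableT (cst 0%E)) => //; last exact: integrable0.
  by move=> w _; rewrite dot0r.
pose u := (l2norm a)^-1 *: a.
have u1 : dot u u = 1 by exact: l2norm_unit.
have na : l2norm a != 0 by rewrite l2norm_eq0.
apply: (eq_integrable measurableT (fun w => (l2norm a)%:E * (dot (x w) u)%:E)%E).
  by move=> w _; rewrite -EFinM /u dotZr mulVKf.
apply: integrableZl => //.
apply/integrableP; split; first exact/measurable_EFinP.
rewrite (gauss_single u1 (f := fun s => `|s%:E|%E))//.
  have id1 (s : R) : `|id s| <= 1 * expR `|s| by rewrite mul1r; exact: norm_le_expR.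
  by have /integrableP[] := @integrable_le_gauss R id 1 (@measurable_id _ _ _) ler01 id1.
by apply: measurableT_comp => //; exact/measurable_EFinP.
Qed.

Lemma integrable_sigmoid_dot r (v a : 'cV[R]_d) :
  P.-integrable setT (fun w => (sigmoid (r * dot (x w) v) * dot (x w) a)%:E).
Proof.
have ms : measurable_fun setT (fun w => sigmoid (r * dot (x w) v)).
  by apply: measurableT_comp; [exact: measurable_sigmoid|exact: measurable_funM].
apply: (le_integrable measurableT _ _ (integrable_dot a)).
  by apply/measurable_EFinP; exact: measurable_funM.
move=> w _; rewrite /= lee_fin normrM ler_piMl// ger0_norm ?sigmoid_ge0//.
exact: sigmoid_le1.
Qed.

(** The joint law in [gauss_pair] depends on b only through its norm, so passing from b to - b shows
    that the integral equals its opposite. *)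
Lemma integral_sigmoid_orth r (v b : 'cV[R]_d) : dot v v = 1 -> dot v b = 0 ->
  (\int[P]_w (sigmoid (r * dot (x w) v) * dot (x w) b)%:E = 0)%E.
Proof.
move=> v1 vb.
pose f (s t : R) := (Num.max (sigmoid (r * s) * t) 0)%:E.
have mf : measurable2 f.
  apply/measurable_EFinP; apply: measurable_maxr => //; apply: measurable_funM => //.
  by apply: measurableT_comp; [exact: measurable_sigmoid|exact: measurable_funM].
have f0 s t : (0 <= f s t)%E by rewrite lee_fin le_max lexx orbT.
have vb' : dot v (- b) = 0 by rewrite dotNr vb oppr0.
have E : (\int[P]_w (sigmoid (r * dot (x w) v) * dot (x w) b)%:E =
    \int[P]_w (- (sigmoid (r * dot (x w) v) * dot (x w) b))%:E)%E.
  apply: integral_eq_parts.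
    transitivity (\int[P]_w f (dot (x w) v) (dot (x w) b))%E => //.
    rewrite (gauss_pair v1 vb mf f0) -(l2normN b) -(gauss_pair v1 vb' mf f0).
    by apply: eq_integral => w _; rewrite /f dotNr mulrN.
  under [RHS]eq_integral do rewrite opprK.
  transitivity (\int[P]_w f (dot (x w) v) (dot (x w) (- b)))%E.
    by apply: eq_integral => w _; rewrite /f dotNr mulrN.
  by rewrite (gauss_pair v1 vb' mf f0) l2normN -(gauss_pair v1 vb mf f0).
have int := integrable_sigmoid_dot r v b.
have fin := integrable_fin_num measurableT int.
move: E; under [in RHS]eq_integral do rewrite EFinN.
rewrite integralN//; last exact: integrable_add_def int.
by move: fin => /=; case: (\int[P]_w _)%E => // s _ [] /= ?; congr (_%:E); lra.
Qed.

(** Only the component of a along v contributes. With v = theta / |theta| and r = |theta| this also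
    yields the mean of y x, once y is replaced by its conditional mean. *)
Lemma mean_sigmoid r (v a : 'cV[R]_d) : dot v v = 1 ->
  (\int[P]_w (sigmoid (r * dot (x w) v) * dot (x w) a)%:E = (q r * dot v a)%:E)%E.
Proof.
move=> v1; have i1 := integrable_sigmoid_dot r v v.
have i2 := integrable_sigmoid_dot r v (perp v a).
transitivity (\int[P]_w ((dot v a)%:E * (sigmoid (r * dot (x w) v) * dot (x w) v)%:E +
   (sigmoid (r * dot (x w) v) * dot (x w) (perp v a))%:E))%E.
  apply: eq_integral => w _; rewrite -EFinM -EFinD; congr (_%:E).
  by have E := perpE v a; rewrite [in LHS]E dotDr dotZr; ring.
rewrite integralD//; last exact: integrableZl.
rewrite integral_sigmoid_orth ?dot_perp// adde0 integralZl// mulrC EFinM.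
congr (_ * _)%E; transitivity (\int[gauss]_g (g * sigmoid (r * g))%:E)%E.
  rewrite -(gauss_single_signed v1 (f := fun g => g * sigmoid (r * g))).
    by apply: eq_integral => w _; rewrite mulrC.
  apply: measurable_funM => //; apply: measurableT_comp; first exact: measurable_sigmoid.
  exact: measurable_funM.
by rewrite qE fineK// (integrable_fin_num measurableT (integrable_qf r)).
Qed.

Let s_ (w : T) := sigmoid (dot (x w) theta).

Let Dy : set T := [set w | y w].

Let mDy : measurable Dy.
Proof.
have mt : measurable [set true] by [].
by have := my measurableT mt; rewrite setTI.
Qed.

Let mp : measurable_fun setT (fun u : 'cV[R]_d => sigmoid (dot u theta)).
Proof. by apply: measurableT_comp; [exact: measurable_sigmoid|exact: measurable_dot]. Qed.

Lemma integral_response (F1 F0 : 'cV[R]_d -> \bar R) :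
  measurable_fun setT F1 -> measurable_fun setT F0 ->
  (forall u, 0 <= F1 u)%E -> (forall u, 0 <= F0 u)%E ->
  (\int[P]_w (if y w then F1 (x w) else F0 (x w)) =
   \int[P]_w (F1 (x w) * (s_ w)%:E) + \int[P]_w (F0 (x w) * (1 - s_ w)%:E))%E.
Proof.
move=> mF1 mF0 F10 F00.
have mA (A : set 'cV[R]_d) : measurable A -> measurable (x @^-1` A).
  by move=> mA; rewrite -[X in measurable X]setTI; exact: mx.
have E1 A : measurable A -> (P (x @^-1` A `&` Dy) = \int[P]_(w in x @^-1` A) (s_ w)%:E)%E.
  by move=> mA'; exact: ly.
have ms : measurable_fun setT s_ by exact: (measurableT_comp mp mx).
have s0 w : 0 <= s_ w by exact: sigmoid_ge0.
have E0 A : measurable A -> (P (x @^-1` A `&` ~` Dy) = \int[P]_(w in x @^-1` A) (1 - s_ w)%:E)%E.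
  move=> mA'; have mxA := mA _ mA'.
  have h : (P (x @^-1` A) = P (x @^-1` A `&` Dy) + P (x @^-1` A `&` ~` Dy))%E.
    rewrite -measureU//.
    - by rewrite -setIUr setUv setIT.
    - by apply: measurableI => //; exact: mDy.
    - by apply: measurableI => //; apply: measurableC; exact: mDy.
    - by rewrite -setIIr setICr setI0.
  have h2 : (P (x @^-1` A) = \int[P]_(w in x @^-1` A) (s_ w)%:E + \int[P]_(w in x @^-1` A) (1 - s_ w)%:E)%E.
    rewrite -ge0_integralD//.
    - transitivity (\int[P]_(w in x @^-1` A) (cst 1%E) w)%E; first by rewrite integral_cst// mul1e.
      by apply: eq_integral => w _; rewrite -EFinD; congr (_%:E); rewrite /cst; ring.
    - by move=> w _; rewrite lee_fin.
    - by apply: measurable_funTS; exact/measurable_EFinP.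
    - by move=> w _; rewrite lee_fin subr_ge0 sigmoid_le1.
    - by apply: measurable_funTS; apply/measurable_EFinP; exact: measurable_funB.
  move: h; rewrite h2 (E1 _ mA') => /esym/eqP.
  have f1 : (\int[P]_(w in x @^-1` A) (s_ w)%:E)%E \is a fin_num.
    rewrite -(E1 _ mA') fin_num_measure//; exact: measurableI.
  move=> /eqP /(congr1 (fun z => z - \int[P]_(w in x @^-1` A) (s_ w)%:E)%E).
  by rewrite ![(\int[P]_(w in x @^-1` A) (s_ w)%:E + _)%E]addeC !addeK.
transitivity (\int[P]_w (F1 (x w) * (\1_Dy w)%:E + F0 (x w) * (\1_(~` Dy) w)%:E))%E.
  apply: eq_integral => w _; rewrite !indicE in_setC.
  have -> : (w \in Dy) = y w by apply/idP/idP; rewrite inE.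
  by case: (y w); rewrite /= !(mule0, mule1, adde0, add0e).
rewrite ge0_integralD//; first last.
- apply: emeasurable_funM; first exact: measurableT_comp.
  by apply/measurable_EFinP; apply: measurable_indic; exact: measurableC.
- by move=> w _; rewrite mule_ge0// lee_fin indicE.
- apply: emeasurable_funM; first exact: measurableT_comp.
  by apply/measurable_EFinP; exact: measurable_indic.
- by move=> w _; rewrite mule_ge0// lee_fin indicE.
congr (_ + _)%E.
- exact: (integral_conditional mx mDy mp (fun u => sigmoid_ge0 _) E1).
- apply: (integral_conditional (p := fun u => 1 - sigmoid (dot u theta)) mx (measurableC mDy) _ _ E0) => //.
    exact: measurable_funB.
  by move=> u; rewrite subr_ge0 sigmoid_le1.
Qed.

Definition resid (v : 'cV[R]_d) (r : R) (w : T) : R := (y w)%:R - sigmoid (r * dot (x w) v).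

Let mY : measurable_fun setT (fun w => (y w)%:R : R).
Proof.
rewrite (_ : (fun w => _) = (\1_Dy : T -> R)); first by apply: measurable_indic; exact: mDy.
by apply/funext => w; rewrite indicE; congr (_%:R : R); congr nat_of_bool; apply/idP/idP; rewrite inE.
Qed.

Lemma measurable_resid v r : measurable_fun setT (resid v r).
Proof.
apply: measurable_funB; first exact: mY.
by apply: measurableT_comp; [exact: measurable_sigmoid|exact: measurable_funM].
Qed.

Lemma resid_le1 v r w : `|resid v r w| <= 1.
Proof.
have s0 := sigmoid_ge0 (r * dot (x w) v); have s1 := sigmoid_le1 (r * dot (x w) v).
by rewrite /resid ler_norml; case: (y w) => /=; apply/andP; split; lra.
Qed.

Lemma integrable_resid_dot v r a :
  P.-integrable setT (fun w => (resid v r w * dot (x w) a)%:E).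
Proof.
apply: (le_integrable measurableT _ _ (integrable_dot a)).
  by apply/measurable_EFinP; apply: measurable_funM => //; exact: measurable_resid.
by move=> w _; rewrite /= lee_fin normrM ler_piMl// resid_le1.
Qed.

Lemma mean_response a : theta != 0 ->
  (\int[P]_w ((y w)%:R * dot (x w) a)%:E =
   (q (l2norm theta) * dot ((l2norm theta)^-1 *: theta) a)%:E)%E.
Proof.
move=> th0; have n0 : l2norm theta != 0 by rewrite l2norm_eq0.
rewrite -mean_sigmoid; last exact: l2norm_unit.
have mM (F : 'cV[R]_d -> R) : measurable_fun setT F -> measurable_fun setT (fun u => (Num.max (F u) 0)%:E).
  by move=> mF; apply/measurable_EFinP; exact: measurable_maxr.
have sE w : sigmoid (l2norm theta * dot (x w) ((l2norm theta)^-1 *: theta)) = s_ w.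
  by rewrite dotZr mulVKf.
have md : measurable_fun setT (fun u : 'cV[R]_d => dot u a) by exact: measurable_dot.
have md' : measurable_fun setT (fun u : 'cV[R]_d => - dot u a) by exact: measurableT_comp.
have pos (c : R) : (0 <= (Num.max c 0)%:E)%E by rewrite lee_fin le_max lexx orbT.
apply: integral_eq_parts.
- transitivity (\int[P]_w (if y w then (Num.max (dot (x w) a) 0)%:E else 0))%E.
    by apply: eq_integral => w _; case: (y w); rewrite /= ?mul1r// mul0r maxxx.
  rewrite (@integral_response (fun u => (Num.max (dot u a) 0)%:E) (fun=> 0%E))//; last exact: mM.
  rewrite [X in (_ + X)%E]integral0_eq ?adde0; last by move=> w _; rewrite mul0e.
  apply: eq_integral => w _; rewrite -EFinM sE; congr (_%:E).
  by rewrite [LHS]mulrC maxr_pMr ?sigmoid_ge0// mulr0.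
- transitivity (\int[P]_w (if y w then (Num.max (- dot (x w) a) 0)%:E else 0))%E.
    by apply: eq_integral => w _; case: (y w); rewrite /= ?mul1r// mul0r oppr0 maxxx.
  rewrite (@integral_response (fun u => (Num.max (- dot u a) 0)%:E) (fun=> 0%E))//; last exact: mM.
  rewrite [X in (_ + X)%E]integral0_eq ?adde0; last by move=> w _; rewrite mul0e.
  apply: eq_integral => w _; rewrite -EFinM sE; congr (_%:E).
  by rewrite mulrC maxr_pMr ?sigmoid_ge0// mulr0 mulrN.
Qed.

(** The population mean of the residual times x is q(R) u - q(r) v, here paired with a. It vanishes
    at v = u, r = R. *)
Definition mean_resid (v : 'cV[R]_d) (r : R) (a : 'cV[R]_d) : R :=
  q (l2norm theta) * dot ((l2norm theta)^-1 *: theta) a - q r * dot v a.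

Lemma mean_residE v r a : theta != 0 -> dot v v = 1 ->
  (\int[P]_w (resid v r w * dot (x w) a)%:E = (mean_resid v r a)%:E)%E.
Proof.
move=> th0 v1.
have i1 : P.-integrable setT (fun w => ((y w)%:R * dot (x w) a)%:E).
  apply: (le_integrable measurableT _ _ (integrable_dot a)).
    by apply/measurable_EFinP; apply: measurable_funM => //; exact: mY.
  by move=> w _; rewrite /= lee_fin normrM ler_piMl//; case: (y w); rewrite ?normr1 ?normr0.
under eq_integral do rewrite /resid mulrBl EFinB.
rewrite integralB_EFin//; last exact: integrable_sigmoid_dot.
by rewrite mean_response// mean_sigmoid// -EFinB.
Qed.

End one_sample.

(** * One observation: exponential moments *)

Section one_sample_bounds.
Context {R : realType} {disp : measure_display} {T : measurableType disp}
  (P : probability T R) {d : nat}.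
Variables (theta : 'cV[R]_d) (x : T -> 'cV[R]_d) (y : T -> bool).
Hypothesis mx : measurable_fun setT x.
Hypothesis my : measurable_fun setT y.
Hypothesis gx : std_gaussian_vec P x.
Hypothesis ly : logistic_response P theta x y.

Let mxv v : measurable_fun setT (fun w => dot (x w) v) := measurable_dot v mx.

Lemma measurable_expRabs (k : R) : measurable_fun setT (fun g : R => expR (k * `|g|)).
Proof. by apply: measurableT_comp => //; apply: measurable_funM => //; exact: measurableT_comp. Qed.

(** Orthogonality makes x.v and x.b independent: the first factor gives 2 / k, the second at most 2
    e^2 <= 32. *)
Lemma integral_exp_orth (k : R) (v b : 'cV[R]_d) :
  0 < k -> dot v v = 1 -> dot v b = 0 -> l2norm b <= 1 ->
  (\int[P]_w (expR (- k * `|dot (x w) v|) * expR (2 * `|dot (x w) b|))%:E <= (64 / k)%:E)%E.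
Proof.
move=> k0 v1 vb b1.
pose f (s t : R) := (expR (- k * `|s|) * expR (2 * `|t|))%:E.
have mf : measurable2 f.
  apply/measurable_EFinP; apply: measurable_funM.
    exact: (measurableT_comp (measurable_expRabs (- k))).
  exact: (measurableT_comp (measurable_expRabs 2)).
have f0 s t : (0 <= f s t)%E by rewrite lee_fin mulr_ge0 ?expR_ge0.
rewrite -[X in (X <= _)%E]/(\int[P]_w f (dot (x w) v) (dot (x w) b))%E.
rewrite (gauss_pair mx gx v1 vb mf f0) /plane /plane_integral.
have inner g : (\int[gauss]_h f g (l2norm b * h)%R <= (expR (- k * `|g|))%:E * 32%:E)%E.
  rewrite /f; under eq_integral do rewrite EFinM.
  have mm : measurable_fun setT (fun h : R => expR (2 * `|l2norm b * h|)).
    by apply: (measurableT_comp (measurable_expRabs 2)); exact: measurable_funM.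
  rewrite ge0_integralZl//; last exact/measurable_EFinP.
  apply: lee_wpmul2l; first by rewrite lee_fin expR_ge0.
  apply: (@le_trans _ _ (\int[gauss]_h (expR (2 * `|h|))%:E)%E).
    apply: le_integral_EFin => //; first exact: measurable_expRabs.
    move=> h; rewrite ler_expR normrM ger0_norm ?l2norm_ge0//.
    by rewrite ler_wpM2l// ler_piMl.
  apply: le_trans (gauss_expRabs 2) _; rewrite lee_fin.
  have e2 : expR (2 ^+ 2 / 2) = expR (1 / 2) ^+ 4 :> R.
    by rewrite -expRM_natl; congr expR; field.
  have h := @expR_half_le2 R; have h0 := expR_ge0 (1 / 2 : R).
  have : expR (1 / 2) ^+ 4 <= (2 : R) ^+ 4 by apply: lerXn2r; rewrite ?nnegrE.
  rewrite e2; lra.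
have mF : measurable_fun setT (fun g : R => \int[gauss]_h f g (l2norm b * h)%R)%E.
  have mf' := measurable2_lin 1 0 0 (l2norm b) mf.
  have := @measurable_fun_fubini_tonelli_F _ _ _ _ _ gauss _ mf' (fun p => f0 _ _).
  rewrite /fubini_F/=; congr (measurable_fun _ _).
  by apply/funext => g; apply: eq_integral => h _; rewrite !mul1r !mul0r addr0 add0r.
apply: (@le_trans _ _ (\int[gauss]_g ((expR (- k * `|g|))%:E * 32%:E))%E).
  apply: le_integralT => //.
  - by apply: emeasurable_funM => //; apply/measurable_EFinP; exact: measurable_expRabs.
  - by move=> g; apply: integral_ge0.
rewrite ge0_integralZr//; last by apply/measurable_EFinP; exact: measurable_expRabs.
apply: (@le_trans _ _ ((2 / k)%:E * 32%:E)%E).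
  apply: lee_wpmul2r; first by rewrite lee_fin.
  by under eq_integral do rewrite mulNr; exact: gauss_expRNabs.
rewrite -EFinM lee_fin le_eqVlt; apply/orP; left; apply/eqP.
by field; rewrite gt_eqF.
Qed.

Variables (v : 'cV[R]_d) (r R0 : R).
Hypothesis R0_gt0 : 0 < R0.
Hypothesis v1 : dot v v = 1.
Hypothesis r_ge : R0 / 2 <= r.
Hypothesis th_ge : R0 / 2 <= dot v theta.
Hypothesis th_perp : l2norm (perp v theta) <= 1.

Let k_ (w : T) := dot (x w) (perp v theta).
Let g_ (w : T) := dot (x w) v.

Let thE w : dot (x w) theta = dot v theta * g_ w + k_ w.
Proof. by have E := perpE v theta; rewrite [in LHS]E dotDr dotZr. Qed.

Let exp_sign (a : R) (g : R) : R0 / 2 <= a -> 0 <= g -> expR (- (a * g)) <= expR (- (R0 / 2 * `|g|)).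
Proof. by move=> ha g0; rewrite ler_expR lerN2 ger0_norm// ler_wpM2r. Qed.

(** The left side is the conditional mean of |y - s(r x.v)|. Both sigmoids are within exp (- R0
    |x.v| / 2) of the step function in x.v, up to a factor exp |k| due to the part of theta
    orthogonal to v. *)
Lemma resid_prob_bound w :
  sigmoid (dot (x w) theta) * (1 - sigmoid (r * g_ w)) +
  (1 - sigmoid (dot (x w) theta)) * sigmoid (r * g_ w) <=
  2 * expR (- (R0 / 2 * `|g_ w|)) * expR `|k_ w|.
Proof.
set a := dot (x w) theta; set g := g_ w; set k := k_ w.
have aE : a = dot v theta * g + k by exact: thE.
have sa0 := sigmoid_ge0 a; have sa1 := sigmoid_le1 a.
have sg0 := sigmoid_ge0 (r * g); have sg1 := sigmoid_le1 (r * g).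
have k1 : 1 <= expR `|k| by rewrite -[leLHS]expR0 ler_expR.
have e0 := expR_ge0 (- (R0 / 2 * `|g|)).
have split (u z : R) : u <= expR (- (R0 / 2 * `|g|)) -> z <= expR (- (R0 / 2 * `|g|)) * expR `|k| ->
    u + z <= 2 * expR (- (R0 / 2 * `|g|)) * expR `|k|.
  move=> hu hz; have : expR (- (R0 / 2 * `|g|)) <= expR (- (R0 / 2 * `|g|)) * expR `|k| by rewrite ler_peMr.
  lra.
have [g0|g0] := leP 0 g.
  apply: split.
    apply: le_trans (exp_sign r_ge g0); apply: le_trans (sigmoidC_le_exp (r * g)).
    by rewrite ler_piMl// subr_ge0.
  apply: (@le_trans _ _ (1 - sigmoid a)); first by rewrite ler_piMr// subr_ge0.
  apply: le_trans (sigmoidC_le_exp a) _; rewrite aE opprD expRD.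
  apply: ler_pM; rewrite ?expR_ge0//; first exact: exp_sign.
  by rewrite ler_expR -normrN ler_norm.
have gN : 0 <= - g by rewrite oppr_ge0 ltW.
rewrite addrC; apply: split.
  rewrite -(normrN g); apply: le_trans (exp_sign r_ge gN); rewrite mulrN opprK.
  apply: le_trans (sigmoid_le_exp (r * g)).
  by rewrite ler_piMl// gerBl.
apply: (@le_trans _ _ (sigmoid a)); first by rewrite ler_piMr// gerBl.
apply: le_trans (sigmoid_le_exp a) _; rewrite aE expRD.
apply: ler_pM; rewrite ?expR_ge0//; last by rewrite ler_expR ler_norm.
by rewrite -(normrN g) -[X in expR X]opprK -mulrN; exact: exp_sign.
Qed.

(** The weight R0 / 8 uses up a quarter of the decay R0 / 2 of the residual and leaves 3 R0 / 8. The
    directions b and [perp v theta] need not be orthogonal to each other, so they are first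
    separated by 2 A B <= A^2 + B^2. *)
Lemma integral_resid_exp (b : 'cV[R]_d) : dot v b = 0 -> l2norm b <= 1 ->
  (\int[P]_w (`|resid x y v r w| * expR (R0 / 8 * `|g_ w| + `|dot (x w) b|))%:E
     <= (400 / R0)%:E)%E.
Proof.
move=> vb b1.
pose U (u : 'cV[R]_d) := expR (R0 / 8 * `|dot u v| + `|dot u b|).
have mU : measurable_fun setT U.
  have md c : measurable_fun setT (fun u : 'cV[R]_d => dot u c) by exact: measurable_dot.
  apply: measurableT_comp => //; apply: measurable_funD.
    by apply: measurable_funM => //; apply: measurableT_comp => //.
  by apply: measurableT_comp => //.
pose S (u : 'cV[R]_d) := sigmoid (r * dot u v).
have mS : measurable_fun setT S.
  apply: measurableT_comp; first exact: measurable_sigmoid.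
  by apply: measurable_funM => //; exact: measurable_dot.
have S0 u : 0 <= S u by exact: sigmoid_ge0.
have S1 u : 0 <= 1 - S u by rewrite subr_ge0 sigmoid_le1.
have U0 u : 0 <= U u by exact: expR_ge0.
pose F1 u : \bar R := ((1 - S u) * U u)%:E.
pose F0 u : \bar R := (S u * U u)%:E.
have mF1 : measurable_fun setT F1.
  by apply/measurable_EFinP; apply: measurable_funM => //; exact: measurable_funB.
have mF0 : measurable_fun setT F0 by apply/measurable_EFinP; exact: measurable_funM.
have ms : measurable_fun setT (fun w => sigmoid (dot (x w) theta)).
  by apply: measurableT_comp; first exact: measurable_sigmoid.
have s0 w : 0 <= sigmoid (dot (x w) theta) by exact: sigmoid_ge0.
have s1 w : 0 <= 1 - sigmoid (dot (x w) theta) by rewrite subr_ge0 sigmoid_le1.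
rewrite (eq_integral (fun w => if y w then F1 (x w) else F0 (x w))); last first.
  move=> w _; rewrite /F1 /F0 /resid -/(S (x w)).
  case: (y w) => /=; first by rewrite ger0_norm.
  by rewrite sub0r normrN ger0_norm.
have F1_0 u : (0 <= F1 u)%E by rewrite lee_fin mulr_ge0.
have F0_0 u : (0 <= F0 u)%E by rewrite lee_fin mulr_ge0.
rewrite (integral_response mx my ly mF1 mF0)//.
have mFx1 : measurable_fun setT (fun w => F1 (x w) * (sigmoid (dot (x w) theta))%:E)%E.
  by apply: emeasurable_funM; [exact: measurableT_comp|exact/measurable_EFinP].
have mFx0 : measurable_fun setT (fun w => F0 (x w) * (1 - sigmoid (dot (x w) theta))%:E)%E.
  by apply: emeasurable_funM; [exact: measurableT_comp|apply/measurable_EFinP; exact: measurable_funB].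
rewrite -ge0_integralD//; last 2 first.
- by move=> w _; apply: mule_ge0; rewrite ?F1_0 ?F0_0 ?lee_fin.
- by move=> w _; apply: mule_ge0; rewrite ?F1_0 ?F0_0 ?lee_fin.
pose k := R0 * (3 / 8).
have k0 : 0 < k by rewrite mulr_gt0// divr_gt0.
pose V (c : 'cV[R]_d) w := (expR (- k * `|g_ w|) * expR (2 * `|dot (x w) c|))%:E.
have mV c : measurable_fun setT (V c).
  apply/measurable_EFinP; apply: measurable_funM.
    exact: (measurableT_comp (measurable_expRabs (- k)) (mxv v)).
  exact: (measurableT_comp (measurable_expRabs 2) (mxv c)).
have V0 c w : (0 <= V c w)%E by rewrite lee_fin mulr_ge0 ?expR_ge0.
apply: (@le_trans _ _ (\int[P]_w (V (perp v theta) w + V b w))%E).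
  apply: le_integralT.
  - exact: emeasurable_funD.
  - exact: emeasurable_funD.
  - by move=> w; apply: adde_ge0; apply: mule_ge0; rewrite ?F1_0 ?F0_0 ?lee_fin.
  - move=> w; rewrite /F1 /F0 /V -!EFinM -!EFinD lee_fin.
    have := resid_prob_bound w; rewrite -/(S (x w)) => /(ler_wpM2r (U0 (x w))) h.
    have e1 : expR (- (R0 / 2 * `|g_ w|)) * U (x w) = expR (- k * `|g_ w|) * expR `|dot (x w) b|.
      by rewrite /U -!expRD; congr expR; rewrite /k /g_; field.
    have e2 (z : R) : expR (2 * z) = expR z ^+ 2 by rewrite -expRM_natl.
    have h2 := sqr_ge0 (expR `|k_ w| - expR `|dot (x w) b|).
    have h3 : 2 * (expR `|k_ w| * expR `|dot (x w) b|) <= expR (2 * `|k_ w|) + expR (2 * `|dot (x w) b|).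
      rewrite !e2; move: h2; rewrite sqrrB; lra.
    have := ler_wpM2l (expR_ge0 (- k * `|g_ w|)) h3; rewrite -/(k_ w) => h4.
    rewrite -mulrDr; apply: le_trans h4.
    rewrite mulrCA [X in _ <= 2 * X]mulrCA -e1; apply: le_trans (le_trans h _).
      by rewrite /S le_eqVlt; apply/orP; left; apply/eqP; rewrite /g_; ring.
    by rewrite le_eqVlt; apply/orP; left; apply/eqP; ring.
rewrite ge0_integralD//.
apply: (@le_trans _ _ ((64 / k)%:E + (64 / k)%:E)%E).
  apply: leeD; apply: integral_exp_orth => //.
  by rewrite dot_perp.
rewrite -EFinD lee_fin /k.
have -> : 64 / (R0 * (3 / 8)) + 64 / (R0 * (3 / 8)) = (64 * 16 / 3) / R0.
  by field; rewrite gt_eqF.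
by rewrite ler_pM2r ?invr_gt0//; lra.
Qed.

(** 1024 = 16^2 * 4 comes from bounding (x.a)^2 by an exponential, and 400 from
    [integral_resid_exp]. *)
Definition bernC : R := 1024 * 400.

Let xi (a : 'cV[R]_d) w := resid x y v r w * dot (x w) a.

(** Expand by [expR_le_quad]: the linear term gives the mean, and the quadratic remainder is
    dominated by the weighted residual of [integral_resid_exp], of mean O(1/R0). The inequality 1 +
    z <= exp z restores the exponential form. *)
Lemma bernstein (a : 'cV[R]_d) (lam : R) :
  `|dot v a| <= R0 -> l2norm (perp v a) <= 1 -> `|lam| <= 16^-1 ->
  (\int[P]_w (expR (lam * xi a w))%:E <=
    (expR (lam * mean_resid theta v r a + bernC * lam ^+ 2 / R0))%:E)%E.
Proof.
move=> va pa lam1.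
have th0 : theta != 0.
  by apply/eqP => th0; have := R0_gt0; move: th_ge; rewrite th0 dot0r; lra.
set b := perp v a in pa.
have vb : dot v b = 0 by rewrite dot_perp.
pose E w := `|resid x y v r w| * expR (R0 / 8 * `|g_ w| + `|dot (x w) b|).
have mxi : measurable_fun setT (xi a).
  by apply: measurable_funM => //; exact: measurable_resid.
have mE : measurable_fun setT E.
  apply: measurable_funM; first by apply: measurableT_comp => //; exact: measurable_resid.
  apply: measurableT_comp => //; apply: measurable_funD.
    apply: measurable_funM => //; apply: measurableT_comp => //; exact: mxv.
  apply: measurableT_comp => //; exact: mxv.
have E0 w : 0 <= E w by rewrite mulr_ge0 ?expR_ge0.
have intE : (\int[P]_w (E w)%:E <= (400 / R0)%:E)%E by exact: integral_resid_exp.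
have iE : P.-integrable setT (EFin \o E).
  apply/integrableP; split; first exact/measurable_EFinP.
  rewrite (eq_integral (fun w => (E w)%:E)); last by move=> w _; rewrite /= ger0_norm.
  by apply: le_lt_trans intE _; rewrite ltry.
have ixi : P.-integrable setT (EFin \o xi a) by exact: integrable_resid_dot.
pose c := lam ^+ 2 * 1024.
have pw w : expR (lam * xi a w) <= 1 + lam * xi a w + c * E w.
  apply: le_trans (expR_le_quad _) _; rewrite lerD2l.
  (* |x.a| <= 16 U, so |lam| <= 1/16 gives |lam xi| <= U. The square and the exponential then cost
     exp U each, and exp (2 U) is within the weight in [E]; one factor |resid| is kept and the other
     bounded by 1. *)
  pose U := (R0 * `|g_ w| + `|dot (x w) b|) / 16.
  have U0 : 0 <= U by rewrite divr_ge0// addr_ge0// mulr_ge0// ltW.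
  have xa : `|dot (x w) a| <= 16 * U.
    have Ea := perpE v a; rewrite -/b in Ea; rewrite [in leLHS]Ea dotDr dotZr.
    apply: le_trans (ler_normD _ _) _; rewrite normrM /U [leRHS]mulrC divfK; last lra.
    by rewrite lerD2r ler_wpM2r.
  have e1 := resid_le1 x y v r w; have e0 := normr_ge0 (resid x y v r w).
  have h1 : `|lam * xi a w| <= U.
    rewrite /xi !normrM; apply: (@le_trans _ _ (16^-1 * (1 * (16 * U)))).
      by apply: ler_pM => //; apply: ler_pM.
    by rewrite mul1r mulKf.
  have h2 : (xi a w) ^+ 2 <= `|resid x y v r w| * (16 * U) ^+ 2.
    rewrite -real_normK ?num_real// /xi normrM exprMn; apply: ler_pM; rewrite ?sqr_ge0//.
      by rewrite expr2 ler_piMl.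
    by rewrite ler_sqr ?nnegrE// mulr_ge0.
  have h3 := sqr_le_expR U0.
  have h4 : (xi a w) ^+ 2 <= `|resid x y v r w| * (1024 * expR U).
    apply: le_trans h2 _; rewrite ler_wpM2l// exprMn.
    have -> : 1024 * expR U = 16 ^+ 2 * (4 * expR U) by ring.
    by rewrite ler_wpM2l// exprn_ge0.
  have h5 : expR `|lam * xi a w| <= expR U by rewrite ler_expR.
  have h6 : (xi a w) ^+ 2 * expR `|lam * xi a w| <= 1024 * E w.
    apply: (@le_trans _ _ (`|resid x y v r w| * (1024 * expR U) * expR U)).
      by apply: ler_pM => //; rewrite ?sqr_ge0 ?expR_ge0.
    have -> : `|resid x y v r w| * (1024 * expR U) * expR U = 1024 * (`|resid x y v r w| * (expR U * expR U)) by ring.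
    apply: ler_wpM2l; first lra.
    apply: ler_wpM2l; first exact: e0.
    rewrite -expRD ler_expR /U.
    have n0 := normr_ge0 (dot (x w) b); lra.
  apply: (@le_trans _ _ (lam ^+ 2 * (1024 * E w))); last by rewrite /c -[leRHS]mulrA.
  by rewrite exprMn -[leLHS]mulrA; apply: ler_wpM2l => //; exact: sqr_ge0.
have c0 : 0 <= c by apply: mulr_ge0; [exact: sqr_ge0|lra].
apply: (@le_trans _ _ (\int[P]_w (1 + lam * xi a w + c * E w)%:E)%E).
  apply: le_integral_EFin => //.
  - by apply: measurableT_comp => //; exact: measurable_funM.
  - apply: measurable_funD; last exact: measurable_funM.
    by apply: measurable_funD => //; exact: measurable_funM.
have i2 : P.-integrable setT (fun w => (lam * xi a w)%:E).
  by under eq_fun do rewrite EFinM; exact: integrableZl.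
have i3 : P.-integrable setT (fun w => (c * E w)%:E).
  by under eq_fun do rewrite EFinM; exact: integrableZl.
have i1 : P.-integrable setT (fun w : T => 1%:E).
  exact: finite_measure_integrable_cst.
under eq_integral do rewrite EFinD EFinD.
rewrite integralD//; last exact: integrableD.
rewrite integralD//.
rewrite [X in (X + _ + _)%E](integral_prob_cst P).
under [X in (_ + X + _)%E]eq_integral do rewrite EFinM.
under [X in (_ + X)%E]eq_integral do rewrite EFinM.
rewrite !integralZl// (mean_residE mx my gx ly)//.
apply: (@le_trans _ _ (1 + lam%:E * (mean_resid theta v r a)%:E + c%:E * (400 / R0)%:E)%E).
  by apply: leeD2l; apply: lee_wpmul2l; rewrite ?lee_fin.
rewrite -!EFinM -!EFinD lee_fin -addrA; apply: le_trans (expR_ge1Dx _).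
rewrite lerD2l lerD2l /c /bernC le_eqVlt; apply/orP; left; apply/eqP.
by ring.
Qed.

End one_sample_bounds.

(** * Curvature of the loss: moments of the observations with bounded linear predictor *)

Section small_ball.
Context {R : realType} {disp : measure_display} {T : measurableType disp}
  (P : probability T R) {d : nat}.
Variables (x : T -> 'cV[R]_d).
Hypothesis mx : measurable_fun setT x.
Hypothesis gx : std_gaussian_vec P x.
Variables (u : 'cV[R]_d) (R0 : R).
Hypothesis u1 : dot u u = 1.
Hypothesis R0_ge1 : 1 <= R0.

Let R0_gt0 : 0 < R0. Proof. exact: lt_le_trans R0_ge1. Qed.

Let mxv v : measurable_fun setT (fun w => dot (x w) v) := measurable_dot v mx.

(* The change of variables making the Fisher information isotropic up to the
   factor 1/R0. *)
Definition stretch (D : 'cV[R]_d) : 'cV[R]_d := D + ((R0 - 1) * dot u D) *: u.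

Lemma dot_stretch z D : dot z (stretch D) = R0 * dot u D * dot z u + dot z (perp u D).
Proof. by rewrite /stretch /perp dotDr dotBr !dotZr; ring. Qed.

(** With u = theta / R0 this says that the true linear predictor is at most 1 in absolute value, the
    region where [bregman_lb] supplies curvature. *)
Definition near0 (z : 'cV[R]_d) : bool := `|R0 * dot z u| <= 1.

Lemma gauss_one_minus (c : R) (J : set R) : measurable J ->
  (\int[gauss]_h (1 - c * \1_J h)%:E = (1 - c * fine (gauss J))%:E)%E.
Proof.
move=> mJ.
have i1 : gauss.-integrable setT (fun _ : R => 1%:E).
  exact: (@finite_measure_integrable_cst _ _ _ (@gauss R) _ _ measurableT).
have iJ : gauss.-integrable setT (EFin \o (\1_J : R -> R)).
  exact: integrable_indic.
have i2 : gauss.-integrable setT (fun h : R => (c * \1_J h)%:E).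
  by under eq_fun do rewrite EFinM; exact: integrableZl.
under eq_integral do rewrite EFinB.
rewrite integralB_EFin// [X in (X - _)%E](integral_prob_cst gauss).
under eq_integral do rewrite EFinM.
rewrite integralZl//= integral_indic// setIT EFinB EFinM fineK//.
by apply: fin_num_measure.
Qed.

Lemma measurable_near0 : measurable [set z | near0 z].
Proof.
rewrite -[X in measurable X]setTI.
apply: (measurable_fun_le (f := fun z : 'cV[R]_d => `|R0 * dot z u|) (g := fun=> 1)) => //.
apply: measurableT_comp => //; apply: measurable_funM => //; exact: measurable_dot.
Qed.

(** On an event of probability at least of order 1/R0 the observation is near 0 and its product with
    the stretched D is at least s / 2. The exponential is therefore at most 1 - ka on that event,
    and 1 - z <= exp (- z). *)
Lemma small_ball (D : 'cV[R]_d) (s : R) : 0 < s -> s <= 1 -> s <= l2norm D ->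
  (\int[P]_w (expR (- ((near0 (x w))%:R * Num.min 1 (dot (x w) (stretch D) ^+ 2))))%:E
    <= (expR (- ((1 - expR (- (s ^+ 2 / 4))) * pdf1 ^+ 2 / 4 / R0)))%:E)%E.
Proof.
move=> s0 s1 sD.
set b := perp u D; set c := dot u D.
have ub : dot u b = 0 by rewrite dot_perp.
set be := l2norm b.
have be0 : 0 <= be := l2norm_ge0 b.
have cb : s <= `|c| + be.
  apply: le_trans sD _; rewrite -ler_sqr ?nnegrE ?l2norm_ge0 ?addr_ge0//.
  rewrite (pythagoras D u1) -/b -/c -/be sqrrD real_normK ?num_real//.
  have : 0 <= `|c| * be by rewrite mulr_ge0.
  lra.
pose near1 (g : R) : bool := `|R0 * g| <= 1.
pose f (g h : R) := expR (- ((near1 g)%:R * Num.min 1 ((R0 * c * g + h) ^+ 2))).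
have mf : measurable_fun setT (fun p : R * R => f p.1 p.2).
  apply: measurableT_comp => //; apply: measurableT_comp => //; apply: measurable_funM.
    have mA : measurable [set p : R * R | `|R0 * p.1| <= 1].
      rewrite -[X in measurable X]setTI.
      apply: (measurable_fun_le (f := fun p : R * R => `|R0 * p.1|) (g := fun=> 1)) => //.
      by apply: measurableT_comp => //; apply: measurable_funM.
    rewrite (_ : (fun p : R * R => _) = (\1_[set p : R * R | `|R0 * p.1| <= 1] : _ -> R)).
      exact: measurable_indic.
    by apply/funext => p; rewrite indicE; congr (_%:R : R); congr nat_of_bool; apply/idP/idP; rewrite inE.
  apply: measurable_minr => //; apply: measurable_funX; apply: measurable_funD => //.
  exact: measurable_funM.
have f0 g h : (0 <= (f g h)%:E)%E by rewrite lee_fin expR_ge0.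
have mf2 : measurable2 (fun g h => (f g h)%:E) by exact/measurable_EFinP.
rewrite (eq_integral (fun w => (f (dot (x w) u) (dot (x w) b))%:E)); last first.
  by move=> w _; rewrite dot_stretch.
rewrite (gauss_pair mx gx u1 ub mf2 f0) -/be.
pose I : set R := `[(2 * R0)^-1, R0^-1]%classic.
(* The sign of h is matched with that of c, so that the contributions along u and orthogonal to u do
   not cancel. *)
pose J : set R := if 0 <= c then `[2^-1, 1]%classic else `[-1, - 2^-1]%classic.
have mI : measurable I by exact: measurable_itv.
have mJ : measurable J by rewrite /J; case: ifP => _; exact: measurable_itv.
pose ka := 1 - expR (- (s ^+ 2 / 4)).
have ka0 : 0 <= ka by rewrite subr_ge0 -expR0 ler_expR oppr_le0 divr_ge0// sqr_ge0.
have ka1 : ka <= 1 by rewrite gerBl expR_ge0.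
have pw g h : f g (be * h) <= 1 - ka * \1_I g * \1_J h.
  have f1 : f g (be * h) <= 1.
    by rewrite /f -[leRHS]expR0 ler_expR oppr_le0 mulr_ge0// le_min ler01 sqr_ge0.
  rewrite !indicE; case: (boolP (g \in I)) => [|_]; last by rewrite mulr0 mul0r subr0.
  case: (boolP (h \in J)) => [|_]; last by rewrite mulr0 subr0.
  rewrite !inE => hJ; rewrite /I/= in_itv/= => /andP[g1 g2].
  rewrite !mulr1 /ka opprB addrC subrK /f ler_expR lerN2.
  have gp : 0 < g by apply: lt_le_trans g1; rewrite invr_gt0 mulr_gt0.
  have Rg1 : R0 * g <= 1 by rewrite -(divff (lt0r_neq0 R0_gt0)) ler_pM2l.
  have Rg2 : 2^-1 <= R0 * g.
    have := ler_wpM2l (ltW R0_gt0) g1; rewrite invfM mulrCA mulfV ?gt_eqF// mulr1; exact.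
  have -> : near1 g by rewrite /near1 ger0_norm ?mulr_ge0 ?(ltW R0_gt0) ?(ltW gp).
  rewrite mul1r.
  rewrite le_min; apply/andP; split.
    have : s ^+ 2 <= 1 by rewrite expr_le1// ltW.
    have := sqr_ge0 s; lra.
  rewrite (mulrAC R0 c g).
  have key : 2^-1 * s <= `|R0 * g * c + be * h|.
    move: hJ cb; rewrite /J; case: (leP 0 c) => c0 /=; rewrite in_itv/= => /andP[h1 h2].
      rewrite (ger0_norm c0) => cb; rewrite ger0_norm; last first.
        by rewrite addr_ge0// mulr_ge0//; [rewrite mulr_ge0// ltW|lra].
      have k1 : 2^-1 * c <= R0 * g * c by rewrite ler_wpM2r.
      have k2 : 2^-1 * be <= be * h by rewrite mulrC ler_wpM2l.
      lra.
    rewrite (ltr0_norm c0) => cb.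
    have k1 : R0 * g * c <= 2^-1 * c by rewrite ler_wnM2r// ltW.
    have k2 : be * h <= be * (- 2^-1) by rewrite ler_wpM2l.
    by rewrite ler0_norm; lra.
  have -> : s ^+ 2 / 4 = (2^-1 * s) ^+ 2 by rewrite exprMn; field.
  rewrite -[leRHS]real_normK ?num_real// ler_sqr ?nnegrE//.
  by rewrite mulr_ge0// ltW.
have pI : pdf1 / 2 / R0 <= fine (gauss I).
  have iR : (R0 : R)^-1 <= 1 by rewrite invf_le1.
  have iR2 : (2 * R0)^-1 <= R0^-1 by rewrite lef_pV2 ?posrE ?mulr_gt0 ?R0_gt0//; have := R0_gt0; lra.
  have i0 : 0 <= (2 * R0)^-1 by rewrite invr_ge0 mulr_ge0// ltW.
  have h := gauss_itv (le_trans (lerN10 R) i0) iR2 iR.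
  rewrite -lee_fin fineK ?fin_num_measure//; apply: le_trans h.
  by rewrite lee_fin le_eqVlt; apply/orP; left; apply/eqP; field; rewrite gt_eqF.
have pJ : pdf1 / 2 <= fine (gauss J).
  rewrite -lee_fin fineK ?fin_num_measure// /J; case: ifP => _.
    have := @gauss_itv R 2^-1 1; move=> /(_ ltac:(lra) ltac:(lra) ltac:(lra)).
    by apply: le_trans; rewrite lee_fin; lra.
  have := @gauss_itv R (-1) (- 2^-1); move=> /(_ ltac:(lra) ltac:(lra) ltac:(lra)).
  by apply: le_trans; rewrite lee_fin; lra.
have p1 := @pdf1_gt0 R.
have gJ0 : 0 <= fine (gauss J) by exact: fine_ge0.
have gJ1 : fine (gauss J) <= 1.
  by rewrite -lee_fin fineK ?fin_num_measure// probability_le1.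
apply: (@le_trans _ _ (\int[gauss]_g (1 - (ka * fine (gauss J)) * \1_I g)%:E)%E).
  apply: le_integralT.
  - have mf' := measurable2_lin 1 0 0 be mf2.
    have := @measurable_fun_fubini_tonelli_F _ _ _ _ _ gauss _ mf' (fun p => f0 _ _).
    rewrite /fubini_F/=; congr (measurable_fun _ _).
    by apply/funext => g; apply: eq_integral => h _; rewrite !mul1r !mul0r addr0 add0r.
  - by apply/measurable_EFinP; apply: measurable_funB => //; apply: measurable_funM.
  - by move=> g; apply: integral_ge0 => h _.
  - move=> g; apply: (@le_trans _ _ (\int[gauss]_h (1 - (ka * \1_I g) * \1_J h)%:E)%E).
      apply: le_integral_EFin => //.
      + have := measurable2_r g (measurable2_lin 1 0 0 be mf2).
        move=> /measurable_EFinP; congr (measurable_fun _ _).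
        by apply/funext => h; rewrite !mul1r !mul0r addr0 add0r.
      + by apply: measurable_funB => //; apply: measurable_funM.
      + by move=> h; exact: expR_ge0.
    by rewrite gauss_one_minus// lee_fin le_eqVlt; apply/orP; left; apply/eqP; ring.
rewrite gauss_one_minus// lee_fin.
apply: le_trans (expR_ge1Dx _); rewrite lerD2l lerN2.
have -> : ka * pdf1 ^+ 2 / 4 / R0 = ka * (pdf1 / 2) * (pdf1 / 2 / R0) by field; rewrite gt_eqF.
apply: ler_pM => //.
- by rewrite mulr_ge0// divr_ge0// ltW.
- by rewrite divr_ge0 ?divr_ge0// ltW.
- by rewrite ler_wpM2l.
Qed.

(** On [near0] the product is at most 1 + |x.b|, and the indicator is at most exp (1 - R0 |x.u|).
    The two factors e give e^2 <= 16, and 1024 = 16 * 64. *)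
Lemma near0_mgf (D : 'cV[R]_d) : l2norm D <= 1 ->
  (\int[P]_w (expR ((near0 (x w))%:R * `|dot (x w) (stretch D)|))%:E
    <= (expR (1024 / R0))%:E)%E.
Proof.
move=> D1; set b := perp u D.
have ub : dot u b = 0 by rewrite dot_perp.
have b1 : l2norm b <= 1 by apply: le_trans (l2norm_perp D u1) D1.
have c1 : `|dot u D| <= 1.
  apply: le_trans (cauchy_schwarz u D) _.
  by rewrite {1}/l2norm u1 sqrtr1 mul1r.
pose E w := expR (- R0 * `|dot (x w) u|) * expR (2 * `|dot (x w) b|).
have mE : measurable_fun setT E.
  apply: measurable_funM.
    exact: (measurableT_comp (measurable_expRabs (- R0))).
  exact: (measurableT_comp (measurable_expRabs 2)).
have E0 w : 0 <= E w by rewrite mulr_ge0 ?expR_ge0.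
have mnear : measurable_fun setT (fun w => (near0 (x w))%:R : R).
  rewrite (_ : (fun w => _) = (\1_[set z | near0 z] : _ -> R) \o x).
    by apply: measurableT_comp => //; apply: measurable_indic; exact: measurable_near0.
  by apply/funext => p/=; rewrite indicE; congr (_%:R : R); congr nat_of_bool; apply/idP/idP; rewrite inE.
have e1 : expR 2 = expR (1 / 2) ^+ 4 :> R by rewrite -expRM_natl; congr expR; field.
have e2 : expR 2 <= 16 :> R.
  have h := @expR_half_le2 R; have h0 := expR_ge0 (1 / 2 : R).
  have : expR (1 / 2) ^+ 4 <= (2 : R) ^+ 4 by apply: lerXn2r; rewrite ?nnegrE.
  rewrite e1; lra.
have pw w : expR ((near0 (x w))%:R * `|dot (x w) (stretch D)|) <= 1 + 16 * E w.
  case: (boolP (near0 (x w))) => [nr|_]; last by rewrite mul0r expR0 lerDl mulr_ge0.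
  rewrite mul1r; apply: (@le_trans _ _ (16 * E w)); last by rewrite lerDr.
  have h : `|dot (x w) (stretch D)| <= 1 + `|dot (x w) b|.
    rewrite dot_stretch; apply: le_trans (ler_normD _ _) _; rewrite lerD2r.
    rewrite mulrAC normrM -[leRHS]mulr1; apply: ler_pM => //.
  apply: (@le_trans _ _ (expR 2 * E w)); last by rewrite ler_wpM2r.
  rewrite /E -!expRD ler_expR; move: nr; rewrite /near0 normrM (ger0_norm (ltW R0_gt0)).
  have := normr_ge0 (dot (x w) b); lra.
apply: (@le_trans _ _ (\int[P]_w (1 + 16 * E w)%:E)%E).
  apply: le_integral_EFin => //.
  - apply: measurableT_comp => //; apply: measurable_funM => //.
    by apply: measurableT_comp.
  - by apply: measurable_funD => //; exact: measurable_funM.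
under eq_integral do rewrite EFinD EFinM.
have mE' : measurable_fun setT (fun w => (E w)%:E) by exact/measurable_EFinP.
rewrite ge0_integralD//; last 2 first.
- by move=> w _; rewrite mule_ge0 ?lee_fin.
- by apply: emeasurable_funM.
rewrite ge0_integralZl//; last by move=> w _; rewrite lee_fin.
rewrite [X in (X + _)%E](integral_prob_cst P).
apply: (@le_trans _ _ (1 + 16%:E * (64 / R0)%:E)%E).
  apply: leeD2l; apply: lee_wpmul2l; first by rewrite lee_fin.
  exact: integral_exp_orth.
rewrite -EFinM -EFinD lee_fin; apply: le_trans (expR_ge1Dx _).
by rewrite lerD2l mulrA; lra.
Qed.

End small_ball.

(** * Nets of the ball *)

Section net.
Context {R : realType}.

Lemma sum_pow2_le (M : nat) : \sum_(a < M) (2^-1 : R) ^+ a <= 2.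
Proof.
suff : \sum_(a < M) (2^-1 : R) ^+ a + 2 * 2^-1 ^+ M = 2.
  have : 0 <= (2^-1 : R) ^+ M by rewrite exprn_ge0// invr_ge0.
  lra.
elim: M => [|M IH]; first by rewrite big_ord0 expr0; lra.
rewrite big_ord_recr/= exprS -[RHS]IH; lra.
Qed.

(** Each counted function has weight 2^S 2^(- sum) >= 1, and the total weight of all functions
    factorises over the coordinates: each factor is two signs times a geometric series, at most
    4. *)
Lemma card_small_ffun (d S : nat) :
  (#|[pred f : {ffun 'I_d -> bool * 'I_S.+1} | (\sum_j (f j).2 <= S)%N]|)%:R
    <= 2 ^+ S * 4 ^+ d :> R.
Proof.
rewrite -sum1_card natr_sum.
apply: (@le_trans _ _ (\sum_(f : {ffun 'I_d -> bool * 'I_S.+1})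
    2 ^+ S * \prod_j (2^-1 : R) ^+ ((f j).2 : nat))).
  rewrite [leRHS](bigID (fun f : {ffun 'I_d -> bool * 'I_S.+1} => (\sum_j (f j).2 <= S)%N))/=.
  rewrite -[leLHS]addr0; apply: lerD; last first.
    by apply: sumr_ge0 => f _; rewrite mulr_ge0 ?exprn_ge0// prodr_ge0// => j _; rewrite exprn_ge0// invr_ge0.
  apply: ler_sum => f; rewrite inE => hf.
  have -> : \prod_j (2^-1 : R) ^+ ((f j).2 : nat) = (2 ^+ (\sum_j (f j).2))^-1.
    by rewrite -expr_sum exprVn.
  by rewrite ler_pdivlMr ?exprn_gt0// mul1r ler_weXn2l// ler1n.
rewrite -mulr_sumr ler_wpM2l ?exprn_ge0//.
have -> : \sum_(f : {ffun 'I_d -> bool * 'I_S.+1}) \prod_j (2^-1 : R) ^+ ((f j).2 : nat)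
   = \prod_(j < d) \sum_(p : bool * 'I_S.+1) (2^-1 : R) ^+ (p.2 : nat).
  by rewrite (bigA_distr_bigA (fun (j : 'I_d) (p : bool * 'I_S.+1) => (2^-1 : R) ^+ (p.2 : nat))).
rewrite prodr_const card_ord; apply: lerXn2r; rewrite ?nnegrE//.
  by apply: sumr_ge0 => p _; rewrite exprn_ge0// invr_ge0.
rewrite -(pair_big xpredT xpredT (fun (_ : bool) (a : 'I_S.+1) => (2^-1 : R) ^+ a))/=.
rewrite big_bool/=; have := sum_pow2_le S.+1; lra.
Qed.

(** The d-th root of the bound of [card_small_ffun] at S = d N^2. *)
Definition netK (N : nat) : R := 2 ^+ (N ^ 2) * 4.

(* Rounding the coordinates towards 0 to multiples of 1 / (N sqrt d) stays in
   the ball; the integer points k in question have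
   |k|_1 <= |k|_2^2 <= d N^2, and are counted with the weights 2^(-|k|_1). *)
Lemma ball_net (d N : nat) : (0 < d)%N -> (0 < N)%N ->
  exists s : seq 'cV[R]_d, [/\ (size s)%:R <= netK N ^+ d,
    forall z, z \in s -> l2norm z <= 1 &
    forall D, l2norm D <= 1 -> exists2 z, z \in s & l2norm (D - z) <= N%:R^-1].
Proof.
move=> d0 N0.
have dR : 0 < d%:R :> R by rewrite ltr0n.
have NR : 0 < N%:R :> R by rewrite ltr0n.
pose h : R := (N%:R * Num.sqrt d%:R)^-1.
have sd : 0 < Num.sqrt (d%:R : R) by rewrite sqrtr_gt0.
have h0 : 0 < h by rewrite invr_gt0 mulr_gt0.
have h2 : h ^+ 2 * (d * N ^ 2)%:R = 1.
  rewrite /h exprVn exprMn sqr_sqrtr ?ler0n// natrM natrX mulrC mulrC [d%:R * _]mulrC mulVf//.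
  by rewrite mulf_neq0// ?expf_neq0// gt_eqF.
pose S := (d * N ^ 2)%N.
pose vec (f : {ffun 'I_d -> bool * 'I_S.+1}) : 'cV[R]_d :=
  \col_j ((-1) ^+ (f j).1 * ((f j).2 : nat)%:R * h).
pose s := [seq z <- [seq vec f | f <- enum [pred f : {ffun 'I_d -> bool * 'I_S.+1} | (\sum_j (f j).2 <= S)%N]] | l2norm z <= 1].
exists s; split.
- apply: (@le_trans _ _ (2 ^+ S * 4 ^+ d)).
    apply: le_trans (card_small_ffun d S); rewrite ler_nat /s size_filter.
    by apply: leq_trans (count_size _ _) _; rewrite size_map -cardE.
  by rewrite /netK exprMn -exprM /S mulnC.
- by move=> z; rewrite mem_filter => /andP[].
- move=> D D1.
  have D2 : dot D D <= 1 by rewrite -l2norm_sqr expr_le1// l2norm_ge0.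
  pose a j := Num.truncn (`|D j 0| / h).
  have aP j : (a j)%:R * h <= `|D j 0| < (a j).+1%:R * h.
    by have /andP[] := truncn_itv (divr_ge0 (normr_ge0 (D j 0)) (ltW h0)); rewrite ler_pdivlMr// ltr_pdivrMr// => -> ->.
  have sumA : (\sum_j a j <= S)%N.
    rewrite -(ler_nat R) natr_sum.
    have : h ^+ 2 * (\sum_j (a j)%:R) <= h ^+ 2 * S%:R.
      rewrite h2; apply: le_trans D2; rewrite mulr_sumr /dot; apply: ler_sum => j _.
      apply: (@le_trans _ _ (((a j)%:R * h) ^+ 2)).
        rewrite exprMn mulrC ler_wpM2r ?sqr_ge0// -natrX ler_nat.
        by rewrite -mulnn; case: (a j) => // k; rewrite leq_pmulr.
      rewrite -expr2 -[leRHS]real_normK ?num_real// lerXn2r ?nnegrE// ?mulr_ge0//; first exact: ltW.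
      by have /andP[] := aP j.
    by rewrite ler_pM2l// exprn_gt0.
  have aS j : (a j < S.+1)%N.
    by rewrite ltnS; apply: leq_trans sumA; rewrite (bigD1 j)//= leq_addr.
  pose f : {ffun 'I_d -> bool * 'I_S.+1} := [ffun j => (D j 0 < 0, Ordinal (aS j))].
  have DE j : D j 0 = (-1) ^+ (D j 0 < 0)%R * `|D j 0|.
    have [hD|hD] := ltP (D j 0) 0; first by rewrite expr1 mulN1r ltr0_norm// opprK.
    by rewrite expr0 mul1r ger0_norm.
  have vE j : vec f j 0 = (-1) ^+ (D j 0 < 0)%R * ((a j)%:R * h) by rewrite /vec mxE ffunE/= mulrA.
  have sqr1 j : ((-1) ^+ (D j 0 < 0)%R : R) ^+ 2 = 1 by rewrite sqrr_sign.
  have l2_1 (c : 'cV[R]_d) (e : R) : 0 <= e -> dot c c <= e ^+ 2 -> l2norm c <= e.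
    by move=> e0 he; rewrite -ler_sqr ?nnegrE ?l2norm_ge0// l2norm_sqr.
  have v1 : l2norm (vec f) <= 1.
    apply: l2_1 => //; rewrite expr1n; apply: le_trans D2; rewrite /dot; apply: ler_sum => j _.
    rewrite -!expr2 vE exprMn sqr1 mul1r -[leRHS]real_normK ?num_real//.
    rewrite lerXn2r ?nnegrE// ?mulr_ge0//; first exact: ltW.
    by have /andP[] := aP j.
  exists (vec f).
    rewrite mem_filter v1/=; apply/mapP; exists f => //; rewrite mem_enum inE.
    by under eq_bigr do rewrite ffunE.
  apply: l2_1; first by rewrite invr_ge0.
  apply: (@le_trans _ _ (\sum_(j < d) h ^+ 2)).
    rewrite /dot; apply: ler_sum => j _; rewrite -expr2 !mxE.
    have -> : D j 0 - (-1) ^+ (f j).1 * ((f j).2 : nat)%:R * h = (-1) ^+ (D j 0 < 0)%R * (`|D j 0| - (a j)%:R * h).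
      by rewrite ffunE/= {1}DE; ring.
    rewrite exprMn sqr1 mul1r lerXn2r ?nnegrE//; [|exact: ltW|].
      by rewrite subr_ge0; have /andP[] := aP j.
    by have /andP[_] := aP j; rewrite -natr1; lra.
  rewrite sumr_const card_ord -[leRHS]mul1r -{1}h2 natrM natrX.
  by rewrite (exprVn N%:R) (mulrA _ d%:R) mulfK ?mulr_natr// expf_neq0// gt_eqF.
Qed.

Lemma net_l2norm (d : nat) (s : seq 'cV[R]_d) (z : 'cV[R]_d) (B : R) :
  (forall D, l2norm D <= 1 -> exists2 D', D' \in s & l2norm (D - D') <= 2^-1) ->
  0 <= B -> (forall D, D \in s -> dot z D <= B) -> l2norm z <= 2 * B.
Proof.
move=> net B0 hB; have [->|z0] := eqVneq z 0; first by rewrite l2norm0 mulr_ge0.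
have nz : 0 < l2norm z by rewrite l2norm_gt0.
pose D := (l2norm z)^-1 *: z.
have [|D' D's hD] := net D; first by rewrite /l2norm l2norm_unit// sqrtr1.
have e : dot z D = l2norm z.
  by rewrite /D dotZr -l2norm_sqr expr2 mulKf// gt_eqF.
have h1 := hB _ D's.
have h2 : dot z (D - D') <= l2norm z * 2^-1.
  by apply: le_trans (dot_le _ _) _; rewrite ler_wpM2l// ltW.
move: h2; rewrite dotBr e; lra.
Qed.

(** Moving to the net shows that the supremum over the ball is at most B plus half of itself. The
    crude bound M makes this supremum finite, so that it can be absorbed. *)
Lemma net_seminorm (d : nat) (s : seq 'cV[R]_d) (p : 'cV[R]_d -> R) (B M : R) :
  (forall D, l2norm D <= 1 -> exists2 D', D' \in s & l2norm (D - D') <= 2^-1) ->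
  (forall D E, p (D + E) <= p D + p E) -> (forall c D, p (c *: D) = `|c| * p D) ->
  (forall D, l2norm D <= 1 -> p D <= M) ->
  (forall D, D \in s -> p D <= B) -> forall D, p D <= 2 * B * l2norm D.
Proof.
move=> net pD pZ pM pB.
pose A := [set p D | D in [set D : 'cV[R]_d | l2norm D <= 1]].
have hA : has_sup A.
  split; first by exists (p 0); exists 0 => //=; rewrite l2norm0.
  by exists M => _ [D D1 <-]; exact: pM.
have le_sup D : l2norm D <= 1 -> p D <= sup A.
  by move=> D1; apply: ub_le_sup; [exact: hA.2|exists D].
have supB : sup A <= B + 2^-1 * sup A.
  apply: ge_sup; first exact: hA.1.
  move=> _ [D D1 <-]; have [D' D's hD] := net D D1.
  rewrite -(subrK D' D) addrC; apply: le_trans (pD _ _) _; apply: lerD; first exact: pB.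
  have -> : D - D' = 2^-1 *: (2 *: (D - D')) by rewrite scalerA mulVf ?scale1r// lt0r_neq0.
  rewrite pZ ger0_norm// ler_wpM2l//; apply: le_sup.
  rewrite l2normZ ger0_norm//; lra.
have hS : sup A <= 2 * B by lra.
move=> D; have [->|D0] := eqVneq D 0.
  by rewrite l2norm0 mulr0 -(scale0r (0 : 'cV[R]_d)) pZ normr0 mul0r.
have nz : 0 < l2norm D by rewrite l2norm_gt0.
have -> : p D = l2norm D * p ((l2norm D)^-1 *: D).
  by rewrite pZ ger0_norm ?invr_ge0 ?ltW// mulrA mulfV ?mul1r// gt_eqF.
rewrite [leLHS]mulrC (ler_wpM2r (ltW nz))//; apply: le_trans hS; apply: le_sup.
by rewrite /l2norm l2norm_unit// sqrtr1.
Qed.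

Lemma union_bound_seq {disp} {T : measurableType disp} (P : probability T R) (I : eqType)
  (s : seq I) (A : I -> set T) (p : R) :
  (forall i, i \in s -> measurable (A i)) -> (forall i, i \in s -> (P (A i) <= p%:E)%E) ->
  measurable [set w | exists2 i, i \in s & A i w] /\
  (P [set w | exists2 i, i \in s & A i w] <= ((size s)%:R * p)%:E)%E.
Proof.
elim: s => [|i s IH] mA hA.
  have -> : [set w | exists2 i : I, i \in [::] & A i w] = set0.
    by apply/seteqP; split => // w [].
  by rewrite measure0 mul0r.
have -> : [set w | exists2 j : I, j \in i :: s & A j w] = A i `|` [set w | exists2 j, j \in s & A j w].
  apply/seteqP; split => w /=.
    by move=> [j]; rewrite inE => /orP[/eqP->|js] Aj; [left|right; exists j].
  move=> [Ai|[j js Aj]]; first by exists i => //; rewrite mem_head.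
  by exists j => //; rewrite inE js orbT.
have [|j js|m1 p1] := IH; first by move=> j js; apply: mA; rewrite inE js orbT.
  by apply: hA; rewrite inE js orbT.
 have mi := mA i (mem_head _ _); split; first exact: measurableU.
apply: le_trans (measureU2 _ _ _) _ => //.
rewrite /= -natr1 mulrDl mul1r addrC EFinD; apply: leeD => //.
exact: hA (mem_head _ _).
Qed.

End net.

(** * Step 1: uniform events *)

Section chernoff_net.
Context {R : realType} {d1 d2 : measure_display} {T : measurableType d1}
  {T' : measurableType d2} (P : probability T R) {n : nat}.
Variable Z : 'I_n -> T -> T'.
Hypothesis mZ : forall i, measurable_fun setT (Z i).
Hypothesis indep : mutually_independent P Z.

Lemma measurable_le_set {d0} {U : measurableType d0} (f g : U -> R) :
  measurable_fun setT f -> measurable_fun setT g -> measurable [set w | f w <= g w].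
Proof. by move=> mf mg; rewrite -[X in measurable X]setTI; exact: measurable_fun_le. Qed.

Lemma measurable_lt_set {d0} {U : measurableType d0} (f g : U -> R) :
  measurable_fun setT f -> measurable_fun setT g -> measurable [set w | f w < g w].
Proof.
move=> mf mg; rewrite (_ : [set w | _] = ~` [set w | g w <= f w]).
  by apply: measurableC; exact: measurable_le_set.
by apply/seteqP; split => w /=; rewrite ltNge => /negP.
Qed.

Lemma measurable_forall_seq (I : eqType) (s : seq I) {d0} {U : measurableType d0} (A : I -> set U) :
  (forall i, i \in s -> measurable (A i)) -> measurable [set w | forall i, i \in s -> A i w].
Proof.
elim: s => [|i s IH] mA.
  by rewrite (_ : [set w | _] = setT)//; apply/seteqP; split.
rewrite (_ : [set w | _] = A i `&` [set w | forall i, i \in s -> A i w]).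
  apply: measurableI; first by apply: mA; rewrite mem_head.
  by apply: IH => j js; apply: mA; rewrite inE js orbT.
apply/seteqP; split => w /=.
  by move=> h; split; [apply: h; rewrite mem_head|move=> j js; apply: h; rewrite inE js orbT].
by move=> [h1 h2] j; rewrite inE => /orP[/eqP->|/h2].
Qed.

Lemma sum_ord_lt (l : nat) (a : R) : (l <= n)%N -> \sum_(j < n | (j < l)%N) a = l%:R * a.
Proof.
by move=> ln; rewrite -(big_ord_widen n (fun=> a) ln) sumr_const card_ord mulr_natl.
Qed.

(** A union bound: the size exp (K D) of the net, with D the dimension in the uses below, is paid
    for by the excess K D in tau. *)
Lemma chernoff_net (I : eqType) (s : seq I) (h : I -> T' -> R) (l : nat) (a tau K t D : R) :
  (l <= n)%N -> (forall i, measurable_fun setT (h i)) ->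
  (forall i (j : 'I_n), i \in s -> (\int[P]_w (expR (h i (Z j w)))%:E <= (expR a)%:E)%E) ->
  (size s)%:R <= expR (K * D) -> K * D + t <= tau ->
  let G := [set W : n.-tuple T' | forall i, i \in s -> \sum_(j < n | (j < l)%N) h i (tnth W j) < l%:R * a + tau] in
  [/\ measurable G, indep_of_ge l G & (P (data Z @^-1` (~` G)) <= (expR (- t))%:E)%E].
Proof.
move=> ln mh hh sK tK G.
have msum i : measurable_fun setT (fun W : n.-tuple T' => \sum_(j < n | (j < l)%N) h i (tnth W j)).
  by apply: measurable_sum_cond => j jl; exact: (measurableT_comp (mh i) (measurable_tnth j)).
have mb i : measurable [set W : n.-tuple T' | \sum_(j < n | (j < l)%N) h i (tnth W j) < l%:R * a + tau].
  exact: measurable_lt_set.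
have mG : measurable G.
  apply: (measurable_forall_seq (A := fun i => [set W : n.-tuple T' |
    \sum_(j < n | (j < l)%N) h i (tnth W j) < l%:R * a + tau])) => i _; exact: mb.
split => //.
  move=> W j z lj; rewrite /G/=.
  have e i : \sum_(k < n | (k < l)%N) h i (tnth (upd W j z) k) = \sum_(k < n | (k < l)%N) h i (tnth W k).
    apply: eq_bigr => k kl; rewrite tnth_upd.
    by case: (eqVneq k j) => // kj; move: kl; rewrite kj ltnNge lj.
  by apply/propext; split => H i /H; rewrite e.
pose A i := data Z @^-1` [set W | l%:R * a + tau <= \sum_(j < n | (j < l)%N) h i (tnth W j)].
have mA i : measurable (A i).
  rewrite -[A i]setTI; apply: measurable_data => //.
  exact: measurable_le_set.
have pA i : i \in s -> (P (A i) <= (expR (- tau))%:E)%E.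
  move=> si; have := @tuple_chernoff R d1 d2 T T' P n Z mZ indep 0 l a tau setT (fun j W => h i (tnth W j)) measurableT.
  rewrite preimage_setT probability_setT mule1.
  have -> : [set w | setT (data Z w) /\ tau <= \sum_(j < n | (0 <= j < l)%N) (h i (tnth (data Z w) j) - a)] = A i.
    apply/seteqP; split => w; rewrite /A/= sumrB sum_ord_lt//; first by move=> [_]; rewrite lerBrDl.
    by rewrite lerBrDl.
  apply => //.
  - by move=> j; exact: (measurableT_comp (mh i) (measurable_tnth j)).
  - move=> j W k z jk; rewrite tnth_upd; case: eqP => // e.
    by move: jk; rewrite e ltnn.
  - by move=> j W _; under eq_integral do rewrite tnth_upd eqxx; exact: hh.
have [_ up] := union_bound_seq (P := P) (s := s) (A := A) (fun i _ => mA i) pA.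
have -> : data Z @^-1` (~` G) = [set w | exists2 i, i \in s & A i w].
  apply/seteqP; split => w /=.
    move=> /existsNP[i /not_implyP[si /negP]]; rewrite -leNgt => hi; by exists i.
  by move=> [i si Ai] /(_ i si); rewrite ltNge Ai.
apply: le_trans up _; rewrite lee_fin.
apply: (@le_trans _ _ (expR (K * D) * expR (- tau))).
  by rewrite ler_wpM2r// expR_ge0.
by rewrite -expRD ler_expR; lra.
Qed.

End chernoff_net.

Section step1_events.
Context {R : realType} {d1 : measure_display} {T : measurableType d1}
  (P : probability T R) {n d : nat}.
Variables (theta : 'cV[R]_d) (x : 'I_n -> T -> 'cV[R]_d) (y : 'I_n -> T -> bool).
Hypothesis sample : logistic_sample P theta x y.
Hypothesis th1 : 1 <= l2norm theta.

Definition obs (i : 'I_n) (w : T) : 'cV[R]_d * bool := (x i w, y i w).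

Definition rz (v : 'cV[R]_d) (r : R) (p : 'cV[R]_d * bool) : R :=
  (p.2)%:R - sigmoid (r * dot p.1 v).

Lemma measurable_obs i : measurable_fun setT (obs i).
Proof. by case: sample => mx my _ _ _; apply/measurable_fun_pairP; split; [exact: mx|exact: my]. Qed.

Lemma obs_indep : mutually_independent P obs.
Proof. by case: sample. Qed.

Lemma measurable_rz v r : measurable_fun setT (rz v r).
Proof.
apply: measurable_funB.
  by apply: (measurableT_comp (f := fun b : bool => b%:R : R)).
apply: measurableT_comp; first exact: measurable_sigmoid.
by apply: measurable_funM => //; exact: measurable_dot.
Qed.

Let R0 := l2norm theta.
Let R0_gt0 : 0 < R0. Proof. exact: lt_le_trans th1. Qed.
Let u := R0^-1 *: theta.

Let th0 : theta != 0.
Proof. by rewrite -l2norm_gt0. Qed.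

Let u1 : dot u u = 1. Proof. exact: l2norm_unit. Qed.

Lemma dim_gt0 : (0 < d)%N.
Proof.
rewrite lt0n; apply/eqP => d0; move: R0_gt0; rewrite /R0 /l2norm /dot.
rewrite big1 ?sqrtr0 ?ltxx// => i; by have := ltn_ord i; rewrite {2}d0.
Qed.

Lemma netK_gt0 N : 0 < netK N :> R.
Proof. by rewrite /netK mulr_gt0// exprn_gt0. Qed.

Lemma net_exp N : netK N ^+ d = expR (ln (netK N) * d%:R) :> R.
Proof. by rewrite mulrC expRM_natl lnK// posrE netK_gt0. Qed.

Lemma dot_stretchC (a b : 'cV[R]_d) : dot a (stretch u R0 b) = dot (stretch u R0 a) b.
Proof. by rewrite /stretch dotDl dotDr dotZl dotZr (dotC a u); ring. Qed.

Lemma bernC_ge0 : 0 <= bernC :> R.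
Proof. rewrite /bernC; lra. Qed.

Lemma score_event (m : nat) (lam t : R) : (m <= n)%N -> 0 < lam -> lam <= 16^-1 ->
  ln (netK 2) * d%:R + t <= lam ^+ 2 * (m%:R / R0) ->
  exists G : set (n.-tuple ('cV[R]_d * bool)%type),
  [/\ measurable G, indep_of_ge m G, (P (data obs @^-1` (~` G)) <= (expR (- t))%:E)%E &
   forall W, G W -> l2norm (stretch u R0 (\sum_(j < n | (j < m)%N) rz u R0 (tnth W j) *: (tnth W j).1))
     <= 2 * ((bernC + 1) * lam * (m%:R / R0))].
Proof.
move=> mn lam0 lam1 ht.
have [s [sK s1 net]] := @ball_net R d 2 dim_gt0 isT.
rewrite net_exp in sK.
pose h D (p : 'cV[R]_d * bool) := lam * (rz u R0 p * dot p.1 (stretch u R0 D)).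
have mh D : measurable_fun setT (h D).
  apply: measurable_funM => //; apply: measurable_funM; first exact: measurable_rz.
  exact: measurable_dot.
have [mx my _ gx ly] := sample.
have hh D (j : 'I_n) : D \in s -> (\int[P]_w (expR (h D (obs j w)))%:E <= (expR (bernC * lam ^+ 2 / R0))%:E)%E.
  move=> /s1 D1.
  have uT : dot u theta = R0.
    by rewrite /u dotZl -l2norm_sqr -/R0 expr2 mulKf// gt_eqF.
  have uS : dot u (stretch u R0 D) = R0 * dot u D.
    by rewrite /stretch dotDr dotZr u1; ring.
  have := @bernstein R _ T P d theta (x j) (y j) (mx j) (my j) (gx j) (ly j) u R0 R0 R0_gt0 u1.
  have hR : R0 / 2 <= R0 by have := R0_gt0; lra.
  rewrite uT => /(_ hR hR).
  have -> : perp u theta = 0.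
    rewrite /perp uT /u scalerA mulfV ?scale1r ?subrr// gt_eqF//.
  rewrite l2norm0 => /(_ ler01 (stretch u R0 D) lam).
  rewrite uS normrM (ger0_norm (ltW R0_gt0)).
  have c1 : `|dot u D| <= 1.
    by apply: le_trans (cauchy_schwarz u D) _; rewrite {1}/l2norm u1 sqrtr1 mul1r.
  have -> : perp u (stretch u R0 D) = perp u D.
    rewrite /perp uS /stretch; apply/matrixP => i k; rewrite !mxE; ring.
  have -> : mean_resid theta u R0 (stretch u R0 D) = 0.
    by rewrite /mean_resid -/R0 -/u subrr.
  rewrite mulr0 add0r; apply.
  - by rewrite ler_piMr// ltW.
  - exact: le_trans (l2norm_perp D u1) D1.
  - by rewrite ger0_norm// ltW.
have [mG iG pG] := chernoff_net measurable_obs obs_indep mn mh hh sK ht.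
eexists; split; [exact: mG|exact: iG|exact: pG|].
move=> W GW; set S := \sum_(j < n | _) _.
apply: (@net_l2norm R d s) => //.
  apply: mulr_ge0; last by rewrite divr_ge0// ltW.
  apply: mulr_ge0; last exact: ltW.
  by have := bernC_ge0; lra.
move=> D Ds; rewrite -dot_stretchC /S dot_suml.
have := GW D Ds; rewrite /h -mulr_sumr => hD.
rewrite -(ler_pM2l lam0); under eq_bigr do rewrite dotZl.
apply: le_trans (ltW hD) _; rewrite le_eqVlt; apply/orP; left; apply/eqP.
by field; rewrite gt_eqF.
Qed.

(** R0 times the exponent in [small_ball] at s = c0 / 2. *)
Definition smallc (c0 : R) : R := (1 - expR (- ((c0 / 2) ^+ 2 / 4))) * pdf1 ^+ 2 / 4.

Lemma measurable_near0_nat : measurable_fun setT (fun p : 'cV[R]_d * bool => (near0 u R0 p.1)%:R : R).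
Proof.
rewrite (_ : (fun p => _) = (\1_[set z | near0 u R0 z] : _ -> R) \o fst).
  apply: measurableT_comp => //; apply: measurable_indic; exact: measurable_near0.
by apply/funext => p/=; rewrite indicE; congr (_%:R : R); congr nat_of_bool; apply/idP/idP; rewrite inE.
Qed.

Lemma curvature_event (m N : nat) (c0 t : R) : (m <= n)%N -> (1 < N)%N -> 0 < c0 -> c0 <= 1 ->
  ln (netK N) * d%:R + t <= smallc c0 / 2 * (m%:R / R0) ->
  exists G : set (n.-tuple ('cV[R]_d * bool)%type),
  [/\ measurable G, indep_of_ge m G, (P (data obs @^-1` (~` G)) <= (expR (- t))%:E)%E &
   forall W, G W -> forall D, l2norm D = c0 -> exists2 D', l2norm (D - D') <= c0 / N%:R &
     smallc c0 / 2 * (m%:R / R0) <= \sum_(j < n | (j < m)%N) (near0 u R0 (tnth W j).1)%:R *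
        Num.min 1 (dot (tnth W j).1 (stretch u R0 D') ^+ 2)].
Proof.
move=> mn N1 c00 c01 ht.
have [s [sK s1 net]] := @ball_net R d N dim_gt0 (ltnW N1).
rewrite net_exp in sK.
(* Unit vectors are approximated by these points alone, and the lower bound on their norm is what
   [small_ball] needs after scaling by c0. *)
pose s' := [seq D <- s | 2^-1 <= l2norm D].
have s'K : (size s')%:R <= expR (ln (netK N) * d%:R) :> R.
  by apply: le_trans sK; rewrite ler_nat size_filter count_size.
pose h D (p : 'cV[R]_d * bool) := - ((near0 u R0 p.1)%:R * Num.min 1 (dot p.1 (stretch u R0 (c0 *: D)) ^+ 2)).
have mh D : measurable_fun setT (h D).
  apply: measurableT_comp => //; apply: measurable_funM; first exact: measurable_near0_nat.
  apply: measurable_minr => //; apply: measurable_funX; exact: measurable_dot.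
have [mx my _ gx ly] := sample.
have hh D (j : 'I_n) : D \in s' -> (\int[P]_w (expR (h D (obs j w)))%:E <= (expR (- (smallc c0 / R0)))%:E)%E.
  rewrite mem_filter => /andP[D2 _].
  apply: (small_ball (mx j) (gx j) u1 th1 (s := c0 / 2)).
  - by rewrite divr_gt0.
  - lra.
  - by rewrite l2normZ (ger0_norm (ltW c00)) ler_wpM2l// ltW.
have [mG iG pG] := chernoff_net measurable_obs obs_indep mn mh hh s'K ht.
eexists; split; [exact: mG|exact: iG|exact: pG|].
move=> W GW D Dc.
have c0D : l2norm (c0^-1 *: D) = 1.
  by rewrite l2normZ Dc ger0_norm ?invr_ge0 ?(ltW c00)// mulVf// gt_eqF.
have [|D1 D1s hD] := net (c0^-1 *: D); first by rewrite c0D.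
have Ni : (N%:R : R)^-1 <= 2^-1 by rewrite lef_pV2 ?posrE ?ltr0n ?(ltnW N1)// ler_nat.
have D1s' : D1 \in s'.
  rewrite mem_filter D1s andbT.
  have := l2normD (c0^-1 *: D - D1) D1; rewrite subrK c0D; lra.
exists (c0 *: D1).
  have -> : D - c0 *: D1 = c0 *: (c0^-1 *: D - D1).
    by rewrite scalerBr scalerA mulfV ?scale1r// gt_eqF.
  by rewrite l2normZ (ger0_norm (ltW c00)) ler_wpM2l// ltW.
have := GW D1 D1s'; rewrite /h sumrN => hW.
have e : m%:R * - (smallc c0 / R0) = - (smallc c0 * (m%:R / R0)) by field; rewrite gt_eqF.
move: hW; rewrite e; lra.
Qed.

(** Controls, uniformly and linearly in |D|, the change of the truncated curvature when a point of
    the sphere is replaced by its neighbour in the net. *)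
Lemma near0_event (m : nat) (t : R) : (m <= n)%N ->
  ln (netK 2) * d%:R + t <= m%:R / R0 ->
  exists G : set (n.-tuple ('cV[R]_d * bool)%type),
  [/\ measurable G, indep_of_ge m G, (P (data obs @^-1` (~` G)) <= (expR (- t))%:E)%E &
   forall W, G W -> forall D, \sum_(j < n | (j < m)%N) (near0 u R0 (tnth W j).1)%:R *
        `|dot (tnth W j).1 (stretch u R0 D)| <= 2050 * (m%:R / R0) * l2norm D].
Proof.
move=> mn ht.
have [s [sK s1 net]] := @ball_net R d 2 dim_gt0 isT.
rewrite net_exp in sK.
pose h D (p : 'cV[R]_d * bool) := (near0 u R0 p.1)%:R * `|dot p.1 (stretch u R0 D)|.
have mh D : measurable_fun setT (h D).
  apply: measurable_funM; first exact: measurable_near0_nat.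
  apply: measurableT_comp => //; exact: measurable_dot.
have [mx my _ gx ly] := sample.
have hh D (j : 'I_n) : D \in s -> (\int[P]_w (expR (h D (obs j w)))%:E <= (expR (1024 / R0))%:E)%E.
  by move=> /s1 D1; apply: (near0_mgf (mx j) (gx j) u1 th1 D1).
have [mG iG pG] := chernoff_net measurable_obs obs_indep mn mh hh sK ht.
eexists; split; [exact: mG|exact: iG|exact: pG|].
move=> W GW D.
pose p D := \sum_(j < n | (j < m)%N) h D (tnth W j).
have -> : 2050 * (m%:R / R0) * l2norm D = 2 * (1025 * (m%:R / R0)) * l2norm D.
  by congr (_ * _); generalize (m%:R / R0) => L; lra.
apply: (@net_seminorm R d s p _ (\sum_(j < n | (j < m)%N) l2norm (stretch u R0 (tnth W j).1)) net).
- move=> D1 D2; rewrite /p -big_split/=; apply: ler_sum => j _; rewrite /h -mulrDr ler_wpM2l//.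
  by rewrite !dot_stretchC dotDr ler_normD.
- move=> c D1; rewrite /p mulr_sumr; apply: eq_bigr => j _.
  by rewrite /h !dot_stretchC dotZr normrM mulrCA.
- move=> D1 hD1; rewrite /p; apply: ler_sum => j _; rewrite /h dot_stretchC.
  apply: (@le_trans _ _ (1 * (l2norm (stretch u R0 (tnth W j).1) * 1))).
    apply: ler_pM => //; first by rewrite lern1; case: near0.
    by apply: le_trans (cauchy_schwarz _ _) _; rewrite ler_wpM2l// l2norm_ge0.
  by rewrite mul1r mulr1.
- move=> D1 D1s; have := GW D1 D1s; rewrite -/(p D1).
  by rewrite [1024 / R0]mulrC mulrA => /ltW hp; apply: le_trans hp _; lra.
Qed.

End step1_events.

(** * Minimisers of the logistic loss *)

Section euclidean_compactness.
Context {R : realType} {d : nat}.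

Lemma l2norm_le_sum (z : 'cV[R]_d) : l2norm z <= \sum_j `|z j 0|.
Proof.
rewrite -ler_sqr ?nnegrE ?l2norm_ge0 ?sumr_ge0// l2norm_sqr expr2 mulr_suml /dot.
apply: ler_sum => j _; rewrite -expr2 -real_normK ?num_real// expr2 ler_wpM2l//.
by rewrite (bigD1 j)//= lerDl sumr_ge0.
Qed.

Lemma lipschitz_continuous (g : 'cV[R]_d -> R) (M : R) :
  (forall D E, g D <= g E + M * l2norm (D - E)) ->
  continuous (fun D : 'rV[R]_d => g D^T).
Proof.
move=> lip D; have FD : Filter (nbhs D) by exact: nbhs_filter.
apply/(@cvgrPdist_le _ _ _ (nbhs D) FD (fun D : 'rV[R]_d => g D^T)) => e e0.
pose K := `|M| * d%:R + 1.
have K0 : 0 < K by rewrite ltr_wpDl// mulr_ge0.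
apply/nbhs_ballP; exists (e / K) => /=; first by rewrite divr_gt0.
move=> E hE.
have h : l2norm (D^T - E^T) <= d%:R * (e / K).
  apply: le_trans (l2norm_le_sum _) _.
  have -> : d%:R * (e / K) = \sum_(j < d) (e / K) by rewrite sumr_const card_ord mulr_natl.
  apply: ler_sum => j _; rewrite !mxE; apply: ltW; exact: (hE.2 0 j).
have h2 : `|M| * l2norm (D^T - E^T) <= e.
  apply: (@le_trans _ _ (`|M| * (d%:R * (e / K)))); first by rewrite ler_wpM2l.
  have -> : `|M| * (d%:R * (e / K)) = e * ((`|M| * d%:R) / K) by ring.
  rewrite ler_piMr ?(ltW e0)// ler_pdivrMr// mul1r /K lerDl//.
have h3 z : M * z <= `|M| * `|z| by rewrite -normrM ler_norm.
have h4 := lip D^T E^T; have h5 := lip E^T D^T.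
have nn : l2norm (E^T - D^T) = l2norm (D^T - E^T) by rewrite -l2normN opprB.
have := h3 (l2norm (D^T - E^T)); rewrite nn in h5; rewrite (ger0_norm (l2norm_ge0 _)) => h6.
by rewrite ler_norml; apply/andP; split; lra.
Qed.

(** Used on a ball (a = 0) for the existence of the minimiser and on a sphere (a = b) for the gap
    around it. *)
Lemma EVT_shell (g : 'cV[R]_d -> R) (M a b : R) :
  (forall D E, g D <= g E + M * l2norm (D - E)) ->
  (exists D : 'cV[R]_d, a <= l2norm D <= b) ->
  exists2 D, a <= l2norm D <= b & forall E, a <= l2norm E <= b -> g D <= g E.
Proof.
move=> lip [D0 hD0].
pose A := [set D : 'rV[R]_d | a <= l2norm D^T <= b].
have cn : continuous (fun D : 'rV[R]_d => l2norm D^T).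
  apply: (@lipschitz_continuous (@l2norm R d) 1) => D E.
  by have := l2normD (D - E) E; rewrite subrK mul1r addrC.
have cA : closed A.
  rewrite (_ : A = (fun D : 'rV[R]_d => l2norm D^T) @^-1` `[a, b]).
    by apply: closed_comp => [D _|]; [exact: cn|exact: interval_closed].
  by apply/seteqP; split => D /=; rewrite in_itv.
have kA : compact A.
  have kB : compact [set v : 'rV[R]_d | forall i, v ord0 i \in `[(- b), b]].
    apply: (@rV_compact _ _ (fun=> `[(- b), b]%classic)) => _; exact: segment_compact.
  apply: subclosed_compact cA kB _ => v /andP[_ vb] i.
  rewrite in_itv/= -ler_norml; apply: le_trans vb.
  by have := l2norm_coord v^T i; rewrite mxE.
have neA : A !=set0 by exists D0^T; rewrite /A/= trmxK.
have [c cA' hc] := compact_EVT_min neA kA (continuous_subspaceT (lipschitz_continuous lip)).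
exists c^T; first by move: cA'; rewrite inE.
by move=> E hE; have := hc E^T; rewrite trmxK; apply; rewrite inE /A/= trmxK.
Qed.

(** Approximation from above: a lower bound on a coordinate of z remains one for the rational point,
    as [argmin_coord_lt] requires. *)
Lemma rat_vec_above (z : 'cV[R]_d) (e : R) : 0 < e ->
  exists w : 'cV[rat]_d, forall j, z j 0 < ratr (w j 0) < z j 0 + e.
Proof.
move=> e0.
have h j : exists w : rat, z j 0 < ratr w < z j 0 + e.
  have [|w] := @rat_in_itvoo R (z j 0) (z j 0 + e); first by rewrite ltrDl.
  by rewrite in_itv/=; exists w.
pose w : 'cV[rat]_d := \col_j sval (cid (h j)).
by exists w => j; rewrite mxE; case: cid.
Qed.

End euclidean_compactness.

Section logistic_objective.
Context {R : realType} {n d : nat}.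
Variables (X : 'I_n -> 'cV[R]_d) (Y : 'I_n -> bool) (m : nat).

Definition tot_loss (th : 'cV[R]_d) : R :=
  \sum_(i < n | (i < m)%N) logistic_loss (dot (X i) th) (Y i).

Definition score (th : 'cV[R]_d) : 'cV[R]_d :=
  \sum_(i < n | (i < m)%N) (sigmoid (dot (X i) th) - (Y i)%:R) *: X i.

Definition tot_bregman (th E : 'cV[R]_d) : R :=
  \sum_(i < n | (i < m)%N) bregman (dot (X i) th) (dot (X i) E).

Lemma tot_bregman_ge0 th E : 0 <= tot_bregman th E.
Proof. by apply: sumr_ge0 => i _; exact: bregman_ge0. Qed.

Lemma tot_lossD th E : tot_loss (th + E) = tot_loss th + dot (score th) E + tot_bregman th E.
Proof.
rewrite /tot_loss /score /tot_bregman dot_suml -!big_split/=; apply: eq_bigr => i _.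
by rewrite dotDr logistic_lossD dotZl.
Qed.

Lemma tot_loss_lipschitz D E :
  tot_loss D <= tot_loss E + (\sum_(i < n | (i < m)%N) l2norm (X i)) * l2norm (D - E).
Proof.
have e : tot_loss E = tot_loss D + dot (score D) (E - D) + tot_bregman D (E - D).
  by rewrite -tot_lossD addrC subrK.
have b0 := tot_bregman_ge0 D (E - D).
have : dot (score D) (D - E) <= (\sum_(i < n | (i < m)%N) l2norm (X i)) * l2norm (D - E).
  rewrite /score dot_suml mulr_suml; apply: ler_sum => i _.
  rewrite dotZl; apply: le_trans (ler_norm _) _; rewrite normrM -[leRHS]mul1r.
  apply: ler_pM => //; last exact: cauchy_schwarz.
  have s0 := sigmoid_ge0 (dot (X i) D); have s1 := sigmoid_le1 (dot (X i) D).
  by rewrite ler_norml; case: (Y i) => /=; lra.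
have -> : dot (score D) (D - E) = - dot (score D) (E - D) by rewrite -dotNr opprB.
lra.
Qed.

(** Convexity along a ray: add the tangent inequality at a + b towards a + s b and (s - 1) times the
    one towards a. *)
Lemma bregman_scale (a b s : R) : 1 <= s -> s * bregman a b <= bregman a (s * b).
Proof.
move=> s1.
have h1 := bregman_ge0 (a + b) ((s - 1) * b).
have h2 := bregman_ge0 (a + b) (- b).
have e : a + b + (s - 1) * b = a + s * b by ring.
move: h1 h2; rewrite /bregman e addrK => h1 h2.
have := mulr_ge0 (_ : 0 <= s - 1) h2; rewrite subr_ge0 => /(_ s1).
lra.
Qed.

Lemma tot_loss_ray th E s : 1 <= s ->
  s * (tot_loss (th + E) - tot_loss th) <= tot_loss (th + s *: E) - tot_loss th.
Proof.
move=> s1; rewrite !tot_lossD dotZr.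
have : s * tot_bregman th E <= tot_bregman th (s *: E).
  by rewrite /tot_bregman mulr_sumr; apply: ler_sum => i _; rewrite dotZr bregman_scale.
lra.
Qed.

Definition spanning := forall E : 'cV[R]_d, E != 0 -> exists2 i : 'I_n, (i < m)%N & dot (X i) E != 0.

Hypothesis span : spanning.

Lemma tot_bregman_gt0 th E : E != 0 -> 0 < tot_bregman th E.
Proof.
move=> /span [i im xi]; rewrite /tot_bregman (bigD1 i)//= ltr_pwDl//.
  exact: bregman_gt0.
by apply: sumr_ge0 => j _; exact: bregman_ge0.
Qed.

Variable th : 'cV[R]_d.
Hypothesis th_min : forall z, tot_loss th <= tot_loss z.

(** Expand both losses at the midpoint: the first-order terms are opposite and one remainder is
    positive by [spanning]. *)
Lemma argmin_strict E : E != 0 -> tot_loss th < tot_loss (th + E).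
Proof.
move=> E0; pose H := 2^-1 *: E; pose M := th + H.
have H0 : H != 0 by rewrite scaler_eq0 invr_eq0 negb_or E0 andbT lt0r_neq0.
have e1 : tot_loss th = tot_loss M - dot (score M) H + tot_bregman M (- H).
  by rewrite -dotNr -tot_lossD /M addrK.
have e2 : tot_loss (th + E) = tot_loss M + dot (score M) H + tot_bregman M H.
  rewrite -tot_lossD /M -addrA; congr (tot_loss (_ + _)).
  by rewrite /H -scalerDl (_ : 2^-1 + 2^-1 = 1 :> R) ?scale1r//; lra.
have p1 := tot_bregman_gt0 M H0.
have p2 := tot_bregman_ge0 M (- H).
have := th_min M; lra.
Qed.

(** The minimum over the sphere of radius e exceeds the global one by [argmin_strict], and convexity
    along rays extends the gap outwards. *)
Lemma argmin_gap e : (0 < d)%N -> 0 < e ->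
  exists2 mu, 0 < mu & forall z, e <= l2norm (z - th) -> tot_loss th + mu <= tot_loss z.
Proof.
move=> d0 e0.
pose g E := tot_loss (th + E).
have lip D E : g D <= g E + (\sum_(i < n | (i < m)%N) l2norm (X i)) * l2norm (D - E).
  by have := tot_loss_lipschitz (th + D) (th + E); rewrite opprD addrACA subrr add0r.
pose z1 : 'cV[R]_d := const_mx 1.
have z10 : z1 != 0.
  by apply/eqP => /matrixP/(_ (Ordinal d0) 0); rewrite !mxE; apply/eqP; rewrite oner_eq0.
have [|D hD Dmin] := @EVT_shell R d g _ e e lip.
  exists (e *: ((l2norm z1)^-1 *: z1)).
  by rewrite l2normZ /l2norm l2norm_unit// sqrtr1 mulr1 ger0_norm ?lexx// ltW.
have D0 : D != 0 by rewrite -l2norm_gt0; apply: lt_le_trans e0 _; case/andP: hD.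
exists (g D - tot_loss th); first by rewrite subr_gt0; exact: argmin_strict.
move=> z hz; set E := z - th in hz.
have E0 : 0 < l2norm E by exact: lt_le_trans hz.
pose s := l2norm E / e.
have s1 : 1 <= s by rewrite ler_pdivlMr// mul1r.
have s0 : 0 < s by exact: lt_le_trans s1.
have := tot_loss_ray th (s^-1 *: E) s1; rewrite scalerA mulfV ?gt_eqF// scale1r.
have -> : th + E = z by rewrite /E addrC subrK.
have hE : g D <= g (s^-1 *: E).
  apply: Dmin; rewrite l2normZ ger0_norm ?invr_ge0 ?(ltW s0)// /s invfM invrK mulrAC mulVf ?gt_eqF//.
  by rewrite mul1r lexx.
have p0 : 0 <= tot_loss (th + s^-1 *: E) - tot_loss th by rewrite subr_ge0.
have := ler_peMl p0 s1; move: hE; rewrite /g; lra.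
Qed.

(* A description of the minimiser by countably many comparisons of losses at
   rational points: it makes the first estimate a measurable function of the
   sample. *)
Lemma argmin_coord_lt (j : 'I_d) (a : R) : th j 0 < a <->
  exists (w : 'cV[rat]_d) (k : nat), ratr (w j 0) < a /\
    forall w' : 'cV[rat]_d, a <= ratr (w' j 0) ->
      tot_loss (map_mx ratr w) + k.+1%:R^-1 <= tot_loss (map_mx ratr w').
Proof.
have d0 : (0 < d)%N by apply: leq_ltn_trans (ltn_ord j).
pose M := (\sum_(i < n | (i < m)%N) l2norm (X i)).
have M0 : 0 <= M by apply: sumr_ge0 => i _; exact: l2norm_ge0.
have K0 : 0 < M * d%:R + 1 by rewrite ltr_wpDl// mulr_ge0.
have approx e mu : 0 < e -> 0 < mu -> exists2 w : 'cV[rat]_d,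
    th j 0 < ratr (w j 0) < th j 0 + e & tot_loss (map_mx ratr w) <= tot_loss th + mu.
  move=> e0 mu0; pose dl := Num.min e (mu / (M * d%:R + 1)).
  have dl0 : 0 < dl by rewrite lt_min e0 divr_gt0.
  have [w hw] := rat_vec_above th dl0.
  exists w.
    have /andP[-> h] := hw j; apply: lt_le_trans h _; rewrite lerD2l ge_min lexx//.
  apply: le_trans (tot_loss_lipschitz _ th) _; rewrite lerD2l -/M.
  have h : l2norm (map_mx ratr w - th) <= d%:R * dl.
    apply: le_trans (l2norm_le_sum _) _.
    have -> : d%:R * dl = \sum_(j < d) dl by rewrite sumr_const card_ord mulr_natl.
    by apply: ler_sum => i _; rewrite !mxE; have /andP[h1 h2] := hw i; rewrite ger0_norm; lra.
  apply: (@le_trans _ _ (M * d%:R * dl)); first by rewrite -mulrA ler_wpM2l.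
  apply: (@le_trans _ _ (M * d%:R * (mu / (M * d%:R + 1)))).
    by rewrite ler_wpM2l ?mulr_ge0// /dl ge_min lexx orbT.
  rewrite mulrCA ler_piMr ?(ltW mu0)// ler_pdivrMr// mul1r lerDl//.
split=> [tha|[w [k [wa hw]]]].
  (* A point whose coordinate j is at least a is at distance at least a - th_j from the minimiser,
     so its loss exceeds the minimum by mu. *)
  have [||mu mu0 gap] := @argmin_gap (a - th j 0) _ _ => //; first by rewrite subr_gt0.
  have [||w hw lw] := approx (a - th j 0) (mu / 2); rewrite ?subr_gt0 ?divr_gt0//.
  have [k hk] : exists k : nat, k.+1%:R^-1 <= mu / 2.
    have h0 : 0 < (mu / 2)^-1 by rewrite invr_gt0 divr_gt0.
    exists (Num.truncn (mu / 2)^-1); rewrite invf_ple ?posrE ?divr_gt0 ?ltr0n//.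
    by have /andP[_ /ltW] := truncn_itv (ltW h0).
  exists w, k; split; first by case/andP: hw => _; rewrite addrC subrK.
  move=> w' aw'; have gw : tot_loss th + mu <= tot_loss (map_mx ratr w').
    2: by apply: le_trans (lerD lw hk) _; apply: le_trans gw; lra.
  apply: gap; apply: le_trans (l2norm_coord _ j); apply: le_trans (ler_norm _); rewrite !mxE; lra.
(* Otherwise a rational point just above the minimiser has coordinate j at least a and an almost
   minimal loss, against the comparison. *)
have [//|ath] := ltP (th j 0) a.
have [||w' /andP[hw' _] lw'] := approx 1 (k.+1%:R^-1 / 2) => //.
have := hw w' (le_trans ath (ltW hw')).
have : 0 < k.+1%:R^-1 :> R by rewrite invr_gt0 ltr0n.
suff h (z : R) : tot_loss (map_mx ratr w') <= tot_loss th + z / 2 -> 0 < z ->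
    tot_loss (map_mx ratr w) + z <= tot_loss (map_mx ratr w') -> tot_loss th < tot_loss th.
  by move=> z0 /(h _ lw' z0); rewrite ltxx.
by have := th_min (map_mx ratr w); lra.
Qed.

End logistic_objective.

(** * Step 1: localization of the minimiser *)

(** Truncating the square at 1 caps its slope at 2. *)
Lemma min_sqr_lip {R : realType} (a b : R) :
  Num.min 1 (a ^+ 2) <= Num.min 1 (b ^+ 2) + 2 * `|a - b|.
Proof.
have ab : `|a| <= `|b| + `|a - b| by have := ler_normD (a - b) b; rewrite subrK addrC.
have n0 := normr_ge0 (a - b); have b0 := normr_ge0 b; have a0 := normr_ge0 a.
rewrite -(real_normK (num_real a)) -(real_normK (num_real b)).
suff key (x y z : R) : 0 <= x -> 0 <= y -> 0 <= z -> y <= x + z ->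
    Num.min 1 (y ^+ 2) <= Num.min 1 (x ^+ 2) + 2 * z by exact: key.
move=> {ab n0 b0 a0} x0 y0 z0 yxz.
have [b1|b1] := leP 1 (x ^+ 2); first by rewrite ge_min; apply/orP; left; lra.
have x1 : x < 1 by rewrite -(@expr_lt1 _ 2).
have [y1|y1] := leP y 1.
  rewrite ge_min; apply/orP; right.
  have := mulr_ge0 (_ : 0 <= 1 - y) z0; have := mulr_ge0 (_ : 0 <= 1 - x) z0.
  rewrite !subr_ge0 => /(_ (ltW x1)) h1 /(_ y1) h2.
  have [yx|xy] := leP y x.
    have : y ^+ 2 <= x ^+ 2 by rewrite lerXn2r ?nnegrE.
    lra.
  have h3 : (y - x) * (y + x) <= z * 2 by apply: ler_pM; lra.
  have e : y ^+ 2 = x ^+ 2 + (y - x) * (y + x) by ring.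
  by rewrite e; lra.
rewrite ge_min; apply/orP; left.
have : (1 - x) * (1 + x) <= z * 2 by apply: ler_pM; lra.
have e : x ^+ 2 = 1 - (1 - x) * (1 + x) by ring.
by rewrite e; lra.
Qed.

Section localization.
Context {R : realType} {n d : nat}.
Variables (X : 'I_n -> 'cV[R]_d) (Y : 'I_n -> bool) (m : nat) (theta : 'cV[R]_d).
Hypothesis th1 : 1 <= l2norm theta.
Let R0 := l2norm theta.
Let u := R0^-1 *: theta.
Let R0_gt0 : 0 < R0. Proof. exact: lt_le_trans th1. Qed.
Let u1 : dot u u = 1. Proof. by apply: l2norm_unit; rewrite -l2norm_gt0. Qed.

Lemma stretchK (E : 'cV[R]_d) : stretch u R0 (stretch u R0^-1 E) = E.
Proof.
rewrite /stretch dotDr dotZr u1; apply/matrixP => i j; rewrite !mxE.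
by field; rewrite gt_eqF.
Qed.

Lemma stretchZ (k c : R) (E : 'cV[R]_d) : stretch u k (c *: E) = c *: stretch u k E.
Proof. by rewrite /stretch dotZr; apply/matrixP => i j; rewrite !mxE; ring. Qed.

Lemma stretch0 (k : R) : stretch u k 0 = 0.
Proof. by rewrite /stretch dot0r mulr0 scale0r addr0. Qed.

(** Since [stretch] is self-adjoint, it can be moved onto the score, and Cauchy-Schwarz bounds the
    linear term. The remainder is bounded below by [bregman_lb] on the observations in [near0], the
    other ones being nonnegative. *)
Lemma loss_increase (A B c0 : R) (D : 'cV[R]_d) : l2norm D = c0 ->
  l2norm (stretch u R0 (\sum_(j < n | (j < m)%N) rz u R0 (X j, Y j) *: X j)) <= A ->
  B <= \sum_(j < n | (j < m)%N) (near0 u R0 (X j))%:R * Num.min 1 (dot (X j) (stretch u R0 D) ^+ 2) ->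
  tot_loss X Y m theta + (B / 5000 - A * c0) <= tot_loss X Y m (theta + stretch u R0 D).
Proof.
move=> Dc hA hB; rewrite tot_lossD -addrA lerD2l.
have xu z : R0 * dot z u = dot z theta by rewrite /u dotZr mulrA mulfV ?mul1r// gt_eqF.
have e : score X Y m theta = - (\sum_(j < n | (j < m)%N) rz u R0 (X j, Y j) *: X j).
  by rewrite /score -sumrN; apply: eq_bigr => j _; rewrite /rz/= xu -scaleNr opprB.
have h1 : - (A * c0) <= dot (score X Y m theta) (stretch u R0 D).
  rewrite e dotNl lerN2; apply: (@le_trans _ _ (A * l2norm D)); last by rewrite Dc.
  rewrite (dot_stretchC theta); apply: le_trans (dot_le _ _) _.
  by rewrite ler_wpM2r// l2norm_ge0.
suff h2 : B / 5000 <= tot_bregman X m theta (stretch u R0 D) by lra.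
apply: (@le_trans _ _ ((\sum_(j < n | (j < m)%N) (near0 u R0 (X j))%:R * Num.min 1 (dot (X j) (stretch u R0 D) ^+ 2)) / 5000)).
  by apply: ler_wpM2r; [rewrite invr_ge0; lra|exact: hB].
rewrite mulr_suml; apply: ler_sum => j _.
case: (boolP (near0 u R0 (X j))) => [nr|_]; last by rewrite !mul0r bregman_ge0.
by rewrite mul1r bregman_lb// -xu.
Qed.

Lemma curvature_transfer (B e : R) (D D' : 'cV[R]_d) :
  B <= \sum_(j < n | (j < m)%N) (near0 u R0 (X j))%:R * Num.min 1 (dot (X j) (stretch u R0 D') ^+ 2) ->
  \sum_(j < n | (j < m)%N) (near0 u R0 (X j))%:R * `|dot (X j) (stretch u R0 (D - D'))| <= e ->
  B - 2 * e <= \sum_(j < n | (j < m)%N) (near0 u R0 (X j))%:R * Num.min 1 (dot (X j) (stretch u R0 D) ^+ 2).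
Proof.
move=> hB he; rewrite lerBlDr.
apply: le_trans hB _; apply: le_trans _ (lerD (lexx _) (ler_wpM2l _ he)) => //.
rewrite mulr_sumr -big_split/=; apply: ler_sum => j _.
rewrite mulrCA -mulrDr ler_wpM2l//; apply: le_trans (min_sqr_lip _ (dot (X j) (stretch u R0 D))) _.
rewrite lerD2l ler_wpM2l// distrC !(dot_stretchC theta) -dotBr.
by [].
Qed.

Variable c0 : R.
Hypothesis c0_gt0 : 0 < c0.
Hypothesis up : forall D, l2norm D = c0 ->
  tot_loss X Y m theta < tot_loss X Y m (theta + stretch u R0 D).

Lemma loss_far (D : 'cV[R]_d) : c0 <= l2norm D ->
  tot_loss X Y m theta < tot_loss X Y m (theta + stretch u R0 D).
Proof.
move=> cD; have D0 : 0 < l2norm D by exact: lt_le_trans cD.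
pose s := l2norm D / c0.
have s1 : 1 <= s by rewrite ler_pdivlMr// mul1r.
have s0 : 0 < s by exact: lt_le_trans s1.
have hD : l2norm (s^-1 *: D) = c0.
  by rewrite l2normZ ger0_norm ?invr_ge0 ?(ltW s0)// /s invfM invrK mulrAC mulVf ?mul1r// gt_eqF.
have := up hD; have := tot_loss_ray X Y m theta (stretch u R0 (s^-1 *: D)) s1.
rewrite stretchZ scalerA mulfV ?gt_eqF// scale1r -subr_gt0 => h1 h2.
by rewrite -subr_gt0; apply: lt_le_trans h1; exact: mulr_gt0.
Qed.

Lemma argmin_exists : exists th, forall z, tot_loss X Y m th <= tot_loss X Y m z.
Proof.
pose g D := tot_loss X Y m (theta + stretch u R0 D).
have lip D E : g D <= g E + ((\sum_(i < n | (i < m)%N) l2norm (X i)) * R0) * l2norm (D - E).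
  have := tot_loss_lipschitz X Y m (theta + stretch u R0 D) (theta + stretch u R0 E).
  rewrite opprD addrACA subrr add0r => h; apply: le_trans h _; rewrite lerD2l -mulrA ler_wpM2l//.
    by apply: sumr_ge0 => i _; exact: l2norm_ge0.
  (* [stretch] is linear, multiplies the component along u by R0 >= 1 and fixes the orthogonal one,
     so it increases norms by at most the factor R0. *)
  have -> : stretch u R0 D - stretch u R0 E = stretch u R0 (D - E).
    by rewrite /stretch dotBr mulrBr scalerBl opprD addrACA.
  have -> : stretch u R0 (D - E) = R0 *: (D - E) + (- (R0 - 1)) *: perp u (D - E).
    by rewrite /stretch /perp; apply/matrixP => i j; rewrite !mxE; ring.
  move: (D - E) => F.
  have -> : R0 *: F + (- (R0 - 1)) *: perp u F = (R0 * dot u F) *: u + perp u F.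
    by rewrite /perp; apply/matrixP => i j; rewrite !mxE; ring.
  rewrite -ler_sqr ?nnegrE ?mulr_ge0 ?l2norm_ge0 ?(ltW R0_gt0)//.
  rewrite (pythagoras _ u1) exprMn (pythagoras F u1).
  have -> : dot u ((R0 * dot u F) *: u + perp u F) = R0 * dot u F.
    by rewrite dotDr dotZr u1 dot_perp// addr0 mulr1.
  have -> : perp u ((R0 * dot u F) *: u + perp u F) = perp u F.
    have uP := dot_perp F u1; set Q := perp u F in uP *; clearbody Q.
    by rewrite /perp dotDr dotZr u1 uP addr0 mulr1 addrC addKr.
  rewrite exprMn mulrDr lerD2l ler_peMl ?sqr_ge0// expr_ge1// ltW//.
have [|D hD Dmin] := @EVT_shell R d g _ 0 c0 lip; first by exists 0; rewrite l2norm0 lexx ltW.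
exists (theta + stretch u R0 D) => z.
have -> : z = theta + stretch u R0 (stretch u R0^-1 (z - theta)) by rewrite stretchK addrC subrK.
set E := stretch u R0^-1 _.
have [Ec|Ec] := leP (l2norm E) c0; first by apply: Dmin; rewrite l2norm_ge0.
apply: le_trans (ltW (loss_far (ltW Ec))).
have := Dmin 0; rewrite /g l2norm0 stretch0 addr0 lexx (ltW c0_gt0); exact.
Qed.

Lemma argmin_local th : (forall z, tot_loss X Y m th <= tot_loss X Y m z) ->
  l2norm (stretch u R0^-1 (th - theta)) < c0.
Proof.
move=> thmin; rewrite ltNge; apply/negP => /loss_far.
by rewrite stretchK addrC subrK ltNge thmin.
Qed.

End localization.

Section events.
Context {R : realType} {d1 d2 : measure_display} {T : measurableType d1}
  {T' : measurableType d2} (P : probability T R) {n : nat}.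
Variable Z : 'I_n -> T -> T'.
Hypothesis mZ : forall i, measurable_fun setT (Z i).

Definition fails (A : set (n.-tuple T')) : \bar R := P (data Z @^-1` (~` A)).

Lemma measurable_data_preimage (A : set (n.-tuple T')) : measurable A -> measurable (data Z @^-1` A).
Proof. by move=> mA; rewrite -[X in measurable X]setTI; exact: measurable_data. Qed.

Lemma failsI (A B : set (n.-tuple T')) (a b : R) : measurable A -> measurable B ->
  (fails A <= a%:E)%E -> (fails B <= b%:E)%E -> (fails (A `&` B) <= (a + b)%:E)%E.
Proof.
move=> mA mB hA hB; rewrite /fails setCI preimage_setU.
apply: le_trans (measureU2 _ _ _) _.
- by apply: measurable_data_preimage; exact: measurableC.
- by apply: measurable_data_preimage; exact: measurableC.
by rewrite EFinD leeD.
Qed.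

Lemma indep_of_geI k (A B : set (n.-tuple T')) :
  indep_of_ge k A -> indep_of_ge k B -> indep_of_ge k (A `&` B).
Proof. by move=> hA hB W j z kj; rewrite /setI/= hA// hB. Qed.

End events.

Lemma smallc_gt0 {R : realType} (c0 : R) : 0 < c0 -> 0 < smallc c0.
Proof.
move=> c00; rewrite /smallc divr_gt0// mulr_gt0 ?exprn_gt0 ?pdf1_gt0// subr_gt0.
by rewrite -[ltRHS]expR0 ltr_expR oppr_lt0 divr_gt0// exprn_gt0// divr_gt0.
Qed.

Lemma step1_event {R : realType} (c0 : R) : 0 < c0 -> c0 <= 1 ->
  exists2 C1 : R, 0 < C1 & forall (d1 : measure_display) (T : measurableType d1)
  (P : probability T R) (n d : nat) (theta : 'cV[R]_d) (x : 'I_n -> T -> 'cV[R]_d)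
  (y : 'I_n -> T -> bool) (m : nat) (t : R),
  logistic_sample P theta x y -> 1 <= l2norm theta -> (m <= n)%N -> 1 <= t ->
  C1 * (d%:R + t) <= m%:R / l2norm theta ->
  exists G : set (n.-tuple ('cV[R]_d * bool)%type),
  [/\ measurable G, indep_of_ge m G, (fails P (obs x y) G <= (3 * expR (- t))%:E)%E &
   forall W, G W -> let X j := (tnth W j).1 in let Y j := (tnth W j).2 in
    spanning X m /\ forall D, l2norm D = c0 ->
      tot_loss X Y m theta <
      tot_loss X Y m (theta + stretch ((l2norm theta)^-1 *: theta) (l2norm theta) D)].
Proof.
move=> c00 c01; set ka := smallc c0; have ka0 : 0 < ka by exact: smallc_gt0.
pose bc : R := bernC + 1.
have bc0 : 0 < bc by rewrite /bc; have := @bernC_ge0 R; lra.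
have den0 : 0 < 200 * 400 * bc by apply: mulr_gt0; [lra|exact: bc0].
(* The curvature ka L / 4 left after the net contributes ka L / 20000 in [loss_increase]; this lam
   keeps the score term 2 bc lam L c0 below half of it. The cap is the range of [bernstein]. *)
pose lam : R := Num.min 16^-1 (ka / (200 * 400 * bc)).
have lam0 : 0 < lam.
  rewrite /lam lt_min invr_gt0; apply/andP; split; first lra.
  by apply: divr_gt0; [exact: ka0|exact: den0].
have lam1 : lam <= 16^-1 by rewrite /lam ge_min lexx.
have lam2 : lam * (200 * 400 * bc) <= ka by rewrite -(ler_pdivlMr _ _ den0) /lam ge_min lexx orbT.
clearbody lam.
(* With this mesh the passage from net to sphere costs 2 * 2050 L c0 / N <= ka L / 4, half of the
   curvature ka L / 2 on the net. *)
pose N := (Num.truncn ((41 * 400) / ka)).+2.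
have N1 : (1 < N)%N by [].
have N0 : 0 < N%:R :> R by rewrite ltr0n.
have NK : (41 * 400) / ka <= N%:R.
  have h : 0 <= (41 * 400) / ka by apply: divr_ge0; [lra|exact: ltW].
  have /andP[_ /ltW hN] := truncn_itv h; apply: le_trans hN _; rewrite ler_nat /N//.
clearbody N.
pose K : R := `|ln (netK 2)| + `|ln (netK N)| + 1.
have K1 : 1 <= K by rewrite /K; have := normr_ge0 (ln (netK 2) : R); have := normr_ge0 (ln (netK N) : R); lra.
(* The three events have rates lam^2, ka / 2 and 1 per unit of L: Q dominates the reciprocals, K the
   logarithms of the net sizes. *)
pose Q : R := lam ^- 2 + 2 / ka + 1.
have l2 : 0 < lam ^- 2 by rewrite invr_gt0 exprn_gt0.
have ka2 : 0 < 2 / ka by rewrite divr_gt0.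
have Q0 : 0 < Q by rewrite /Q; lra.
exists (K * Q); first by rewrite mulr_gt0//; lra.
move=> d1 T P n d theta x y m t sample th1 mn t1 hC.
set R0 := l2norm theta in hC *; set L := m%:R / R0 in hC.
have dt : 0 <= d%:R + t by rewrite addr_ge0//; lra.
have base k q : `|k| <= K -> 0 < q -> q^-1 <= Q -> k * d%:R + t <= q * L.
  move=> kK q0 qQ; apply: (@le_trans _ _ (K * (d%:R + t))).
    rewrite mulrDr lerD ?ler_wpM2r ?ler_peMl//; first exact: le_trans (ler_norm _) kK.
    lra.
  rewrite -(ler_pdivrMl _ _ q0); apply: le_trans hC; rewrite (mulrC K Q) -mulrA ler_wpM2r//.
  by rewrite mulr_ge0//; lra.
have L0 : 0 < L.
  apply: lt_le_trans hC; rewrite mulr_gt0// ?mulr_gt0//; first lra.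
  by rewrite ltr_wpDl//; lra.
have n2 : `|ln (netK 2)| <= K by rewrite /K; have := normr_ge0 (ln (netK N) : R); lra.
have nN : `|ln (netK N)| <= K by rewrite /K; have := normr_ge0 (ln (netK 2) : R); lra.
have b1 : ln (netK 2) * d%:R + t <= lam ^+ 2 * L.
  by apply: base => //; [rewrite exprn_gt0|rewrite /Q; lra].
have b2 : ln (netK N) * d%:R + t <= ka / 2 * L.
  by apply: base => //; [rewrite divr_gt0|rewrite invfM invrK mulrC /Q; lra].
have b3 : ln (netK 2) * d%:R + t <= L.
  by rewrite -[L]mul1r; apply: base => //; rewrite invr1 /Q; lra.
have [G1 [mG1 iG1 pG1 hG1]] := score_event sample th1 mn lam0 lam1 b1.
have [G2 [mG2 iG2 pG2 hG2]] := curvature_event sample th1 mn N1 c00 c01 b2.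
have [G3 [mG3 iG3 pG3 hG3]] := near0_event sample th1 mn b3.
have mZ := measurable_obs sample.
exists (G1 `&` (G2 `&` G3)); split.
- by apply: measurableI => //; exact: measurableI.
- by apply: indep_of_geI => //; exact: indep_of_geI.
- have -> : 3 * expR (- t) = expR (- t) + (expR (- t) + expR (- t)) by clear; ring.
  by apply: failsI => //; [exact: measurableI|exact: failsI].
move=> W [W1 [W2 W3]] X Y; set u := R0^-1 *: theta.
have S1 := hG1 W W1.
have curv D : l2norm D = c0 -> ka / 4 * L <= \sum_(j < n | (j < m)%N) (near0 u R0 (X j))%:R * Num.min 1 (dot (X j) (stretch u R0 D) ^+ 2).
  move=> Dc; have [D' hD' hS] := hG2 W W2 D Dc.
  apply: le_trans _ (curvature_transfer hS (hG3 W W3 (D - D'))); rewrite -/R0 -/L.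
  have h : 2050 * L * l2norm (D - D') <= 2050 * L * (ka / (41 * 400)).
    apply: ler_wpM2l; first by apply: mulr_ge0; [clear; lra|exact: ltW].
    apply: le_trans hD' _; rewrite ler_pdivrMr// mulrC -ler_pdivrMr; last by apply: divr_gt0; [exact: ka0|clear; lra].
    rewrite invf_div; apply: le_trans _ NK; apply: ler_piMl; last exact: c01.
    by apply: divr_ge0; [clear; lra|exact: ltW].
  have e : 2050 * L * (ka / (41 * 400)) = ka * L / 8 by field.
  by move: h; rewrite e -/ka; clear; lra.
split.
(* A direction orthogonal to all covariates would make the curvature vanish at a point of the
   sphere. *)
- move=> E E0; pose F := stretch u R0^-1 E.
  have FE : stretch u R0 F = E by apply: stretchK.
  have F0 : 0 < l2norm F.
    rewrite l2norm_gt0; apply/eqP => F0; move: E0; rewrite -FE F0.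
    by rewrite /stretch dot0r mulr0 scale0r addr0 eqxx.
  pose D := (c0 / l2norm F) *: F.
  have Dc : l2norm D = c0.
    by rewrite l2normZ ger0_norm ?divr_ge0 ?(ltW c00) ?(ltW F0)// divfK// gt_eqF.
  have := lt_le_trans (mulr_gt0 (divr_gt0 ka0 (ltr0n R 4)) L0) (curv D Dc).
  apply: contraPP => /forall2NP hno; apply/negP; rewrite -leNgt; apply: sumr_le0 => i im.
  have [//|/negP] := hno i; rewrite negbK => /eqP xE.
  rewrite /D stretchZ FE dotZr xE mulr0 expr0n/= min_r// ?mulr0//.
- move=> D Dc.
  have S1' : l2norm (stretch u R0 (\sum_(j < n | (j < m)%N) rz u R0 (X j, Y j) *: X j)) <= 2 * (bc * lam * L).
    by under eq_bigr do rewrite /X /Y -surjective_pairing.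
  have := loss_increase th1 Dc S1' (curv D Dc).
  rewrite -/R0 -/u => h; rewrite -subr_gt0; apply: lt_le_trans (_ : 0 < _) _; last by rewrite lerBrDl; exact: h.
  have h1 : lam * (200 * 400 * bc) * c0 <= ka * 1.
    by apply: ler_pM; [apply: mulr_ge0; exact: ltW|exact: ltW|exact: lam2|exact: c01].
  have e : ka / 4 * L / 5000 - 2 * (bc * lam * L) * c0 = L * (2 * ka - lam * (200 * 400 * bc) * c0)  / (200 * 200).
    by field.
  rewrite e; apply: divr_gt0; last by clear; lra.
  by apply: mulr_gt0; [exact: L0|move: h1 ka0; clear; lra].
Qed.

(** * Measurable selection of the minimiser *)

Lemma measurable_from_lt {R : realType} {d0} {T : measurableType d0} (f : T -> R) :
  (forall a, measurable [set w | f w < a]) -> measurable_fun setT f.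
Proof.
move=> mf; apply: (measurability (@RGenCInfty.G R)); first exact: RGenCInfty.measurableE.
move=> _ [_ [a ->] <-]; rewrite setTI (_ : _ @^-1` _ = ~` [set w | f w < a]).
  exact: measurableC.
by apply/seteqP; split => w /=; rewrite in_itv/= andbT leNgt => /negP.
Qed.

Lemma measurable_to_colvec {R : realType} {d : nat} {d0} {T : measurableType d0}
    (f : T -> 'cV[R]_d) :
  (forall j, measurable_fun setT (fun w => f w j 0)) -> measurable_fun setT f.
Proof.
move=> mf; apply: measurability; first reflexivity.
move=> _ [A hA <-]; rewrite setTI.
have : (\big[setU/set0]_(i < d) preimage_set_system setT (fun v : 'cV[R]_d => v i 0) measurable) `<=`
   [set A | exists j B, measurable B /\ A = (fun v : 'cV[R]_d => v j 0) @^-1` B].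
  apply: (big_ind (fun S => S `<=` [set A | exists j B, measurable B /\ A = (fun v : 'cV[R]_d => v j 0) @^-1` B])) => //.
    by move=> S1 S2 h1 h2 B [/h1|/h2].
  by move=> i _ _ [B mB <-]; exists i, B; rewrite setTI.
move=> /(_ A hA) [j [B [mB ->]]].
by have := mf j measurableT B mB; rewrite setTI.
Qed.

Lemma countable_bigcap_measurable {d0} {T : measurableType d0} (I : countType) (D : set I)
    (F : I -> set T) :
  (forall i, D i -> measurable (F i)) -> measurable (\bigcap_(i in D) F i).
Proof.
move=> mF; rewrite -[X in measurable X]setCK setC_bigcap bigcup_mkcond; apply: measurableC.
apply: countable_bigcupT_measurable => [|i]; first exact: countableP.
by case: ifPn => //; rewrite inE => Di; apply: measurableC; exact: mF.
Qed.

Section argmin_selection.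
Context {R : realType} {n d : nat}.
Local Notation sample := (n.-tuple ('cV[R]_d * bool)%type).
Variables (m : nat) (G : set sample) (theta : 'cV[R]_d).

Definition xs (W : sample) (j : 'I_n) : 'cV[R]_d := (tnth W j).1.
Definition ys (W : sample) (j : 'I_n) : bool := (tnth W j).2.

(** Off G the value is the true parameter, so the localization, and with it every bound on the
    direction, holds for all samples. *)
Definition argmin_sel (W : sample) : 'cV[R]_d :=
  if `[< G W >] then xget theta [set th | forall z, tot_loss (xs W) (ys W) m th <= tot_loss (xs W) (ys W) m z]
  else theta.

Hypothesis mG : measurable G.
Hypothesis iG : indep_of_ge m G.
Hypothesis span : forall W, G W -> spanning (xs W) m.
Hypothesis ex : forall W, G W -> exists th, forall z, tot_loss (xs W) (ys W) m th <= tot_loss (xs W) (ys W) m z.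

Lemma argmin_selP W : G W -> forall z, tot_loss (xs W) (ys W) m (argmin_sel W) <= tot_loss (xs W) (ys W) m z.
Proof.
move=> GW; rewrite /argmin_sel asboolT//; case: xgetP => [th _ //|no].
by have [th hth] := ex GW; have := no th.
Qed.

Lemma argmin_sel_unique W th : G W ->
  (forall z, tot_loss (xs W) (ys W) m th <= tot_loss (xs W) (ys W) m z) -> th = argmin_sel W.
Proof.
move=> GW thmin; apply/eqP; rewrite -subr_eq0; apply/negPn/negP => ne.
have := argmin_strict (span GW) (argmin_selP GW) ne.
by rewrite addrC subrK ltNge thmin.
Qed.

Lemma indep_tot_loss : indep_of_ge m (fun W => tot_loss (xs W) (ys W) m).
Proof.
move=> W j z mj; apply/funext => th; rewrite /tot_loss; apply: eq_bigr => i im.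
rewrite /xs /ys tnth_upd; case: (eqVneq i j) => // ij.
by move: im; rewrite ij ltnNge mj.
Qed.

Lemma indep_argmin_sel : indep_of_ge m argmin_sel.
Proof. by move=> W j z mj; rewrite /argmin_sel iG// indep_tot_loss. Qed.

Lemma measurable_xs j : measurable_fun setT (fun W => xs W j).
Proof. by apply: measurableT_comp => //; exact: measurable_tnth. Qed.

Lemma measurable_ys j : measurable_fun setT (fun W => ys W j).
Proof. by apply: measurableT_comp => //; exact: measurable_tnth. Qed.

Lemma measurable_ysR j : measurable_fun setT (fun W => (ys W j)%:R : R).
Proof. by apply: (measurableT_comp (f := fun b : bool => b%:R : R)) => //; exact: measurable_ys. Qed.

Lemma measurable_tot_loss th : measurable_fun setT (fun W => tot_loss (xs W) (ys W) m th).
Proof.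
apply: measurable_sum_cond => j _; rewrite /logistic_loss.
have mdot : measurable_fun setT (fun W => dot (xs W j) th) by apply: measurable_dot; exact: measurable_xs.
apply: measurable_funB; last by apply: measurable_funM => //; exact: measurable_ysR.
apply: measurableT_comp; first exact: measurable_ln.
by apply: measurable_funD => //; exact: measurableT_comp.
Qed.

Lemma measurable_argmin_sel : measurable_fun setT argmin_sel.
Proof.
apply: measurable_to_colvec => j; apply: measurable_from_lt => a.
rewrite (_ : [set W | _] = (G `&` \bigcup_(p in [set: 'cV[rat]_d * nat])
    ([set W | ratr (p.1 j 0) < a] `&` \bigcap_(w' in [set w' : 'cV[rat]_d | a <= ratr (w' j 0)])
      [set W | tot_loss (xs W) (ys W) m (map_mx ratr p.1) + p.2.+1%:R^-1
                <= tot_loss (xs W) (ys W) m (map_mx ratr w')]))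
   `|` (~` G `&` [set W | theta j 0 < a])).
  apply: measurableU.
    apply: measurableI => //; apply: countable_bigcupT_measurable => [|[w k]]/=; first exact: countableP.
    apply: measurableI.
      rewrite (_ : [set W | _] = if ratr (w j 0) < a then setT else set0).
        by case: ifP.
      by case: ifP => h; apply/seteqP; split => // W /=; rewrite h.
    apply: countable_bigcap_measurable => // w' _.
    by apply: measurable_le_set; [apply: measurable_funD => //|]; exact: measurable_tot_loss.
  apply: measurableI; first exact: measurableC.
  rewrite (_ : [set W | _] = if theta j 0 < a then setT else set0); first by case: ifP.
  by case: ifP => h; apply/seteqP; split => // W /=; rewrite h.
apply/seteqP; split => W /=.
  have [GW|nG] := pselect (G W); last first.
    by rewrite /argmin_sel asboolF// => h; right.
  move=> /(argmin_coord_lt (span GW) (argmin_selP GW)) [w [k [wa hw]]].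
  by left; split => //; exists (w, k).
move=> [[GW [[w k] _ [wa hw]]]|[nG h]]; last by rewrite /argmin_sel asboolF.
by apply/(argmin_coord_lt (span GW) (argmin_selP GW)); exists w, k.
Qed.

End argmin_selection.

Section direction_geometry.
Context {R : realType} {d : nat}.
Variables (theta th : 'cV[R]_d) (c0 : R).
Hypothesis th1 : 1 <= l2norm theta.
Let R0 := l2norm theta.
Let u := R0^-1 *: theta.
Hypothesis c0_gt0 : 0 < c0.
Hypothesis c0_le : c0 <= 4^-1.
Hypothesis loc : l2norm (stretch u R0^-1 (th - theta)) < c0.
Let v := (l2norm th)^-1 *: th.

(** Stretching multiplies only the component along u by R0, so [th] has orthogonal part at most c0
    but length at least 3 R0 / 4. Hence the angle is of order c0 / R0. *)
Lemma direction_close :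
  [/\ R0 / 2 <= l2norm th, dot v v = 1, 0 < dot v u & l2norm (perp v u) <= 2 * c0 / R0].
Proof.
have R0_gt0 : 0 < R0 by exact: lt_le_trans th1.
have u1 : dot u u = 1 by apply: l2norm_unit; rewrite -l2norm_gt0.
move: loc; set D := stretch _ _ _ => Dc.
have thE : th = theta + stretch u R0 D by rewrite /D stretchK// addrC subrK.
have tu : theta = R0 *: u by rewrite /u scalerA mulfV ?scale1r// gt_eqF.
have uD : `|dot u D| <= c0.
  apply: le_trans (cauchy_schwarz u D) _; rewrite {1}/l2norm u1 sqrtr1 mul1r; exact: ltW.
have uth : dot u th = R0 * (1 + dot u D).
  by rewrite thE tu dotDr dotZr u1 /stretch dotDr dotZr u1; ring.
have pth : perp u th = perp u D.
  rewrite /perp uth thE /stretch; apply/matrixP => i j.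
  by move: (dot u D) => e; rewrite !mxE; field; rewrite gt_eqF.
have uth_ge : R0 * (3 / 4) <= dot u th.
  by rewrite uth ler_wpM2l ?(ltW R0_gt0)//; move: uD; rewrite ler_norml => /andP[h _]; have := c0_le; lra.
have pth_le : l2norm (perp u th) <= c0.
  by rewrite pth; apply: le_trans (l2norm_perp D u1) (ltW Dc).
have nth_ge : R0 * (3 / 4) <= l2norm th.
  apply: le_trans uth_ge _; apply: le_trans (dot_le _ _) _.
  by rewrite {1}/l2norm u1 sqrtr1 mul1r.
have nth0 : 0 < l2norm th by apply: lt_le_trans nth_ge; rewrite mulr_gt0//; lra.
have v1 : dot v v = 1 by apply: l2norm_unit; rewrite -l2norm_gt0.
have vu : dot v u = dot u th / l2norm th by rewrite /v dotZl dotC mulrC.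
split => //.
- by apply: le_trans nth_ge; rewrite ler_wpM2l ?(ltW R0_gt0)//; lra.
- by rewrite vu divr_gt0//; apply: lt_le_trans uth_ge; rewrite mulr_gt0//; lra.
(* The sine of the angle between u and v is the same seen from either direction. *)
- have e : l2norm (perp v u) = l2norm (perp u th) / l2norm th.
    have h1 := pythagoras u v1; have h2 := pythagoras th u1.
    have nu : l2norm u = 1 by rewrite /l2norm u1 sqrtr1.
    apply/eqP; rewrite -(@eqrXn2 _ 2)//; rewrite ?divr_ge0 ?l2norm_ge0//; apply/eqP.
    rewrite expr_div_n; move: h1 h2; rewrite nu vu => h1 h2.
    have -> : l2norm (perp v u) ^+ 2 = 1 - (dot u th / l2norm th) ^+ 2.
      by rewrite -(expr1n R 2) h1; ring.
    have -> : l2norm (perp u th) ^+ 2 = l2norm th ^+ 2 - dot u th ^+ 2 by rewrite h2; ring.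
    by field; rewrite gt_eqF.
  rewrite e ler_pdivrMr// mulrAC ler_pdivlMr//.
  have h : R0 * l2norm (perp u th) <= R0 * c0 by rewrite ler_wpM2l// ltW.
  have h' : c0 * (R0 * (3 / 4)) <= c0 * l2norm th by rewrite ler_wpM2l// ltW.
  have p0 : 0 < R0 * c0 by rewrite mulr_gt0.
  by rewrite mulrC; lra.
Qed.

End direction_geometry.

(** * Bernstein bound along adaptive directions *)

Lemma sum_ord_itv {R : realType} (n k l : nat) (a : R) : (k <= l)%N -> (l <= n)%N ->
  \sum_(j < n | (k <= j < l)%N) a = (l - k)%:R * a.
Proof.
move=> kl ln; rewrite mulr_natl -(sumr_const_nat l k a) (big_nat_widen k l n)//.
by rewrite big_geq_mkord; apply: eq_bigl => j; rewrite /= andbC.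
Qed.

Lemma measurable_q {R : realType} {d0} {T : measurableType d0} (f : T -> R) :
  (forall w, 0 <= f w) -> measurable_fun setT f -> measurable_fun setT (fun w => q (f w)).
Proof.
move=> f0 mf; apply: measurable_from_lt => a.
pose I := [set r : R | 0 <= r /\ q r < a].
have mI : measurable I.
  apply: is_interval_measurable => r s /= [r0 qr] [s0 qs] z /andP[rz zs].
  have z0 : 0 <= z by exact: le_trans rz.
  by split => //; apply: le_lt_trans qs; exact: q_ndecr.
rewrite (_ : [set w | _] = f @^-1` I); first by rewrite -[X in measurable X]setTI; exact: mf.
by apply/seteqP; split => w /=; [split|case].
Qed.

Section adaptive.
Context {R : realType} {d1 : measure_display} {T : measurableType d1}
  (P : probability T R) {n d : nat}.
Local Notation sample := (n.-tuple ('cV[R]_d * bool)%type).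
Variables (theta : 'cV[R]_d) (x : 'I_n -> T -> 'cV[R]_d) (y : 'I_n -> T -> bool).
Hypothesis smp : logistic_sample P theta x y.
Variables (k l : nat) (R0 : R) (V a : sample -> 'cV[R]_d) (r : sample -> R).
Hypothesis R0_gt0 : 0 < R0.
Hypothesis kl : (k <= l)%N.
Hypothesis ln : (l <= n)%N.
Hypothesis mV : measurable_fun setT V.
Hypothesis ma : measurable_fun setT a.
Hypothesis mr : measurable_fun setT r.
Hypothesis iV : indep_of_ge k V.
Hypothesis ia : indep_of_ge k a.
Hypothesis ir : indep_of_ge k r.
Hypothesis V1 : forall W, dot (V W) (V W) = 1.
Hypothesis r_ge : forall W, R0 / 2 <= r W.
Hypothesis th_ge : forall W, R0 / 2 <= dot (V W) theta.
Hypothesis th_perp : forall W, l2norm (perp (V W) theta) <= 1.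

Lemma measurable_adaptive_rz (j : 'I_n) : measurable_fun setT (fun W : sample => rz (V W) (r W) (tnth W j)).
Proof.
apply: measurable_funB; first exact: (measurable_ysR j).
apply: measurableT_comp; first exact: measurable_sigmoid.
by apply: measurable_funM => //; apply: measurable_dot2 => //; exact: (measurable_xs j).
Qed.

Lemma measurable_adaptive_mean : measurable_fun setT (fun W => mean_resid theta (V W) (r W) (a W)).
Proof.
apply: measurable_funB.
  by apply: measurable_funM => //; apply: measurable_dot2.
apply: measurable_funM; last exact: measurable_dot2.
by apply: measurable_q => // W; apply: le_trans (r_ge W); rewrite divr_ge0// ltW.
Qed.

Hypothesis Va : forall W, `|dot (V W) (a W)| <= R0.
Hypothesis pa : forall W, l2norm (perp (V W) (a W)) <= 1.

Let dev (c : R) (j : 'I_n) (W : sample) :=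
  c * (rz (V W) (r W) (tnth W j) * dot (xs W j) (a W) - mean_resid theta (V W) (r W) (a W)).

Let mdev c j : measurable_fun setT (dev c j).
Proof.
apply: measurable_funM => //; apply: measurable_funB; last exact: measurable_adaptive_mean.
apply: measurable_funM; first exact: measurable_adaptive_rz.
by apply: measurable_dot2 => //; exact: measurable_xs.
Qed.

(** Resampling a coordinate of index at least k leaves V, a and r fixed, so [bernstein] applies at
    their values; its hypotheses hold at every sample. *)
Lemma adaptive_tail (c s : R) : `|c| <= 16^-1 ->
  let G := [set W | \sum_(j < n | (k <= j < l)%N) dev c j W < (l - k)%:R * (bernC * c ^+ 2 / R0) + s] in
  [/\ measurable G, indep_of_ge l G & (fails P (obs x y) G <= (expR (- s))%:E)%E].
Proof.
move=> c16 G.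
have msum : measurable_fun setT (fun W : sample => \sum_(j < n | (k <= j < l)%N) dev c j W).
  by apply: measurable_sum_cond => j _; exact: mdev.
have mG : measurable G by exact: measurable_lt_set.
have idev (j i : 'I_n) (W : sample) z : (j < i)%N -> (k <= i)%N -> dev c j (upd W i z) = dev c j W.
  move=> ji ki; rewrite /dev /xs iV// ia// ir// tnth_upd.
  by case: (eqVneq j i) => // e; rewrite e ltnn in ji.
split => //.
  move=> W j z lj; rewrite /G/=; congr (_ < _ : Prop); apply: eq_bigr => i /andP[ki il].
  by apply: idev; [exact: leq_trans lj|exact: leq_trans lj].
have mZ := measurable_obs smp; have ind := obs_indep smp.
pose A := [set w | (l - k)%:R * (bernC * c ^+ 2 / R0) + s <= \sum_(j < n | (k <= j < l)%N) dev c j (data (obs x y) w)].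
have -> : fails P (obs x y) G = P A.
  congr (P _); apply/seteqP; split => w /=.
    by move=> /negP; rewrite -leNgt.
  by rewrite /A/= leNgt => /negP.
pose a0 := bernC * c ^+ 2 / R0.
(* The terms of index j < k are set to 0 because they would depend, through V, a and r, on
   coordinates beyond j. *)
have := @tuple_chernoff R _ _ T _ P n (obs x y) mZ ind k l a0 s setT (fun j W => if (k <= j)%N then dev c j W else 0) measurableT.
rewrite preimage_setT probability_setT mule1.
have -> : [set w | setT (data (obs x y) w) /\ s <= \sum_(j < n | (k <= j < l)%N)
    ((if (k <= j)%N then dev c j (data (obs x y) w) else 0) - a0)] = A.
  have e w : \sum_(j < n | (k <= j < l)%N) ((if (k <= j)%N then dev c j (data (obs x y) w) else 0) - a0) =
     \sum_(j < n | (k <= j < l)%N) dev c j (data (obs x y) w) - (l - k)%:R * a0.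
    rewrite sumrB sum_ord_itv//; congr (_ - _); apply: eq_bigr => j /andP[-> _] //.
  by apply/seteqP; split => w; rewrite /A/= e lerBrDl; [case|].
apply => //.
- by move=> j; case: (k <= j)%N; [exact: mdev|exact: measurable_cst].
- by move=> j W i z ji; case: ifP => // kj; apply: idev => //; apply: leq_trans kj (ltnW ji).
- move=> j W /andP[kj jl]; rewrite kj.
  have [mx my _ gx ly] := smp.
  set v := V W; set b := a W; set rr := r W.
  have e w : expR (dev c j (upd W j (obs x y j w))) =
     expR (c * (resid (x j) (y j) v rr w * dot (x j w) b)) * expR (- (c * mean_resid theta v rr b)).
    rewrite /dev /xs iV// ia// ir// tnth_upd eqxx/= -/v -/b -/rr -expRD.
    by congr expR; rewrite /rz /resid/=; ring.
  under eq_integral do rewrite e EFinM.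
  have mres : measurable_fun setT (fun w => c * (resid (x j) (y j) v rr w * dot (x j w) b)).
    apply: measurable_funM => //; apply: measurable_funM; last exact: measurable_dot.
    exact: measurable_resid.
  rewrite ge0_integralZr//; last first.
    by apply/measurable_EFinP; exact: measurableT_comp.
  have B := bernstein (mx j) (my j) (gx j) (ly j) R0_gt0 (V1 W) (r_ge W) (th_ge W) (th_perp W) (Va W) (pa W) c16.
  apply: le_trans (lee_wpmul2r _ B) _; first by rewrite lee_fin expR_ge0.
  by rewrite -EFinM -expRD lee_fin ler_expR /a0 /v /b /rr; lra.
Qed.

(** The choice c = sqrt(t / L) balances the variance term against t, and 256 t <= L keeps it below
    1/16. The two signs of c give the two-sided bound. *)
Lemma adaptive_bernstein (t : R) : 0 < t -> (16 * 16) * t <= (l - k)%:R / R0 ->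
  exists G : set sample, [/\ measurable G, indep_of_ge l G,
   (fails P (obs x y) G <= (2 * expR (- t))%:E)%E & forall W, G W ->
   `| \sum_(j < n | (k <= j < l)%N) (rz (V W) (r W) (tnth W j) * dot (xs W j) (a W)) -
      (l - k)%:R * mean_resid theta (V W) (r W) (a W) | <= (bernC + 1) * Num.sqrt (t * ((l - k)%:R / R0))].
Proof.
move=> t0 ht; set L := (l - k)%:R / R0 in ht *.
have L0 : 0 < L by apply: lt_le_trans ht; rewrite mulr_gt0//; lra.
pose c := Num.sqrt (t / L).
have tL : 0 < t / L by rewrite divr_gt0.
have c0 : 0 < c by rewrite sqrtr_gt0.
have c2 : c ^+ 2 = t / L by rewrite sqr_sqrtr// ltW.
have c16 : c <= 16^-1.
  rewrite -ler_sqr ?nnegrE ?(ltW c0)//.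
  by rewrite c2 ler_pdivrMr//; lra.
have c16' : `|c| <= 16^-1 by rewrite ger0_norm// ltW.
have c16N : `|- c| <= 16^-1 by rewrite normrN.
have [m1 i1 p1] := adaptive_tail t c16'.
have [m2 i2 p2] := adaptive_tail t c16N.
eexists; split; [exact: (measurableI _ _ m1 m2)|exact: (indep_of_geI i1 i2)| |].
  have -> : 2 * expR (- t) = expR (- t) + expR (- t) by lra.
  exact: (failsI (measurable_obs smp) m1 m2 p1 p2).
move=> W [/=]; rewrite sqrrN c2.
have dE c' : \sum_(j < n | (k <= j < l)%N) dev c' j W = c' * (\sum_(j < n | (k <= j < l)%N) (rz (V W) (r W) (tnth W j) * dot (xs W j) (a W)) -
      (l - k)%:R * mean_resid theta (V W) (r W) (a W)).
  by rewrite -mulr_sumr sumrB sum_ord_itv.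
rewrite !dE; set S := _ - _.
have -> : (l - k)%:R * (bernC * (t / L) / R0) + t = (bernC + 1) * t.
  have -> : (l - k)%:R * (bernC * (t / L) / R0) = bernC * t * (L / L) by rewrite /L; ring.
  by rewrite divff ?gt_eqF//; ring.
have e : (bernC + 1) * t = c * ((bernC + 1) * Num.sqrt (t * L)).
  have sE : c * Num.sqrt (t * L) = t.
    rewrite /c -sqrtrM ?(ltW tL)// (_ : t / L * (t * L) = t ^+ 2); last by field; rewrite gt_eqF.
    by rewrite sqrtr_sqr ger0_norm// ltW.
  by rewrite mulrCA sE.
rewrite e mulNr -mulrN !ltr_pM2l// => h1 h2.
by rewrite ler_norml; apply/andP; split; lra.
Qed.

End adaptive.

(** * Step 2 *)

Lemma continuous_bigsum {R : realType} (I : eqType) (s : seq I) (p : pred I) (f : I -> R -> R) :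
  (forall i, continuous (f i)) -> continuous (fun r : R => \sum_(i <- s | p i) f i r).
Proof.
move=> cf; elim: s => [|i s IH].
  by under eq_fun do rewrite big_nil; exact: cst_continuous.
under eq_fun do rewrite big_cons; case: (p i); last exact: IH.
by move=> r; apply: cvgD; [exact: cf|exact: IH].
Qed.

Lemma qinvP {R : realType} (K y : R) : 0 <= K -> 0 <= y <= q K ->
  [/\ 0 <= qinv y, qinv y <= K & q (qinv y) = y].
Proof.
move=> K0 hy; have [|r /andP[r0 rK] qr] := @q_IVT R 0 K y (lexx _) K0; first by rewrite q0.
by rewrite -qr qinvE.
Qed.

Lemma measurable_qinv {R : realType} {d0} {T : measurableType d0} (K : R) (f : T -> R) :
  0 <= K -> (forall w, 0 <= f w <= q K) -> measurable_fun setT f ->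
  measurable_fun setT (fun w => qinv (f w)).
Proof.
move=> K0 f0 mf; apply: measurable_from_lt => a.
have [a0|a0] := leP a 0.
  rewrite (_ : [set w | _] = set0)//; apply/seteqP; split => // w /=.
  by have [h _ _] := qinvP K0 (f0 w); rewrite ltNge (le_trans a0 h).
rewrite (_ : [set w | _] = [set w | f w < q a]); first exact: measurable_lt_set.
have h w : (qinv (f w) < a) = (f w < q a).
  have [h0 _ h] := qinvP K0 (f0 w); apply/idP/idP => [ha|].
    by rewrite -h; apply: q_incr.
  by rewrite -{1}h; apply: contraTT; rewrite -!leNgt => /(q_ndecr (ltW a0)).
by apply/seteqP; split => w /=; rewrite h.
Qed.

Section radial_score.
Context {R : realType} {n d : nat}.
Local Notation sample := (n.-tuple ('cV[R]_d * bool)%type).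
Variables (k l : nat).

(** Minus the derivative in r of the unnormalised loss of the second step. *)
Definition radial (W : sample) (v : 'cV[R]_d) (r : R) : R :=
  \sum_(j < n | (k <= j < l)%N) rz v r (tnth W j) * dot (xs W j) v.

Definition informative (W : sample) (v : 'cV[R]_d) : Prop :=
  exists2 j : 'I_n, (k <= j < l)%N & dot (xs W j) v != 0.

Lemma radial_term_decr (g r r' : R) (b : bool) : r <= r' ->
  (b%:R - sigmoid (r' * g)) * g <= (b%:R - sigmoid (r * g)) * g.
Proof.
move=> rr; rewrite -subr_ge0 -mulrBl opprB addrC addrA subrK.
have [g0|g0] := leP 0 g.
  by rewrite mulr_ge0// subr_ge0 sigmoid_ndecr// ler_wpM2r.
by rewrite mulr_le0// ?(ltW g0)// subr_le0 sigmoid_ndecr// ler_wnM2r// ltW.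
Qed.

Lemma radial_decr W v r r' : informative W v -> r < r' -> radial W v r' < radial W v r.
Proof.
move=> [j jkl g0] rr; rewrite /radial (bigD1 j)//= [ltRHS](bigD1 j)//=.
apply: ltr_leD; last first.
  by apply: ler_sum => i _; apply: radial_term_decr; exact: ltW.
rewrite /rz -/(xs W j); set g := dot _ _ in g0 *.
rewrite -subr_gt0 -mulrBl opprB addrC addrA subrK.
have [gp|gn|ge] := ltgtP 0 g; last by rewrite -ge eqxx in g0.
  by rewrite mulr_gt0// subr_gt0 sigmoid_incr// ltr_pM2r.
by rewrite nmulr_lgt0// subr_lt0 sigmoid_incr// ltr_nM2r.
Qed.

Lemma continuous_radial W v : continuous (radial W v).
Proof.
apply: continuous_bigsum => j r; apply: cvgM; last exact: cvg_cst.
apply: cvgB; first exact: cvg_cst.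
apply: (@cvg_comp _ _ _ (fun r => r * dot (xs W j) v) sigmoid _ (nbhs (r * dot (xs W j) v))).
  by apply: cvgM; [exact: cvg_id|exact: cvg_cst].
exact: continuous_sigmoid.
Qed.

(** If all projections on v vanished the score would be identically 0, so a change of sign also
    yields [informative]. *)
Lemma radial_root W v a b : a <= b -> 0 < radial W v a -> radial W v b < 0 ->
  informative W v /\ exists2 r, a <= r <= b & radial W v r = 0.
Proof.
move=> ab Fa Fb; split.
  apply: contrapT => /forall2NP no.
  have e r : radial W v r = 0.
    by apply: big1 => j jkl; have [//|/negP] := no j; rewrite negbK => /eqP ->; rewrite mulr0.
  by move: Fa; rewrite e ltxx.
have [||r] := @IVT R (radial W v) a b 0 ab.
- by apply: continuous_subspaceT; exact: continuous_radial.
- by rewrite ge_min le_max (ltW Fa) (ltW Fb) orbT.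
by rewrite in_itv/= => h1 h2; exists r.
Qed.

End radial_score.

Lemma q_inj_le {R : realType} (a b : R) : 0 <= b -> q a <= q b -> a <= b.
Proof. by move=> b0; apply: contraTT; rewrite -!ltNge => ba; exact: q_incr. Qed.

Lemma perpZ {R : realType} {d : nat} (v w : 'cV[R]_d) (c : R) : perp v (c *: w) = c *: perp v w.
Proof. by rewrite /perp dotZr scalerBr scalerA. Qed.

Section step2.
Context {R : realType} {d1 : measure_display} {T : measurableType d1}
  (P : probability T R) {n d : nat}.
Local Notation sample := (n.-tuple ('cV[R]_d * bool)%type).
Variables (theta : 'cV[R]_d) (x : 'I_n -> T -> 'cV[R]_d) (y : 'I_n -> T -> bool).
Hypothesis smp : logistic_sample P theta x y.
Hypothesis th1 : 1 <= l2norm theta.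
Let R0 := l2norm theta.
Let u := R0^-1 *: theta.
Variables (k l : nat) (V : sample -> 'cV[R]_d) (rho t : R).
Hypothesis kl : (k <= l)%N.
Hypothesis ln : (l <= n)%N.
Hypothesis mV : measurable_fun setT V.
Hypothesis iV : indep_of_ge k V.
Hypothesis V1 : forall W, dot (V W) (V W) = 1.
Hypothesis Vu : forall W, 0 < dot (V W) u.
Hypothesis Vp : forall W, l2norm (perp (V W) u) <= rho / R0.
Hypothesis rho1 : rho <= 2^-1.
Hypothesis rho2 : 4 * rho ^+ 2 <= pdf1 / (16 * 32).
Hypothesis t0 : 0 < t.
Let L := (l - k)%:R / R0.
Hypothesis L_large : (16 * 16) * t <= L.

(** Twice the deviation bound of [radial_at] divided by (l - k) R0 = L R0^2: at this distance from
    the target the sign of the score is certain. *)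
Definition radial_err : R := 2 * (bernC + 1) * Num.sqrt (t * L) / (L * R0 ^+ 2).
Let del := radial_err.
Hypothesis del_small : del * R0 ^+ 2 <= pdf1 / (32 * 32).

Let R0_gt0 : 0 < R0. Proof. exact: lt_le_trans th1. Qed.
Let u1 : dot u u = 1. Proof. by apply: l2norm_unit; rewrite -l2norm_gt0. Qed.
Let thu : theta = R0 *: u. Proof. by rewrite /u scalerA mulfV ?scale1r// gt_eqF. Qed.
Let L0 : 0 < L. Proof. by apply: lt_le_trans L_large; rewrite mulr_gt0//; lra. Qed.
Let m0 : 0 < (l - k)%:R :> R.
Proof. by have := mulr_gt0 L0 R0_gt0; rewrite /L divfK// gt_eqF. Qed.

Let sq_gt0 : 0 < Num.sqrt (t * L). Proof. by rewrite sqrtr_gt0 mulr_gt0. Qed.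

Lemma bernC1_gt0 : 0 < bernC + 1 :> R.
Proof. by have := @bernC_ge0 R; lra. Qed.

Lemma radial_err_gt0 : 0 < del.
Proof.
apply: divr_gt0; last by rewrite mulr_gt0 ?exprn_gt0.
by rewrite mulr_gt0// mulr_gt0 ?bernC1_gt0.
Qed.

Let cosa W := dot (V W) u.

Lemma cosa_le1 W : cosa W <= 1.
Proof.
apply: le_trans (dot_le _ _) _.
by rewrite /l2norm V1 u1 sqrtr1 mulr1.
Qed.

Lemma cosa_ge W : 1 - rho ^+ 2 / R0 ^+ 2 <= cosa W.
Proof.
have h := pythagoras u (V1 W).
have nu : l2norm u = 1 by rewrite /l2norm u1 sqrtr1.
have p2 : l2norm (perp (V W) u) ^+ 2 <= rho ^+ 2 / R0 ^+ 2.
  rewrite -expr_div_n lerXn2r ?nnegrE ?l2norm_ge0//; exact: le_trans (l2norm_ge0 _) (Vp W).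
have c2 : cosa W ^+ 2 <= cosa W by rewrite expr2 ler_piMl ?cosa_le1//; apply/ltW; exact: Vu.
by move: h; rewrite nu -/(cosa W) expr1n; lra.
Qed.

Let s0 W := q R0 * cosa W.

(** From R0 / 2 to R0 and from R0 to 3 R0 / 2 the function q grows by at least a constant over R0^2.
    The bias q(R0) (1 - u.v), at most 4 rho^2 / R0^2, and del are smaller by the choice of the
    constants. *)
Lemma s0_range W : q (R0 / 2) <= s0 W - del /\ s0 W + del <= q (3 / 2 * R0).
Proof.
have R1 : 1 <= R0 := th1.
have p1 := @pdf1_gt0 R.
have R2 : 0 < R0 ^+ 2 by rewrite exprn_gt0.
have h1 : pdf1 / (16 * 16) / R0 ^+ 2 <= q R0 - q (R0 / 2).
  apply: le_trans (q_lb (K := R0) _ _ _ _) => //; try lra.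
  by rewrite le_eqVlt; apply/orP; left; apply/eqP; field; rewrite gt_eqF.
have h2 : pdf1 / (32 * 32) / R0 ^+ 2 <= q (3 / 2 * R0) - q R0.
  apply: le_trans (q_lb (K := 3 / 2 * R0) _ _ _ _) => //; try lra.
  have -> : pdf1 * (3 / 2 * R0 - R0) / (128 * (3 / 2 * R0) ^+ 3) = pdf1 / R0 ^+ 2 * (1 / 864).
    by field; rewrite gt_eqF.
  have -> : pdf1 / (32 * 32) / R0 ^+ 2 = pdf1 / R0 ^+ 2 * (1 / (32 * 32)) by field; rewrite gt_eqF.
  by rewrite ler_wpM2l ?divr_ge0 ?ltW//; lra.
have h3 : del <= pdf1 / (32 * 32) / R0 ^+ 2 by rewrite ler_pdivlMr.
have q4 := q_le4 R0; have q00 : 0 <= q R0 by apply: q_ge0; exact: ltW.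
have c1 := cosa_le1 W; have c2 := cosa_ge W.
have h4 : q R0 * (1 - cosa W) <= pdf1 / (16 * 32) / R0 ^+ 2.
  apply: (@le_trans _ _ (4 * (rho ^+ 2 / R0 ^+ 2))); first by apply: ler_pM => //; lra.
  by rewrite mulrA ler_wpM2r// invr_ge0 ltW.
have h5 : 0 <= q R0 * (1 - cosa W) by rewrite mulr_ge0// subr_ge0.
have e1 : pdf1 / (16 * 16) / R0 ^+ 2 = pdf1 / (16 * 32) / R0 ^+ 2 + pdf1 / (16 * 32) / R0 ^+ 2 by field; rewrite gt_eqF.
have e2 : pdf1 / (16 * 32) / R0 ^+ 2 = pdf1 / (32 * 32) / R0 ^+ 2 + pdf1 / (32 * 32) / R0 ^+ 2 by field; rewrite gt_eqF.
have e3 : 0 < pdf1 / (32 * 32) / R0 ^+ 2 by apply: divr_gt0; [apply: divr_gt0; [exact: p1|lra]|exact: R2].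
have : s0 W = q R0 - q R0 * (1 - cosa W) by rewrite /s0; ring.
by split; lra.
Qed.

(** The population score at r is proportional to s0 - q(r), so [lo] and [hi] are radii where it
    exceeds the noise with opposite signs; they bracket the empirical root. *)
Let lo W := qinv (s0 W - del).
Let hi W := qinv (s0 W + del).
Let K := 3 / 2 * R0.

Let K0 : 0 <= K.
Proof. by rewrite mulr_ge0// ltW. Qed.

Let lo_range W : 0 <= s0 W - del <= q K.
Proof.
have [h1 h2] := s0_range W; have d0 := radial_err_gt0; apply/andP; split.
  by apply: le_trans h1; apply: q_ge0; rewrite divr_ge0// ltW.
by apply: le_trans h2; rewrite lerD2l; lra.
Qed.

Let hi_range W : 0 <= s0 W + del <= q K.
Proof.
have [h1 h2] := s0_range W; have d0 := radial_err_gt0; apply/andP; split=> //.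
by have /andP[h _] := lo_range W; apply: le_trans h _; rewrite lerD2l; lra.
Qed.

Lemma lo_hi W : [/\ R0 / 2 <= lo W, lo W <= hi W, hi W <= K, q (lo W) = s0 W - del & q (hi W) = s0 W + del].
Proof.
have [l0 lK ql] := qinvP K0 (lo_range W); have [h0 hK qh] := qinvP K0 (hi_range W).
have d0 := radial_err_gt0; have [r1 _] := s0_range W.
split => //.
- by apply: q_inj_le => //; rewrite /lo ql.
- by apply: q_inj_le => //; rewrite /lo /hi ql qh lerD2l; lra.
Qed.

Let ms0 : measurable_fun setT s0.
Proof. by apply: measurable_funM => //; exact: measurable_dot. Qed.

Let mlo : measurable_fun setT lo.
Proof. by apply: (measurable_qinv K0 lo_range); exact: measurable_funB. Qed.

Let mhi : measurable_fun setT hi.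
Proof. by apply: (measurable_qinv K0 hi_range); exact: measurable_funD. Qed.

Let ilo : indep_of_ge k lo.
Proof. by move=> W j z kj; rewrite /lo /s0 /cosa iV. Qed.

Let ihi : indep_of_ge k hi.
Proof. by move=> W j z kj; rewrite /hi /s0 /cosa iV. Qed.

Let Vth W : dot (V W) theta = R0 * cosa W.
Proof. by rewrite {1}thu dotZr. Qed.

Lemma cosa_half W : 2^-1 <= cosa W.
Proof.
apply: le_trans (cosa_ge W).
have h : rho ^+ 2 <= 2^-1.
  have r0 : 0 <= rho by have := le_trans (l2norm_ge0 _) (Vp W); rewrite pmulr_lge0 ?invr_gt0.
  by rewrite expr2; apply: le_trans (ler_pM r0 r0 rho1 rho1) _; lra.
have : rho ^+ 2 / R0 ^+ 2 <= rho ^+ 2.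
  by rewrite ler_pdivrMr ?exprn_gt0// ler_peMr ?sqr_ge0// expr_ge1// ltW.
lra.
Qed.

Lemma direction_ge W : R0 / 2 <= dot (V W) theta.
Proof. by rewrite Vth ler_wpM2l ?cosa_half// ltW. Qed.

Lemma direction_perp W : l2norm (perp (V W) theta) <= 1.
Proof.
have -> : perp (V W) theta = R0 *: perp (V W) u.
  by rewrite {1}thu perpZ.
rewrite l2normZ ger0_norm ?(ltW R0_gt0)//.
apply: (@le_trans _ _ (R0 * (rho / R0))); first by rewrite ler_wpM2l// ltW.
by rewrite mulrCA mulfV ?gt_eqF// mulr1; have := rho1; lra.
Qed.

(** Testing along R0 v uses the full length that [bernstein] allows in the direction of v, so the
    deviation of the radial score gains a factor 1/R0. *)
Lemma radial_at (r : sample -> R) : measurable_fun setT r -> indep_of_ge k r ->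
  (forall W, R0 / 2 <= r W) ->
  exists G : set sample, [/\ measurable G, indep_of_ge l G,
   (fails P (obs x y) G <= (2 * expR (- t))%:E)%E & forall W, G W ->
   `| R0 * radial k l W (V W) (r W) - (l - k)%:R * R0 * (s0 W - q (r W)) | <= (bernC + 1) * Num.sqrt (t * L)].
Proof.
move=> mr ir rge.
have ma : measurable_fun setT (fun W => R0 *: V W).
  by apply: measurable_to_colvec => j; under eq_fun do rewrite mxE; apply: measurable_funM => //;
    exact: (measurableT_comp (measurable_coord j)).
have ia : indep_of_ge k (fun W => R0 *: V W) by move=> W j z kj; rewrite iV.
have Va W : `|dot (V W) (R0 *: V W)| <= R0 by rewrite dotZr V1 mulr1 ger0_norm// ltW.
have pa W : l2norm (perp (V W) (R0 *: V W)) <= 1.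
  by rewrite /perp dotZr V1 mulr1 subrr l2norm0.
have [G [mG iG pG hG]] := adaptive_bernstein smp R0_gt0 kl ln mV ma mr iV ia ir V1 rge direction_ge direction_perp Va pa t0 L_large.
exists G; split => // W /hG.
have -> : \sum_(j < n | (k <= j < l)%N) rz (V W) (r W) (tnth W j) * dot (xs W j) (R0 *: V W) = R0 * radial k l W (V W) (r W).
  by rewrite /radial mulr_sumr; apply: eq_bigr => j _; rewrite dotZr mulrCA.
have -> : mean_resid theta (V W) (r W) (R0 *: V W) = R0 * (s0 W - q (r W)).
  by rewrite /mean_resid !dotZr V1 -/R0 -/u /s0 /cosa (dotC u); ring.
by rewrite mulrA.
Qed.

Lemma step2_event : exists (G : set sample) (rs : sample -> R),
  [/\ measurable G, indep_of_ge l G, (fails P (obs x y) G <= (4 * expR (- t))%:E)%E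
    & [/\ measurable_fun setT rs, indep_of_ge l rs, forall W, R0 / 2 <= rs W <= 3 / 2 * R0 &
  forall W, G W -> [/\ informative k l W (V W), radial k l W (V W) (rs W) = 0 & `|q (rs W) - q R0 * cosa W| <= del]]].
Proof.
have lo_ge W : R0 / 2 <= lo W by have [] := lo_hi W.
have hi_ge W : R0 / 2 <= hi W by have [h1 h2 _ _ _] := lo_hi W; exact: le_trans h2.
have [G1 [mG1 iG1 pG1 hG1]] := radial_at mlo ilo lo_ge.
have [G2 [mG2 iG2 pG2 hG2]] := radial_at mhi ihi hi_ge.
have dE : (l - k)%:R * R0 * del = 2 * (bernC + 1) * Num.sqrt (t * L).
  rewrite /del /radial_err; have -> : (l - k)%:R = L * R0 by rewrite /L divfK// gt_eqF.
  by field; rewrite !gt_eqF.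
have Cs : 0 < (bernC + 1) * Num.sqrt (t * L) by rewrite mulr_gt0 ?bernC1_gt0.
pose G := G1 `&` G2.
have signs W : G W -> 0 < radial k l W (V W) (lo W) /\ radial k l W (V W) (hi W) < 0.
  move=> [/hG1 h1 /hG2 h2]; have [_ _ _ ql qh] := lo_hi W.
  have e1 : (l - k)%:R * R0 * (s0 W - q (lo W)) = 2 * ((bernC + 1) * Num.sqrt (t * L)).
    rewrite ql; have -> : s0 W - (s0 W - del) = del by ring.
    by rewrite dE mulrA.
  have e2 : (l - k)%:R * R0 * (s0 W - q (hi W)) = - (2 * ((bernC + 1) * Num.sqrt (t * L))).
    rewrite qh; have -> : s0 W - (s0 W + del) = - del by ring.
    by rewrite mulrN dE mulrA.
  move: h1 h2; rewrite e1 e2 !ler_norml => /andP[h1 _] /andP[_ h2].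
  split; first by rewrite -(pmulr_rgt0 _ R0_gt0); lra.
  by rewrite -(pmulr_rlt0 _ R0_gt0); lra.
have root W : G W -> informative k l W (V W) /\ exists2 r, lo W <= r <= hi W & radial k l W (V W) r = 0.
  by move=> /signs[h1 h2]; have [_ lh _ _ _] := lo_hi W; exact: radial_root.
(* The default R0 satisfies the range bounds, which are thus valid for all samples. *)
pose rs W := if `[< G W >] then xget R0 [set r | lo W <= r <= hi W /\ radial k l W (V W) r = 0] else R0.
have rsP W : G W -> lo W <= rs W <= hi W /\ radial k l W (V W) (rs W) = 0.
  move=> GW; rewrite /rs asboolT//; case: xgetP => [r _ //|no].
  by have [_ [r h1 h2]] := root W GW; case: (no r).
have mG : measurable G by exact: measurableI.
have iG : indep_of_ge l G by exact: indep_of_geI.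
have iVl : indep_of_ge l V by exact: indep_of_geW iV.
have irad : indep_of_ge l (fun W => radial k l W (V W)).
  move=> W j z lj; apply/funext => r; rewrite /radial iVl//; apply: eq_bigr => i /andP[_ il].
  rewrite /xs tnth_upd; case: (eqVneq i j) => // ij; by move: il; rewrite ij ltnNge lj.
exists G, rs; split => //.
- have -> : 4 * expR (- t) = 2 * expR (- t) + 2 * expR (- t) by lra.
  exact: (failsI (measurable_obs smp)).
split.
- apply: measurable_from_lt => a.
  (* The score is strictly decreasing in r, so on G its root is below a exactly when the score at a
     is negative. *)
  rewrite (_ : [set W | _] = (G `&` [set W | radial k l W (V W) a < 0]) `|` (~` G `&` [set W | R0 < a])).
    apply: measurableU; apply: measurableI => //.
    + apply: measurable_lt_set => //; apply: measurable_sum_cond => j _; apply: measurable_funM.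
        exact: (measurable_adaptive_rz (r := fun=> a)).
      by apply: measurable_dot2 => //; exact: measurable_xs.
    + exact: measurableC.
    + by have [h|h] := boolP (R0 < a); [rewrite (_ : [set _ | _] = setT)//|rewrite (_ : [set _ | _] = set0)//];
        apply/seteqP; split => // W.
  apply/seteqP; split => W /=.
    have [GW|nG] := pselect (G W); last by rewrite /rs asboolF// => h; right.
    have [_ h0] := rsP W GW; have [inf _] := root W GW.
    by move=> /(radial_decr inf); rewrite h0 => h; left.
  move=> [[GW h]|[nG h]]; last by rewrite /rs asboolF.
  have [_ h0] := rsP W GW; have [inf _] := root W GW.
  rewrite ltNge; apply/negP; rewrite le_eqVlt => /orP[/eqP e|/(radial_decr inf)].
    by move: h; rewrite e h0 ltxx.
  by rewrite h0 ltNge (ltW h).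
- by move=> W j z lj; rewrite /rs iG// irad// (indep_of_geW kl ilo)// (indep_of_geW kl ihi).
- move=> W; have [GW|nG] := pselect (G W); last by rewrite /rs asboolF//; have := R0_gt0; lra.
  have [/andP[h1 h2] _] := rsP W GW; have [l1 _ l3 _ _] := lo_hi W.
  by rewrite (le_trans l1 h1) (le_trans h2 l3).
- move=> W GW; have [/andP[h1 h2] h0] := rsP W GW; have [inf _] := root W GW; split => //.
  have [l1 _ _ ql qh] := lo_hi W.
  have lo0 : 0 <= lo W by apply: le_trans l1; rewrite divr_ge0// ltW.
  have := q_ndecr lo0 h1; have := q_ndecr (le_trans lo0 h1) h2; rewrite ql qh -/(s0 W) => a1 a2.
  by rewrite ler_norml; apply/andP; split; lra.
Qed.

End step2.

(** * Step 3 *)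

Section maximal.
Context {R : realType} {d1 d2 : measure_display} {T : measurableType d1}
  {T' : measurableType d2} (P : probability T R) {n : nat}.
Variable Z : 'I_n -> T -> T'.
Hypothesis mZ : forall i, measurable_fun setT (Z i).
Hypothesis indep : mutually_independent P Z.
Variables (k : nat) (a s : R) (X : 'I_n -> n.-tuple T' -> R).
Hypothesis kn : (k <= n)%N.
Hypothesis a0 : 0 <= a.
Hypothesis s0 : 0 < s.
Hypothesis mX : forall j, measurable_fun setT (X j).
Hypothesis iX : forall j : 'I_n, indep_of_ge j.+1 (X j).
Hypothesis hX : forall (j : 'I_n) W, (k <= j)%N ->
  (\int[P]_w' (expR (X j (upd W j (Z j w'))))%:E <= (expR a)%:E)%E.

Definition psum (i : nat) (W : n.-tuple T') : R := \sum_(j < n | (k <= j < i)%N) X j W.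

Let B := s + (n - k)%:R * a.

(* Freezing the partial sums once they exceed the level B turns the tail bound
   for the last one into a maximal inequality. *)
Let alive (j : 'I_n) (W : n.-tuple T') : bool := [forall i : 'I_n, (i <= j)%N ==> (psum i W < B)].

Let mpsum i : measurable_fun setT (psum i).
Proof. by apply: measurable_sum_cond => j _; exact: mX. Qed.

Let ipsum (i j : nat) : (i <= j)%N -> indep_of_ge j (psum i).
Proof.
move=> ij W j' z jj'; apply: eq_bigr => i' /andP[_ i'i]; apply: iX.
exact: leq_trans i'i (leq_trans ij jj').
Qed.

Let ialive (j : 'I_n) : indep_of_ge j (alive j).
Proof.
move=> W j' z jj'; apply/eq_forallb => i; case: (boolP (i <= j)%N) => //= ij.
by rewrite (ipsum ij).
Qed.

Let malive (j : 'I_n) : measurable_fun setT (fun W => (alive j W)%:R : R).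
Proof.
have mA : measurable [set W | alive j W].
  rewrite (_ : [set W | _] = [set W | forall i, i \in enum 'I_n -> ((i <= j)%N -> psum i W < B)]).
    apply: (measurable_forall_seq (A := fun i : 'I_n => [set W | (i <= j)%N -> psum i W < B])) => i _.
    case: (boolP (i <= j)%N) => ij.
      rewrite (_ : [set W | _] = [set W | psum i W < B]); first exact: measurable_lt_set.
      by apply/seteqP; split => W /=; [apply|].
    by rewrite (_ : [set W | _] = setT)//; apply/seteqP; split.
  apply/seteqP; split => W /=; first by move=> /forallP h i _ ij; have := h i; rewrite ij.
  by move=> h; apply/forallP => i; apply/implyP; apply: h; rewrite mem_enum.
rewrite (_ : (fun W => _) = (\1_[set W | alive j W] : _ -> R)); first exact: measurable_indic.
by apply/funext => W/=; rewrite indicE; congr (_%:R : R); congr nat_of_bool; apply/idP/idP; rewrite inE.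
Qed.

Lemma maximal_chernoff :
  let G := [set W | forall i : nat, (i <= n)%N -> psum i W < B] in
  [/\ measurable G & (fails P Z G <= (expR (- s))%:E)%E].
Proof.
move=> G.
have B0 : 0 < B by rewrite ltr_wpDr// mulr_ge0.
have mG : measurable G.
  rewrite (_ : G = [set W | forall i, i \in iota 0 n.+1 -> psum i W < B]).
    apply: (measurable_forall_seq (A := fun i => [set W | psum i W < B])) => i _.
    exact: measurable_lt_set.
  by apply/seteqP; split => W h i; [rewrite mem_iota => /andP[_]|]; [|move=> iN; apply: h; rewrite mem_iota];
    rewrite /= ?ltnS//; apply: h.
split => //.
pose Y j W := (alive j W)%:R * X j W.
have := @tuple_chernoff R d1 d2 T T' P n Z mZ indep k n a s setT Y measurableT.
rewrite preimage_setT probability_setT mule1 => ch.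
apply: le_trans _ (ch _ _ _ _); last 4 first.
- by [].
- by move=> j; exact: measurable_funM.
- by move=> j W i z ji; rewrite /Y (@ialive j W i z (ltnW ji))// iX.
- move=> j W /andP[kj _]; rewrite /Y; under eq_integral do rewrite (@ialive j W j _ (leqnn j)).
  case: (alive j W); first by under eq_integral do rewrite mul1r; exact: hX.
  under eq_integral do rewrite mul0r expR0.
  by rewrite (integral_prob_cst P) lee_fin -[leLHS]expR0 ler_expR.
apply: le_measure; rewrite ?inE.
- by apply: measurable_data_preimage => //; exact: measurableC.
- have mS : measurable [set W : n.-tuple T' | s <= \sum_(j < n | (k <= j < n)%N) (Y j W - a)].
    apply: measurable_le_set => //; apply: measurable_sum_cond => j _.
    by apply: measurable_funB => //; exact: measurable_funM.
  rewrite (_ : [set w | _] = data Z @^-1` [set W : n.-tuple T' | s <= \sum_(j < n | (k <= j < n)%N) (Y j W - a)]).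
    exact: measurable_data_preimage.
  by apply/seteqP; split => w /=; [case|].
move=> w /= nG; split => //; move: (data Z w) nG => W nG.
rewrite sumrB sum_ord_itv// lerBrDr.
have ex0 : exists i, (i <= n)%N && (B <= psum i W).
  by apply: contrapT => no; apply: nG => i iN; rewrite ltNge; apply/negP => h; apply: no; exists i; rewrite iN.
case: (ex_minnP ex0) => i /andP[iN Bi] imin.
have low j : (j < i)%N -> psum j W < B.
  move=> ji; rewrite ltNge; apply/negP => h.
  by have := imin j; rewrite (leq_trans (ltnW ji) iN) h leqNgt ji => /(_ isT).
apply: (le_trans Bi); rewrite [in leLHS]/psum [leRHS](bigID (fun j : 'I_n => (j < i)%N))/=.
rewrite [X in _ <= _ + X]big1 ?addr0.
  rewrite le_eqVlt; apply/orP; left; apply/eqP.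
  apply: eq_big => [j|j /andP[kj ji]].
    by rewrite ltn_ord andbT.
  rewrite /Y; suff -> : alive j W by rewrite mul1r.
  by apply/forallP => i'; apply/implyP => h; apply: low; exact: leq_ltn_trans ji.
move=> j /andP[_]; rewrite -leqNgt => ij.
have iN' : (i < n)%N by exact: leq_ltn_trans (ltn_ord j).
rewrite /Y; suff -> : alive j W = false by rewrite mul0r.
apply/negP => /forallP/(_ (Ordinal iN')); rewrite /= ij/= ltNge => /negP; apply.
exact: Bi.
Qed.

End maximal.

Section quadratic_sum.
Context {R : realType} {n d : nat}.
Variables (k : nat) (a : 'I_n -> 'cV[R]_d).

Definition vsum (l : nat) : 'cV[R]_d := \sum_(i < n | (k <= i < l)%N) a i.

Lemma big_ord_itvS (V : nmodType) (F : 'I_n -> V) (l : nat) (ln : (l < n)%N) : (k <= l)%N ->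
  \sum_(i < n | (k <= i < l.+1)%N) F i = F (Ordinal ln) + \sum_(i < n | (k <= i < l)%N) F i.
Proof.
move=> kl; rewrite (bigD1 (Ordinal ln))/=; last by rewrite kl leqnn.
congr (_ + _); apply: eq_bigl => i; rewrite -val_eqE/= ltnS.
by case: ltngtP; rewrite ?andbT ?andbF.
Qed.

(** Telescoping of |S_(l+1)|^2 - |S_l|^2. The cross terms are the martingale increments of the
    degenerate part. *)
Lemma vsum_sqr l : (l <= n)%N -> dot (vsum l) (vsum l) =
  \sum_(j < n | (k <= j < l)%N) (dot (a j) (a j) + 2 * dot (a j) (vsum j)).
Proof.
elim: l => [|l IH] ln.
  rewrite /vsum !big1 ?dot0l//.
  + by move=> j; rewrite ltn0 andbF.
  + by move=> j; rewrite ltn0 andbF.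
have [kl|lk] := leqP k l.
  rewrite (big_ord_itvS _ ln kl) /vsum (big_ord_itvS _ ln kl) -/(vsum l) -IH ?(ltnW ln)//=.
  by rewrite dotDl !dotDr (dotC (vsum l) (a _)); ring.
have none (i : 'I_n) : (k <= i < l.+1)%N = false.
  by apply/negP => /andP[h1 h2]; have := leq_ltn_trans h1 h2; rewrite ltnS leqNgt lk.
by rewrite /vsum !big_pred0// dot0l.
Qed.

End quadratic_sum.

Lemma offdiag_sum {R : realType} {n d : nat} (p : pred 'I_n) (w : 'I_n -> 'cV[R]_d) :
  \sum_(i < n | p i) \sum_(j < n | p j && (i != j)) dot (w i) (w j) =
  dot (\sum_(i < n | p i) w i) (\sum_(i < n | p i) w i) - \sum_(i < n | p i) dot (w i) (w i).
Proof.
rewrite dot_suml -sumrB; apply: eq_bigr => i pi.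
rewrite (dotC (w i) (\sum_(i < n | _) _)) dot_suml [in RHS](bigD1 i)//= addrAC subrr add0r.
by apply: eq_big => [j|j _]; [rewrite eq_sym|exact: dotC].
Qed.

Section step3.
Context {R : realType} {d1 : measure_display} {T : measurableType d1}
  (P : probability T R) {n d : nat}.
Local Notation sample := (n.-tuple ('cV[R]_d * bool)%type).
Variables (theta : 'cV[R]_d) (x : 'I_n -> T -> 'cV[R]_d) (y : 'I_n -> T -> bool).
Hypothesis smp : logistic_sample P theta x y.
Hypothesis th1 : 1 <= l2norm theta.
Let R0 := l2norm theta.
Let u := R0^-1 *: theta.
Variables (k : nat) (V : sample -> 'cV[R]_d) (r : sample -> R) (t : R).
Hypothesis kn : (k <= n)%N.
Hypothesis mV : measurable_fun setT V.
Hypothesis iV : indep_of_ge k V.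
Hypothesis mr : measurable_fun setT r.
Hypothesis ir : indep_of_ge k r.
Hypothesis V1 : forall W, dot (V W) (V W) = 1.
Hypothesis r_ge : forall W, R0 / 2 <= r W.
Hypothesis th_ge : forall W, R0 / 2 <= dot (V W) theta.
Hypothesis th_perp : forall W, l2norm (perp (V W) theta) <= 1.
Let L := (n - k)%:R / R0.
Hypothesis t0 : 0 < t.
Hypothesis L_large : (16 * 16) * t <= L.

Let R0_gt0 : 0 < R0. Proof. exact: lt_le_trans th1. Qed.
Let L0 : 0 < L. Proof. by apply: lt_le_trans L_large; rewrite mulr_gt0//; lra. Qed.

(** The mean of [wres] given the earlier blocks: projecting q(R0) u - q(r) v orthogonally to v
    removes the second term, whatever r. *)
Definition drift (W : sample) : 'cV[R]_d := q R0 *: perp (V W) u.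

Definition wres (W : sample) (j : 'I_n) : 'cV[R]_d :=
  rz (V W) (r W) (tnth W j) *: perp (V W) (xs W j).

Definition wt (W : sample) (j : 'I_n) : 'cV[R]_d := wres W j - drift W.

Lemma dot_wt W j D : dot (wt W j) D =
  rz (V W) (r W) (tnth W j) * dot (xs W j) (perp (V W) D) - mean_resid theta (V W) (r W) (perp (V W) D).
Proof.
rewrite /wt /wres /drift dotBl !dotZl !(dot_perp_sym _ _ (V1 W)) /mean_resid (dot_perp _ (V1 W)).
by rewrite mulr0 subr0.
Qed.

Lemma measurable_coordwise (f : sample -> 'cV[R]_d) j : measurable_fun setT f -> measurable_fun setT (fun W => f W j 0).
Proof. by move=> mf; exact: (measurableT_comp (measurable_coord j) mf). Qed.

Lemma measurable_addv (f g : sample -> 'cV[R]_d) : measurable_fun setT f -> measurable_fun setT g ->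
  measurable_fun setT (fun W => f W + g W).
Proof.
move=> mf mg; apply: measurable_to_colvec => j; under eq_fun do rewrite mxE.
by apply: measurable_funD; exact: measurable_coordwise.
Qed.

Lemma measurable_scalev (c : sample -> R) (f : sample -> 'cV[R]_d) : measurable_fun setT c -> measurable_fun setT f ->
  measurable_fun setT (fun W => c W *: f W).
Proof.
move=> mc mf; apply: measurable_to_colvec => j; under eq_fun do rewrite mxE.
by apply: measurable_funM => //; exact: measurable_coordwise.
Qed.

Lemma measurable_oppv (f : sample -> 'cV[R]_d) : measurable_fun setT f -> measurable_fun setT (fun W => - f W).
Proof.
move=> mf; under eq_fun do rewrite -scaleN1r.
by apply: measurable_scalev.
Qed.

Lemma measurable_perpv (f : sample -> 'cV[R]_d) : measurable_fun setT f -> measurable_fun setT (fun W => perp (V W) (f W)).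
Proof.
move=> mf; apply: measurable_addv => //; apply: measurable_oppv; apply: measurable_scalev => //.
exact: measurable_dot2.
Qed.

Lemma measurable_wt j : measurable_fun setT (fun W => wt W j).
Proof.
apply: measurable_addv.
  apply: measurable_scalev; first exact: measurable_adaptive_rz.
  by apply: measurable_perpv; exact: measurable_xs.
apply: measurable_oppv; apply: measurable_scalev => //.
by apply: measurable_perpv; exact: measurable_cst.
Qed.

Lemma indep_wt (i j : 'I_n) (W : sample) z : (i < j)%N -> (k <= j)%N -> wt (upd W j z) i = wt W i.
Proof.
move=> ij kj; rewrite /wt /wres /drift /xs iV// ir// tnth_upd.
by case: (eqVneq i j) => // e; rewrite e ltnn in ij.
Qed.

Lemma measurable_vsum l : measurable_fun setT (fun W => vsum k (wt W) l).
Proof.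
apply: measurable_to_colvec => i; under eq_fun do rewrite /vsum summxE.
by apply: measurable_sum_cond => j _; apply: measurable_coordwise; exact: measurable_wt.
Qed.

Lemma indep_vsum (l : nat) (j : 'I_n) (W : sample) z : (l <= j)%N -> (k <= j)%N ->
  vsum k (wt (upd W j z)) l = vsum k (wt W) l.
Proof.
move=> lj kj; apply: eq_bigr => i /andP[_ il]; apply: indep_wt => //.
exact: leq_trans lj.
Qed.

Lemma wt_mgf (j : 'I_n) (W : sample) (D : 'cV[R]_d) (c : R) : (k <= j)%N ->
  l2norm D <= 1 -> `|c| <= 16^-1 ->
  (\int[P]_w (expR (c * dot (wt (upd W j (obs x y j w)) j) D))%:E <= (expR (bernC * c ^+ 2 / R0))%:E)%E.
Proof.
move=> kj D1 c16; have [mx my _ gx ly] := smp.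
set v := V W; set rr := r W; set a := perp v D.
have e w : expR (c * dot (wt (upd W j (obs x y j w)) j) D) =
   expR (c * (resid (x j) (y j) v rr w * dot (x j w) a)) * expR (- (c * mean_resid theta v rr a)).
  rewrite dot_wt /xs iV// ir// tnth_upd eqxx/= -/v -/rr -/a -expRD.
  by congr expR; rewrite /rz /resid/=; ring.
under eq_integral do rewrite e EFinM.
have mres : measurable_fun setT (fun w => c * (resid (x j) (y j) v rr w * dot (x j w) a)).
  apply: measurable_funM => //; apply: measurable_funM; last exact: measurable_dot.
  exact: measurable_resid.
rewrite ge0_integralZr//; last first.
  by apply/measurable_EFinP; exact: measurableT_comp.
have va : dot v a = 0 by exact: (dot_perp D (V1 W)).
have Va : `|dot v a| <= R0 by rewrite va normr0 ltW.
have pa : l2norm (perp v a) <= 1.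
  apply: le_trans (l2norm_perp a (V1 W)) _.
  by apply: le_trans (l2norm_perp D (V1 W)) D1.
have B := bernstein (mx j) (my j) (gx j) (ly j) R0_gt0 (V1 W) (r_ge W) (th_ge W) (th_perp W) Va pa c16.
apply: le_trans (lee_wpmul2r _ B) _; first by rewrite lee_fin expR_ge0.
by rewrite -EFinM -expRD lee_fin ler_expR /v /rr; lra.
Qed.

(** A martingale version of [adaptive_bernstein]: the direction may change with j as long as it is
    predictable. It follows from the last partial sum in [maximal_chernoff]. *)
Lemma wt_tail (A : 'I_n -> sample -> 'cV[R]_d) :
  (forall j, measurable_fun setT (A j)) ->
  (forall (j : 'I_n) W (i : 'I_n) z, (k <= i)%N -> (j <= i)%N -> A j (upd W i z) = A j W) ->
  (forall j W, l2norm (A j W) <= 1) ->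
  exists G : set sample, [/\ measurable G, (fails P (obs x y) G <= (2 * expR (- t))%:E)%E &
    forall W, G W -> `| \sum_(j < n | (k <= j < n)%N) dot (wt W j) (A j W) | <= (bernC + 1) * Num.sqrt (t * L)].
Proof.
move=> mA iA A1.
pose c := Num.sqrt (t / L).
have tL : 0 < t / L by rewrite divr_gt0.
have c0 : 0 < c by rewrite sqrtr_gt0.
have c2 : c ^+ 2 = t / L by rewrite sqr_sqrtr// ltW.
have c16 : c <= 16^-1.
  rewrite -ler_sqr ?nnegrE ?(ltW c0)//.
  by rewrite c2 ler_pdivrMr//; have := L_large; lra.
have c16' : `|c| <= 16^-1 by rewrite ger0_norm// ltW.
have c16N : `|- c| <= 16^-1 by rewrite normrN.
have mdot j : measurable_fun setT (fun W => dot (wt W j) (A j W)).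
  by apply: measurable_dot2 => //; exact: measurable_wt.
have tail e : `|e| <= 16^-1 -> e ^+ 2 = t / L ->
  let G := [set W | psum k (fun j W => if (k <= j)%N then e * dot (wt W j) (A j W) else 0) n W < t + (n - k)%:R * (bernC * e ^+ 2 / R0)] in
  measurable G /\ (fails P (obs x y) G <= (expR (- t))%:E)%E.
  move=> e16 e2 G.
  have mX (j : 'I_n) : measurable_fun setT (fun W => if (k <= j)%N then e * dot (wt W j) (A j W) else 0).
    by case: (k <= j)%N; [exact: measurable_funM|exact: measurable_cst].
  have [|||m1 p1] := @maximal_chernoff R _ _ T _ P n (obs x y) (measurable_obs smp) (obs_indep smp) k (bernC * e ^+ 2 / R0) t
    (fun j W => if (k <= j)%N then e * dot (wt W j) (A j W) else 0) kn _ t0 mX.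
  - by rewrite divr_ge0 ?(ltW R0_gt0)// mulr_ge0 ?sqr_ge0// bernC_ge0.
  - move=> j W i z ji; case: (boolP (k <= j)%N) => // kj.
    have ki : (k <= i)%N by exact: leq_trans kj (ltnW ji).
    by rewrite indep_wt// iA// ltnW.
  - move=> j W kj; rewrite kj; under eq_integral do rewrite iA//.
    exact: wt_mgf.
  have mG : measurable G.
    by apply: measurable_lt_set => //; apply: measurable_sum_cond => j _; exact: mX.
  split => //; apply: le_trans p1; apply: le_measure; rewrite ?inE.
  - by apply: measurable_data_preimage; [exact: (measurable_obs smp)|exact: measurableC].
  - by apply: measurable_data_preimage; [exact: (measurable_obs smp)|exact: measurableC].
  by move=> w /= nG hG; apply: nG; apply: hG.
have [m1 p1] := tail c c16' c2.
have c2N : (- c) ^+ 2 = t / L by rewrite sqrrN.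
have [m2 p2] := tail (- c) c16N c2N.
eexists; split; [exact: (measurableI _ _ m1 m2)| |].
  have -> : 2 * expR (- t) = expR (- t) + expR (- t) by lra.
  exact: (failsI (measurable_obs smp) m1 m2 p1 p2).
move=> W [/=]; rewrite sqrrN c2.
have dE e : psum k (fun j W => if (k <= j)%N then e * dot (wt W j) (A j W) else 0) n W =
   e * \sum_(j < n | (k <= j < n)%N) dot (wt W j) (A j W).
  by rewrite /psum mulr_sumr; apply: eq_bigr => j /andP[-> _].
rewrite !dE; set S := \sum_(j < n | _) _.
have -> : t + (n - k)%:R * (bernC * (t / L) / R0) = (bernC + 1) * t.
  have -> : (n - k)%:R * (bernC * (t / L) / R0) = bernC * t * (L / L) by rewrite /L; ring.
  by rewrite divff ?gt_eqF//; ring.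
have e : (bernC + 1) * t = c * ((bernC + 1) * Num.sqrt (t * L)).
  have sE : c * Num.sqrt (t * L) = t.
    rewrite /c -sqrtrM ?(ltW tL)// (_ : t / L * (t * L) = t ^+ 2); last by field; rewrite gt_eqF.
    by rewrite sqrtr_sqr ger0_norm// ltW.
  by rewrite mulrCA sE.
rewrite e mulNr -mulrN !ltr_pM2l// => h1 h2.
by rewrite ler_norml; apply/andP; split; lra.
Qed.

(** 2 * 16 * (1 + bernC / 16^2): deviation L and variance term at exponent 1/16, with a factor 2 for
    the net. *)
Definition vsumC : R := bernC / 8 + 32.

Lemma vsumC_gt0 : 0 < vsumC.
Proof. by rewrite /vsumC; have := @bernC_ge0 R; lra. Qed.

(** A deviation parameter as large as L pays for the net and still leaves exp (- t). All partial
    sums are needed at once because each serves as the direction for the next observation. *)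
Lemma vsum_event : ln (netK 2) * d%:R + t <= L ->
  exists G : set sample, [/\ measurable G, (fails P (obs x y) G <= (expR (- t))%:E)%E &
    forall W, G W -> forall l, (l <= n)%N -> l2norm (vsum k (wt W) l) <= vsumC * L].
Proof.
move=> hL.
have [s [sK s1 net]] := @ball_net R d 2 (dim_gt0 th1) isT.
rewrite net_exp in sK.
pose X D (j : 'I_n) (W : sample) := if (k <= j)%N then 16^-1 * dot (wt W j) D else 0.
pose a0 := bernC * 16^-1 ^+ 2 / R0.
pose GD D := [set W | forall i : nat, (i <= n)%N -> psum k (X D) i W < L + (n - k)%:R * a0].
have mX D j : measurable_fun setT (X D j).
  rewrite /X; case: (k <= j)%N; last exact: measurable_cst.
  by apply: measurable_funM => //; apply: measurable_dot; exact: measurable_wt.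
have hGD D : D \in s -> measurable (GD D) /\ (fails P (obs x y) (GD D) <= (expR (- L))%:E)%E.
  move=> Ds; have [|||m1 p1] := @maximal_chernoff R _ _ T _ P n (obs x y) (measurable_obs smp) (obs_indep smp) k a0 L (X D) kn _ L0 (mX D).
  - by rewrite divr_ge0 ?(ltW R0_gt0)// mulr_ge0 ?sqr_ge0// bernC_ge0.
  - move=> j W i z ji; rewrite /X; case: (boolP (k <= j)%N) => // kj.
    by rewrite indep_wt//; exact: leq_trans kj (ltnW ji).
  - move=> j W kj; rewrite /X kj; apply: wt_mgf => //; first exact: s1.
    by rewrite ger0_norm// invr_ge0.
  by split.
have mA D : D \in s -> measurable (data (obs x y) @^-1` (~` GD D)).
  by move=> Ds; apply: measurable_data_preimage; [exact: (measurable_obs smp)|apply: measurableC; have [] := hGD D Ds].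
have [_ up] := union_bound_seq mA (fun D Ds => (hGD D Ds).2).
pose G := [set W | forall D, D \in s -> GD D W].
have mG : measurable G by apply: (measurable_forall_seq (A := GD)) => D Ds; have [] := hGD D Ds.
exists G; split => //.
  rewrite /fails (_ : data (obs x y) @^-1` (~` G) = [set w | exists2 D, D \in s & (data (obs x y) @^-1` (~` GD D)) w]).
    apply: le_trans up _; rewrite lee_fin.
    apply: (@le_trans _ _ (expR (ln (netK 2) * d%:R) * expR (- L))).
      by rewrite ler_wpM2r// expR_ge0.
    by rewrite -expRD ler_expR; lra.
  apply/seteqP; split => w /=.
    by move=> /existsNP[D /not_implyP[Ds hD]]; exists D.
  by move=> [D Ds hD] /(_ D Ds).
move=> W GW l ln.
have -> : vsumC * L = 2 * (16 * (L + (n - k)%:R * a0)).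
  have e : (n - k)%:R * a0 = bernC * 16^-1 ^+ 2 * L by rewrite /a0 /L; ring.
  by rewrite e /vsumC; field.
have p0 : 0 <= L + (n - k)%:R * a0.
  rewrite addr_ge0 ?(ltW L0)// mulr_ge0// divr_ge0 ?(ltW R0_gt0)// mulr_ge0 ?sqr_ge0// bernC_ge0//.
apply: (@net_l2norm R d s) => //; first by rewrite mulr_ge0.
move=> D Ds; have /ltW := GW D Ds l ln; rewrite -(ler_pM2l (_ : 0 < 16 :> R))//.
apply: le_trans; rewrite /psum /vsum dot_suml mulr_sumr; apply: ler_sum => j /andP[kj _].
by rewrite /X kj mulrA mulfV ?mul1r// lt0r_neq0.
Qed.

Variable rho : R.
Hypothesis rho0 : 0 < rho.
Hypothesis Vp : forall W, l2norm (perp (V W) u) <= rho / R0.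

Definition Bform (W : sample) : R := ((n - k)%:R * ((n - k)%:R - 1))^-1 *
  \sum_(i < n | (k <= i < n)%N) \sum_(j < n | (k <= j < n)%N && (i != j)) dot (wres W i) (wres W j).

(** Equal to sqrt(t / (L R0^4)), the error scale of the second and third steps. *)
Definition estE : R := Num.sqrt (t * L) / (L * R0 ^+ 2).

Lemma step3_event : ln (netK 2) * d%:R + t <= L -> 2 <= (n - k)%:R :> R ->
  exists G : set sample, [/\ measurable G, (fails P (obs x y) G <= (5 * expR (- t))%:E)%E &
    forall W, G W -> `| Bform W - dot (drift W) (drift W) | <= (8 * rho + 4 * vsumC) * (bernC + 1) * estE].
Proof.
move=> hL m2; set m : R := (n - k)%:R in m2.
have [G1 [mG1 pG1 hG1]] := vsum_event hL.
have VL : 0 < vsumC * L by rewrite mulr_gt0 ?vsumC_gt0.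
(* The direction of the drift, rescaled into the unit ball by the bound rho / R0 on the angle;
   undoing this makes the linear part small. *)
pose A2 (j : 'I_n) (W : sample) : 'cV[R]_d := (R0 / rho) *: perp (V W) u.
have mA2 j : measurable_fun setT (A2 j).
  by apply: measurable_scalev => //; apply: measurable_perpv; exact: measurable_cst.
have iA2 (j : 'I_n) W (i : 'I_n) z : (k <= i)%N -> (j <= i)%N -> A2 j (upd W i z) = A2 j W.
  by move=> ki _; rewrite /A2 iV.
have A21 j W : l2norm (A2 j W) <= 1.
  rewrite l2normZ ger0_norm ?divr_ge0 ?(ltW R0_gt0) ?(ltW rho0)//.
  apply: (@le_trans _ _ (R0 / rho * (rho / R0))).
    by rewrite ler_wpM2l// divr_ge0// ltW.
  by rewrite mulrA divfK ?gt_eqF// mulfV// gt_eqF.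
have [G2 [mG2 pG2 hG2]] := wt_tail mA2 iA2 A21.
(* [wt_tail] wants directions in the unit ball for every sample, so S_j is cut off where it exceeds
   its bound. On [G1] the cutoff is inactive. *)
pose b (j : 'I_n) (W : sample) : bool := dot (vsum k (wt W) j) (vsum k (wt W) j) <= (vsumC * L) ^+ 2.
pose A3 (j : 'I_n) (W : sample) : 'cV[R]_d := ((b j W && (k <= j)%N)%:R / (vsumC * L)) *: vsum k (wt W) j.
have mb j : measurable_fun setT (fun W => (b j W && (k <= j)%N)%:R : R).
  case: (boolP (k <= j)%N) => kj; last first.
    by under eq_fun do rewrite andbF; exact: measurable_cst.
  under eq_fun do rewrite andbT.
  have mB : measurable [set W | b j W].
    by apply: measurable_le_set => //; apply: measurable_dot2; exact: measurable_vsum.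
  rewrite (_ : (fun W => _) = (\1_[set W | b j W] : _ -> R)); first exact: measurable_indic.
  by apply/funext => W/=; rewrite indicE; congr (_%:R : R); congr nat_of_bool; apply/idP/idP; rewrite inE.
have mA3 j : measurable_fun setT (A3 j).
  by apply: measurable_scalev; [exact: measurable_funM|exact: measurable_vsum].
have iA3 (j : 'I_n) W (i : 'I_n) z : (k <= i)%N -> (j <= i)%N -> A3 j (upd W i z) = A3 j W.
  by move=> ki ji; rewrite /A3 /b !indep_vsum.
have A31 j W : l2norm (A3 j W) <= 1.
  rewrite /A3; case: (boolP (b j W)) => [bj|_]; last by rewrite mul0r scale0r l2norm0.
  rewrite l2normZ ger0_norm; last by rewrite divr_ge0// ltW.
  rewrite mulrAC ler_pdivrMr// mul1r; apply: (@le_trans _ _ (l2norm (vsum k (wt W) j))).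
    by rewrite ler_piMl ?l2norm_ge0// lern1; case: (k <= j)%N.
  by rewrite -ler_sqr ?nnegrE ?l2norm_ge0 ?(ltW VL)// l2norm_sqr.
have [G3 [mG3 pG3 hG3]] := wt_tail mA3 iA3 A31.
have mZ := measurable_obs smp.
exists (G1 `&` (G2 `&` G3)); split.
- by apply: measurableI => //; exact: measurableI.
- have -> : 5 * expR (- t) = expR (- t) + (2 * expR (- t) + 2 * expR (- t)) by lra.
  by apply: failsI => //; [exact: measurableI|exact: failsI].
move=> W [W1 [W2 W3]].
have /= B2 := hG2 W W2; have B3 := hG3 W W3; have Bv := hG1 W W1.
set mu := drift W; pose a := wt W; set S := vsum k a n.
set sq := Num.sqrt (t * L) in B2 B3.
have R0n : R0 != 0 by rewrite gt_eqF.
have m0 : 0 < m by lra.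
have mE : m = L * R0 by rewrite /L divfK.
pose Dg := \sum_(j < n | (k <= j < n)%N) dot (a j) (vsum k a j).
have hDg : `|Dg| <= vsumC * L * ((bernC + 1) * sq).
  have -> : Dg = vsumC * L * \sum_(j < n | (k <= j < n)%N) dot (wt W j) (A3 j W).
    rewrite /Dg mulr_sumr; apply: eq_bigr => j /andP[kj jn]; rewrite /A3 kj andbT.
    have -> : b j W.
      rewrite /b -l2norm_sqr ler_sqr ?nnegrE ?l2norm_ge0 ?(ltW VL)//; apply: Bv; exact: ltnW.
    by rewrite dotZr mulrA mulrCA mulfV ?mulr1 ?mul1r// gt_eqF.
  by rewrite normrM (ger0_norm (ltW VL)) ler_wpM2l// ltW.
have hS : `|dot S mu| <= 4 * rho / R0 * ((bernC + 1) * sq).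
  have -> : dot S mu = q R0 * (rho / R0) * \sum_(j < n | (k <= j < n)%N) dot (wt W j) (A2 j W).
    rewrite /S /vsum dot_suml mulr_sumr; apply: eq_bigr => j _.
    by rewrite /A2 /mu /drift !dotZr; field; rewrite R0n gt_eqF.
  have q4 := q_le4 R0; have q00 : 0 <= q R0 by apply: q_ge0; exact: ltW.
  have rR : 0 <= rho / R0 by rewrite divr_ge0// ltW.
  rewrite normrM (ger0_norm (mulr_ge0 q00 rR)); apply: ler_pM => //; first by rewrite mulr_ge0.
  by rewrite -mulrA ler_wpM2r.
have wE j : wres W j = a j + mu by rewrite /a /wt subrK.
have sqD (A M : 'cV[R]_d) (c : R) :
    dot (A + c *: M) (A + c *: M) = dot A A + 2 * c * dot A M + c ^+ 2 * dot M M.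
  by rewrite dotDl !dotDr !dotZl !dotZr (dotC M A); ring.
(* With wres = a + mu, excluding the diagonal cancels the squares |a_j|^2 of [vsum_sqr] and leaves
   the cross sum [Dg]. *)
have quad : \sum_(i < n | (k <= i < n)%N) \sum_(j < n | (k <= j < n)%N && (i != j)) dot (wres W i) (wres W j)
   = m * (m - 1) * dot mu mu + 2 * (m - 1) * dot S mu + 2 * Dg.
  rewrite (offdiag_sum (fun i : 'I_n => (k <= i < n)%N)).
  have -> : \sum_(i < n | (k <= i < n)%N) wres W i = S + m *: mu.
    under eq_bigr do rewrite wE; rewrite big_split/=; congr (_ + _).
    by apply/matrixP => i j; rewrite summxE [RHS]mxE sum_ord_itv.
  have -> : \sum_(i < n | (k <= i < n)%N) dot (wres W i) (wres W i) =
     \sum_(i < n | (k <= i < n)%N) dot (a i) (a i) + 2 * dot S mu + m * dot mu mu.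
    have -> : m * dot mu mu = \sum_(i < n | (k <= i < n)%N) dot mu mu by rewrite sum_ord_itv.
    rewrite /S /vsum dot_suml mulr_sumr -!big_split/=; apply: eq_bigr => i _.
    by rewrite wE; have := sqD (a i) mu 1; rewrite scale1r => ->; ring.
  have := vsum_sqr k a (leqnn n); rewrite -/S big_split/= -mulr_sumr -/Dg => eS.
  by rewrite sqD eS; ring.
rewrite /Bform quad -/m.
have mm : 0 < m * (m - 1) by rewrite mulr_gt0//; lra.
have -> : (m * (m - 1))^-1 * (m * (m - 1) * dot mu mu + 2 * (m - 1) * dot S mu + 2 * Dg) - dot mu mu
   = 2 / m * dot S mu + 2 / (m * (m - 1)) * Dg.
  by field; rewrite subr_eq0 !gt_eqF//; lra.
have sq0 : 0 <= sq by exact: sqrtr_ge0.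
have Cs : 0 <= (bernC + 1) * sq by rewrite mulr_ge0// ltW// bernC1_gt0.
apply: le_trans (ler_normD _ _) _; rewrite (normrM (2 / m)) (normrM (2 / (m * (m - 1)))).
have -> : (8 * rho + 4 * vsumC) * (bernC + 1) * estE =
   2 / m * (4 * rho / R0 * ((bernC + 1) * sq)) + 4 / m ^+ 2 * (vsumC * L * ((bernC + 1) * sq)).
  by rewrite /estE -/sq mE; field; rewrite R0n gt_eqF.
apply: lerD.
  by rewrite (ger0_norm (_ : 0 <= 2 / m)) ?divr_ge0 ?(ltW m0)// ler_wpM2l// divr_ge0// ltW.
have c0 : 0 <= 2 / (m * (m - 1)) by rewrite divr_ge0// ltW.
(* Here 2 / (m (m - 1)) <= 4 / m^2, since m >= 2. *)
rewrite (ger0_norm c0); apply: ler_pM => //.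
rewrite ler_pdivrMr// mulrAC ler_pdivlMr ?exprn_gt0//.
by have := mulr_ge0 (ltW m0) (_ : 0 <= m - 2); rewrite subr_ge0 => /(_ m2); lra.
Qed.

End step3.

(** * From moments to the norm *)

Lemma measurable_inv_l2norm {R : realType} {d : nat} {d0} {T : measurableType d0} (f : T -> 'cV[R]_d) :
  measurable_fun setT f -> (forall w, 0 < l2norm (f w)) ->
  measurable_fun setT (fun w => (l2norm (f w))^-1).
Proof.
move=> mf f0; have e w : (l2norm (f w))^-1 = expR (- (ln (dot (f w) (f w)) / 2)).
  rewrite -l2norm_sqr lnXn// -[_ *+ 2]mulr_natr mulfK ?lt0r_neq0// -lnV ?posrE// lnK//.
  by rewrite posrE invr_gt0.
under eq_fun do rewrite e.
apply: measurableT_comp => //; apply: measurableT_comp => //; apply: measurable_funM => //.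
by apply: measurableT_comp; [exact: measurable_ln|exact: measurable_dot2].
Qed.

(** Taking the positive part only brings S closer to b^2; then divide the difference of squares by a
    sum that is at least b. *)
Lemma sqrt_pospart_close {R : realType} (S b : R) : 0 < b ->
  `|Num.sqrt (pospart S) - b| <= `|S - b ^+ 2| / b.
Proof.
move=> b0; rewrite ler_pdivlMr//; set a := pospart S.
have a0 : 0 <= a by rewrite /a /pospart le_max lexx orbT.
have h : `|a - b ^+ 2| <= `|S - b ^+ 2|.
  rewrite /a /pospart; have [S0|S0] := leP S 0 => //.
  have b2 := sqr_ge0 b; rewrite sub0r normrN ger0_norm// ler0_norm; lra.
apply: le_trans h; have s0 := sqrtr_ge0 a.
have -> : a - b ^+ 2 = (Num.sqrt a - b) * (Num.sqrt a + b) by rewrite -subr_sqr sqr_sqrtr.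
by rewrite normrM ler_wpM2l// ger0_norm ?addr_ge0 ?(ltW b0)// lerDr.
Qed.

Lemma clip_close {R : realType} (lo hi b x : R) : lo <= b -> b <= hi ->
  [/\ lo <= clip lo hi x, clip lo hi x <= hi & `|clip lo hi x - b| <= `|x - b|].
Proof.
move=> lb bh; rewrite /clip.
have [xl|lx] := leP x lo.
  rewrite min_l; last exact: le_trans bh.
  split=> //; first exact: le_trans bh.
  by rewrite !ler0_norm; lra.
have [xh|hx] := leP x hi; first by split=> //; exact: ltW.
split=> //; first exact: le_trans bh.
by rewrite !ger0_norm; lra.
Qed.

(** q(r)^2 + B is close to q(R0)^2 (c^2 + 1 - c^2), whatever the cosine c. The 8 comes from q <= 4
    in the difference of squares, 1 / q 1 from the square root, and 128 * 27 from [q_lb] up to 3 R0,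
    a bound for 2 r. *)
Lemma estimate_close {R : realType} (R0 r c B e1 e2 : R) :
  1 <= R0 -> R0 / 2 <= r -> r <= 3 / 2 * R0 -> 0 <= c -> c <= 1 ->
  `|q r - q R0 * c| <= e1 -> `|B - q R0 ^+ 2 * (1 - c ^+ 2)| <= e2 ->
  `|qinv (clip (q (r / 2)) (q (2 * r)) (Num.sqrt (pospart (q r ^+ 2 + B)))) - R0| <=
     128 * 27 / (pdf1 * q 1) * R0 ^+ 3 * (8 * e1 + e2).
Proof.
move=> R1 r1 r2 c0 c1 h1 h2; have p0 := @pdf1_gt0 R.
have q10 : 0 < q (1 : R) by have := @q_incr R 0 1 (lexx _) ltr01; rewrite q0.
have qR1 : q 1 <= q R0 by apply: q_ndecr.
have qR0 : 0 < q R0 by exact: lt_le_trans qR1.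
have qR4 := q_le4 R0; have qr4 := q_le4 r.
have qr0 : 0 <= q r by apply: q_ge0; lra.
set S := q r ^+ 2 + B.
have hS : `|S - q R0 ^+ 2| <= 8 * e1 + e2.
  have -> : S - q R0 ^+ 2 = (q r - q R0 * c) * (q r + q R0 * c) + (B - q R0 ^+ 2 * (1 - c ^+ 2)).
    by rewrite /S; ring.
  apply: le_trans (ler_normD _ _) _; apply: lerD => //; rewrite normrM mulrC.
  apply: ler_pM => //.
  have qc : q R0 * c <= 4 * 1 by apply: ler_pM => //; exact: ltW.
  have qc0 : 0 <= q R0 * c by rewrite mulr_ge0// ltW.
  by rewrite ger0_norm; lra.
have lo : q (r / 2) <= q R0 by apply: q_ndecr; lra.
have hi : q R0 <= q (2 * r) by apply: q_ndecr; lra.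
have [k1 k2 k3] := clip_close (Num.sqrt (pospart S)) lo hi.
set y := clip _ _ _ in k1 k2 k3 *.
have y0 : 0 <= y by apply: le_trans k1; apply: q_ge0; lra.
have yK : y <= q (3 * R0) by apply: le_trans k2 _; apply: q_ndecr; lra.
have K0 : 0 <= 3 * R0 by lra.
have [z0 zK qz] := qinvP K0 (introT andP (conj y0 yK)).
set z := qinv y in z0 zK qz *.
have yb : `|y - q R0| <= (8 * e1 + e2) / q 1.
  apply: le_trans k3 _; apply: le_trans (sqrt_pospart_close S qR0) _.
  apply: ler_pM => //; first by rewrite invr_ge0 ltW.
  by rewrite lef_pV2.
have K1 : 1 <= 3 * R0 by lra.
have R3 : 0 < R0 ^+ 3 by rewrite exprn_gt0//; lra.
have lip a b : 0 <= a -> a <= b -> b <= 3 * R0 -> pdf1 * (b - a) / (128 * (3 * R0) ^+ 3) <= q b - q a.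
  by move=> a0 ab bK; exact: q_lb.
have key : pdf1 * `|z - R0| / (128 * (3 * R0) ^+ 3) <= `|y - q R0|.
  rewrite -qz; have [zR|Rz] := leP z R0.
    rewrite (ler0_norm (_ : z - R0 <= 0)) ?subr_le0// opprB.
    rewrite (ler0_norm (_ : q z - q R0 <= 0)) ?opprB; last by rewrite subr_le0 q_ndecr.
    by apply: lip => //; lra.
  rewrite (ger0_norm (_ : 0 <= z - R0)) ?subr_ge0 ?(ltW Rz)//.
  rewrite (ger0_norm (_ : 0 <= q z - q R0)); last by rewrite subr_ge0 q_ndecr ?(ltW Rz)//; lra.
  by apply: lip => //; [lra|exact: ltW].
have := le_trans key yb.
have dn : 0 < 128 * (3 * R0) ^+ 3 by rewrite mulr_gt0 ?exprn_gt0//; lra.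
rewrite ler_pdivrMr// mulrC -ler_pdivlMr// => h; apply: le_trans h _.
rewrite le_eqVlt; apply/orP; left; apply/eqP; field.
by rewrite !gt_eqF.
Qed.

(** * Identification of the output and assembly of the three steps *)

Section radial_minimum.
Context {R : realType} {n d : nat}.
Variables (k l : nat) (W : n.-tuple ('cV[R]_d * bool)%type) (v : 'cV[R]_d) (s : R).
Hypothesis inf : informative k l W v.
Hypothesis root : radial k l W v s = 0.

Definition radial_loss (r : R) : R :=
  \sum_(j < n | (k <= j < l)%N) logistic_loss (r * dot (xs W j) v) (ys W j).

Lemma radial_loss_min r : r != s -> radial_loss s < radial_loss r.
Proof.
move=> rs.
have -> : radial_loss r = radial_loss s - (r - s) * radial k l W v s +
   \sum_(j < n | (k <= j < l)%N) bregman (s * dot (xs W j) v) ((r - s) * dot (xs W j) v).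
  rewrite /radial_loss /radial mulr_sumr -sumrN -!big_split/=; apply: eq_bigr => j _.
  have -> : r * dot (xs W j) v = s * dot (xs W j) v + (r - s) * dot (xs W j) v by ring.
  by rewrite logistic_lossD /rz; rewrite -/(xs W j) -/(ys W j); ring.
rewrite root mulr0 subr0 ltrDl; have [j jkl g0] := inf.
rewrite (bigD1 j)//= ltr_pwDl//.
  by apply: bregman_gt0; rewrite mulf_neq0// subr_eq0.
by apply: sumr_ge0 => i _; exact: bregman_ge0.
Qed.

End radial_minimum.

(** Both minimisers being unique, the relation defining the output becomes a function of the
    sample. *)
Lemma output_unique {R : realType} {n d : nat} (m1 m2 m3 : nat)
    (W : n.-tuple ('cV[R]_d * bool)%type) (th : 'cV[R]_d) (s : R) :
  (0 < m1)%N -> (0 < m2)%N ->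
  (forall z, tot_loss (xs W) (ys W) m1 th <= tot_loss (xs W) (ys W) m1 z) ->
  (forall th', (forall z, tot_loss (xs W) (ys W) m1 th' <= tot_loss (xs W) (ys W) m1 z) -> th' = th) ->
  th != 0 -> let v := (l2norm th)^-1 *: th in
  informative m1 (m1 + m2) W v -> radial m1 (m1 + m2) W v s = 0 -> 0 <= s <= 4 * l2norm th ->
  forall Rhat, debiased_output (xs W) (ys W) m1 m2 m3 Rhat <->
    Rhat = qinv (qhat (xs W) (ys W) m1 m2 m3 v s).
Proof.
move=> m10 m20 thmin thuniq th0 v inf root hs Rhat.
have i1 : 0 < (m1%:R : R)^-1 by rewrite invr_gt0 ltr0n.
have i2 : 0 < (m2%:R : R)^-1 by rewrite invr_gt0 ltr0n.
have l1E z : loss1 (xs W) (ys W) m1 z = m1%:R^-1 * tot_loss (xs W) (ys W) m1 z by [].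
have l2E r : loss2 (xs W) (ys W) m1 m2 v r = m2%:R^-1 * radial_loss m1 (m1 + m2) W v r by [].
split=> [[th' [r /= [[_ a1] _ a2 ->]]]|->].
  have e : th' = th by apply: thuniq => z; have := a1 z I; rewrite !l1E ler_pM2l.
  move: a2; rewrite e -/v => -[rin rmin]; congr (qinv (qhat _ _ _ _ _ _ _)).
  apply/eqP/negPn/negP => /(radial_loss_min inf root).
  have := rmin s; rewrite /= in_itv/= hs => /(_ isT); rewrite !l2E ler_pM2l// => h1 h2.
  by move: (le_lt_trans h1 h2); rewrite ltxx.
exists th, s => /=; split => //.
  by split => // z _; rewrite !l1E ler_pM2l.
split; first by rewrite /= in_itv.
move=> r _; rewrite !l2E ler_pM2l//; have [->//|rs] := eqVneq r s.
by apply/ltW; exact: radial_loss_min.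
Qed.

Lemma Bhat_Bform {R : realType} {n d : nat} (m1 m2 m3 : nat) (V : n.-tuple ('cV[R]_d * bool)%type -> 'cV[R]_d)
    (r : n.-tuple ('cV[R]_d * bool)%type -> R) W : (m1 + m2 + m3)%N = n ->
  Bhat (xs W) (ys W) m1 m2 m3 (V W) (r W) = Bform (m1 + m2) V r W.
Proof.
move=> nE; have e : (n - (m1 + m2))%N = m3 by rewrite -nE addKn.
rewrite /Bhat /Bform e; congr (_ * _).
have resE i : residual (xs W) (ys W) (V W) (r W) i = wres V r W i.
  by rewrite /residual mulmx_perp perpZ.
apply: eq_big => [i|i _]; first by rewrite /in_I3 ltn_ord andbT.
by apply: eq_big => [j|j _]; [rewrite /in_I3 ltn_ord andbT|rewrite !resE].
Qed.

(** With L = m / R0 the last hypothesis reads m >= n / 4, which is the value 1/4 of the constant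
    c. *)
Lemma err_scale {R : realType} (n R0 t L : R) : 0 < n -> 0 < R0 -> 0 < t -> n / (4 * R0) <= L ->
  Num.sqrt (t * L) / (L * R0 ^+ 2) <= 2 * Num.sqrt (R0 * t / n) / R0 ^+ 2.
Proof.
move=> n0 R00 t0 nL.
have L0 : 0 < L by apply: lt_le_trans nL; rewrite divr_gt0// mulr_gt0.
rewrite invfM mulrA ler_wpM2r ?invr_ge0 ?exprn_ge0 ?(ltW R00)//.
have s0 := sqrtr_ge0 (R0 * t / n).
rewrite -ler_sqr ?nnegrE ?divr_ge0 ?mulr_ge0 ?sqrtr_ge0 ?(ltW L0)//.
rewrite exprMn exprVn sqr_sqrtr ?mulr_ge0 ?(ltW L0) ?(ltW t0)//.
rewrite exprMn sqr_sqrtr ?divr_ge0 ?mulr_ge0 ?(ltW R00) ?(ltW t0) ?(ltW n0)//.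
have -> : t * L / L ^+ 2 = t / L by field; rewrite gt_eqF.
rewrite ler_pdivrMr//; apply: (@le_trans _ _ (2 ^+ 2 * (R0 * t / n) * (n / (4 * R0)))).
  by rewrite le_eqVlt; apply/orP; left; apply/eqP; field; rewrite !gt_eqF.
by rewrite ler_wpM2l// mulr_ge0 ?exprn_ge0// divr_ge0 ?mulr_ge0 ?ltW.
Qed.

Lemma sqrt_scale_le {R : realType} (a t L : R) : 0 < a -> 0 < t -> 0 < L -> a ^+ 2 * t <= L ->
  a * Num.sqrt (t * L) <= L.
Proof.
move=> a0 t0 L0 h; rewrite -ler_sqr ?nnegrE ?mulr_ge0 ?sqrtr_ge0 ?(ltW a0) ?(ltW L0)//.
rewrite exprMn sqr_sqrtr ?mulr_ge0 ?(ltW t0) ?(ltW L0)// mulrA [leRHS]expr2.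
by rewrite ler_wpM2r// ltW.
Qed.

(* The bound c < 1/3 keeps the condition c n <= min(m1, m2, m3) satisfiable:
   this minimum is at most n / 3. *)
Theorem theorem2p3 (R : realType) :
  exists C c : R, [/\ 0 < c, c < C, c < 3^-1 &
  forall (n d m1 m2 m3 : nat) (theta : 'cV[R]_d) (t : R)
    (disp : measure_display) (T : measurableType disp) (P : probability T R)
    (x : 'I_n -> T -> 'cV[R]_d) (y : 'I_n -> T -> bool),
  1 <= l2norm theta ->
  logistic_sample P theta x y ->
  (0 < m1)%N -> (0 < m2)%N -> (0 < m3)%N -> (m1 + m2 + m3 = n)%N ->
  1 <= t ->
  c * n%:R <= (minn m1 (minn m2 m3))%:R ->
  C * l2norm theta * (d%:R + t) <= n%:R ->
  exists E : set T, [/\ measurable E,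
    ((1 - C * expR (- (c * t)))%:E <= P E)%E
  & forall w, E w ->
      (exists Rhat, debiased_output (x^~ w) (y^~ w) m1 m2 m3 Rhat) /\
      (forall Rhat, debiased_output (x^~ w) (y^~ w) m1 m2 m3 Rhat ->
         `|Rhat - l2norm theta| <= C * Num.sqrt (l2norm theta ^+ 3 * t / n%:R))]].
Proof.
have p0 := @pdf1_gt0 R; have p1 : pdf1 <= 1 :> R by exact: normal_pdf01_le1.
have Cb0 := @bernC1_gt0 R; set Cb : R := bernC + 1 in Cb0.
have V0 := @vsumC_gt0 R.
have q10 : 0 < q (1 : R) by have := @q_incr R 0 1 (lexx _) ltr01; rewrite q0.
(* Small enough that rho = 2 c0 satisfies 4 rho^2 = pdf1^2 / 1024 <= pdf1 / 512, the bias condition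
   of the second step. *)
pose c0 : R := pdf1 / 128.
have c00 : 0 < c0 by rewrite /c0 divr_gt0.
have c04 : c0 <= 4^-1 by rewrite /c0; lra.
have c01 : c0 <= 1 by lra.
pose rho := 2 * c0.
have rho0 : 0 < rho by rewrite /rho; lra.
have rho1 : rho <= 2^-1 by rewrite /rho; lra.
have rho2 : 4 * rho ^+ 2 <= pdf1 / (16 * 32).
  have : pdf1 * pdf1 <= pdf1 * 1 :> R by rewrite ler_wpM2l// ltW.
  have -> : 4 * rho ^+ 2 = pdf1 * pdf1 / (32 * 32) by rewrite /rho /c0; field.
  lra.
have [C1 C10 step1] := step1_event c00 c01.
(* Chosen so that g sqrt(t L) <= L is the smallness of [radial_err] required by [step2_event]. *)
pose g : R := 2 * Cb * (32 * 32) / pdf1.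
have g0 : 0 < g.
  by apply: divr_gt0 => //; apply: mulr_gt0; [apply: mulr_gt0|lra].
pose lnK : R := `|ln (netK 2)|.
have lnK0 : 0 <= lnK by exact: normr_ge0.
pose Kerr : R := 128 * 27 / (pdf1 * q 1) * ((40 + 8 * vsumC) * Cb).
have Kerr0 : 0 <= Kerr.
  rewrite /Kerr mulr_ge0//; first by rewrite divr_ge0 ?mulr_ge0 ?(ltW p0) ?(ltW q10)//; lra.
  by rewrite mulr_ge0 ?(ltW Cb0)//; lra.
(* One summand per lower bound on L, times 4 since L >= n / (4 R0): the first step, the range 1/16
   of the exponent, [radial_err], the net of the third step. [Kerr] is the final error constant, and
   12 = 3 + 4 + 5 adds up the failure probabilities. *)
pose C := 4 * C1 + 4 * (16 * 16) + 4 * g ^+ 2 + 4 * (lnK + 1) + Kerr + 12.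
have g2 : 0 <= g ^+ 2 by exact: sqr_ge0.
have CC1 : C1 <= C / 4 by rewrite /C; lra.
have C256 : (16 * 16) <= C / 4 by rewrite /C; lra.
have Cg : g ^+ 2 <= C / 4 by rewrite /C; lra.
have ClnK : lnK + 1 <= C / 4 by rewrite /C; lra.
have CK : Kerr <= C by rewrite /C; lra.
have C12 : 12 <= C by rewrite /C; lra.
clearbody C.
exists C, 4^-1; split; [lra|lra|lra|].
move=> n d m1 m2 m3 theta t disp T P x y th1 smp m10 m20 m30 nE t1 hmin hC.
set R0 := l2norm theta in th1 hC *.
have R00 : 0 < R0 by exact: lt_le_trans th1.
have t0 : 0 < t by exact: lt_le_trans t1.
have dt : 0 <= d%:R :> R by [].
have nR : 0 < n%:R :> R by rewrite ltr0n -nE addn_gt0 m30 orbT.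
have Lge m : (minn m1 (minn m2 m3) <= m)%N -> n%:R / (4 * R0) <= m%:R / R0.
  move=> hm; have : 4^-1 * n%:R <= m%:R :> R by apply: le_trans hmin _; rewrite ler_nat.
  have -> : n%:R / (4 * R0) = 4^-1 * n%:R / R0 by field; rewrite gt_eqF.
  by move=> h; rewrite ler_wpM2r// invr_ge0 ltW.
have Cdt : C / 4 * (d%:R + t) <= n%:R / (4 * R0).
  rewrite ler_pdivlMr ?mulr_gt0//; apply: le_trans hC.
  by rewrite le_eqVlt; apply/orP; left; apply/eqP; field.
have Lbig k m : (minn m1 (minn m2 m3) <= m)%N -> 0 <= k -> k <= C / 4 -> k * (d%:R + t) <= m%:R / R0.
  move=> hm k0 kC; apply: le_trans _ (Lge m hm); apply: le_trans _ Cdt.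
  by rewrite ler_wpM2r// addr_ge0// ltW.
have h1 : (minn m1 (minn m2 m3) <= m1)%N by exact: geq_minl.
have h2 : (minn m1 (minn m2 m3) <= m2)%N by apply: leq_trans (geq_minr _ _) (geq_minl _ _).
have h3 : (minn m1 (minn m2 m3) <= m3)%N by apply: leq_trans (geq_minr _ _) (geq_minr _ _).
have m1n : (m1 <= n)%N by rewrite -nE -addnA leq_addr.
have m12n : (m1 + m2 <= n)%N by rewrite -nE leq_addr.
have k12 : (m1 <= m1 + m2)%N by exact: leq_addr.
have eL2 : (m1 + m2 - m1)%N = m2 by rewrite addKn.
have eL3 : (n - (m1 + m2))%N = m3 by rewrite -nE addKn.
have [G1 [mG1 iG1 pG1 hG1]] := step1 _ _ P n d theta x y m1 t smp th1 m1n t1 (Lbig C1 m1 h1 (ltW C10) CC1).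
have span W : G1 W -> spanning (xs W) m1 by move=> /hG1 [].
have ex W : G1 W -> exists th, forall z, tot_loss (xs W) (ys W) m1 th <= tot_loss (xs W) (ys W) m1 z.
  by move=> /hG1 [_ up]; exact: (argmin_exists th1 c00 up).
pose sel := argmin_sel m1 G1 theta.
(* Off [G1] the selected point is theta itself, so the localization holds for every sample. *)
have loc W : l2norm (stretch (R0^-1 *: theta) R0^-1 (sel W - theta)) < c0.
  have [GW|nG] := pselect (G1 W).
    have [_ up] := hG1 W GW.
    exact: (argmin_local th1 c00 up (argmin_selP theta ex GW)).
  by rewrite /sel /argmin_sel asboolF// subrr stretch0 l2norm0.
pose V W := (l2norm (sel W))^-1 *: sel W.
have geo W := direction_close th1 c00 c04 (loc W).
have nsel W : 0 < l2norm (sel W).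
  by have [h _ _ _] := geo W; apply: lt_le_trans h; rewrite divr_gt0.
have V1 W : dot (V W) (V W) = 1 by have [] := geo W.
have Vu W : 0 < dot (V W) (R0^-1 *: theta) by have [] := geo W.
have Vp W : l2norm (perp (V W) (R0^-1 *: theta)) <= rho / R0 by have [] := geo W.
have msel : measurable_fun setT sel by exact: measurable_argmin_sel.
have mV : measurable_fun setT V.
  by apply: measurable_scalev => //; exact: measurable_inv_l2norm.
have iV : indep_of_ge m1 V.
  by move=> W j z mj; rewrite /V /sel (indep_argmin_sel theta iG1).
have L2256 : (16 * 16) * t <= (m1 + m2 - m1)%:R / R0.
  rewrite eL2; apply: le_trans (Lbig (16 * 16) m2 h2 _ C256); last by clear; lra.
  by apply: ler_wpM2l; [clear; lra|rewrite lerDr].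
have L3256 : (16 * 16) * t <= (n - (m1 + m2))%:R / R0.
  rewrite eL3; apply: le_trans (Lbig (16 * 16) m3 h3 _ C256); last by clear; lra.
  by apply: ler_wpM2l; [clear; lra|rewrite lerDr].
have E2 : Num.sqrt (t * (m2%:R / R0)) / (m2%:R / R0 * R0 ^+ 2) <= 2 * Num.sqrt (R0 * t / n%:R) / R0 ^+ 2.
  by apply: err_scale => //; exact: Lge.
have E3 : Num.sqrt (t * (m3%:R / R0)) / (m3%:R / R0 * R0 ^+ 2) <= 2 * Num.sqrt (R0 * t / n%:R) / R0 ^+ 2.
  by apply: err_scale => //; exact: Lge.
set eta := Num.sqrt (R0 * t / n%:R) in E2 E3.
have err2 : radial_err theta m1 (m1 + m2) t <= 4 * Cb * (eta / R0 ^+ 2).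
  rewrite /radial_err eL2 -/R0 -/Cb -mulrA.
  have : 2 * Cb * (Num.sqrt (t * (m2%:R / R0)) / (m2%:R / R0 * R0 ^+ 2)) <= 2 * Cb * (2 * eta / R0 ^+ 2).
    by apply: ler_wpM2l => //; rewrite mulr_ge0// ltW.
  by move=> h; apply: le_trans h _; rewrite le_eqVlt; apply/orP; left; apply/eqP; field; rewrite gt_eqF.
have small : radial_err theta m1 (m1 + m2) t * R0 ^+ 2 <= pdf1 / (32 * 32).
  rewrite /radial_err eL2 -/R0 -/Cb; set L := m2%:R / R0.
  have L0 : 0 < L by rewrite divr_gt0// ltr0n.
  have Lg : g ^+ 2 * t <= L.
    apply: le_trans (Lbig (g ^+ 2) m2 h2 g2 Cg); by rewrite ler_wpM2l// lerDr.
  have sL := sqrt_scale_le g0 t0 L0 Lg.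
  have -> : 2 * Cb * Num.sqrt (t * L) / (L * R0 ^+ 2) * R0 ^+ 2 = pdf1 / (32 * 32) * (g * Num.sqrt (t * L) / L).
    by rewrite /g; field; rewrite !gt_eqF.
  apply: ler_piMr; first by apply: divr_ge0; [exact: ltW|clear; lra].
  by rewrite ler_pdivrMr// mul1r.
have [G2 [rs [mG2 iG2 pG2 [mrs irs rs_range hG2]]]] :=
  step2_event smp th1 k12 m12n mV iV V1 Vu Vp rho1 rho2 t0 L2256 small.
have th_ge := direction_ge th1 V1 Vu Vp rho1.
have th_perp := direction_perp th1 Vp rho1.
have rs_ge W : R0 / 2 <= rs W by have /andP[] := rs_range W.
have K2L : ln (netK 2) * d%:R + t <= (n - (m1 + m2))%:R / R0.
  rewrite eL3; apply: le_trans (Lbig (lnK + 1) m3 h3 _ ClnK); last by move: lnK0; clear; lra.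
  rewrite mulrDr; apply: lerD; last by rewrite ler_peMl ?(ltW t0)//; move: lnK0; clear; lra.
  by rewrite ler_wpM2r//; apply: le_trans (ler_norm _) _; rewrite -/lnK; clear; lra.
have m32 : 2 <= (n - (m1 + m2))%:R :> R.
  have : (n - (m1 + m2))%:R / R0 <= (n - (m1 + m2))%:R :> R by rewrite ler_pdivrMr// ler_peMr.
  by move: L3256 t1; clear; lra.
have [G3 [mG3 pG3 hG3]] := step3_event smp th1 m12n mV (indep_of_geW k12 iV) mrs irs V1 rs_ge th_ge th_perp t0 L3256 rho0 Vp K2L m32.
pose G := G1 `&` (G2 `&` G3).
have mG : measurable G by apply: measurableI => //; exact: measurableI.
have mZ := measurable_obs smp.
have pG : (fails P (obs x y) G <= (12 * expR (- t))%:E)%E.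
  have -> : 12 * expR (- t) = 3 * expR (- t) + (4 * expR (- t) + 5 * expR (- t)) by clear; ring.
  by apply: failsI => //; [exact: measurableI|exact: failsI].
exists (data (obs x y) @^-1` G); split.
- exact: measurable_data_preimage.
- have mE : measurable (data (obs x y) @^-1` G) by exact: measurable_data_preimage.
  have e : fails P (obs x y) G = (1 - P (data (obs x y) @^-1` G))%E.
    by rewrite /fails -preimage_setC probability_setC.
  have fP : P (data (obs x y) @^-1` G) \is a fin_num by exact: fin_num_measure.
  rewrite -(fineK fP) lee_fin; move: pG; rewrite e -(fineK fP) -EFinB lee_fin => h.
  have : 12 * expR (- t) <= C * expR (- (4^-1 * t)).
    by apply: ler_pM => //; rewrite ler_expR; move: t0; clear; lra.
  by move: h; clear; lra.
move=> w; rewrite /preimage/=; set W := data (obs x y) w => -[W1 [W2 W3]].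
have xE : x^~ w = xs W by apply/funext => i; rewrite /xs /W tnth_data.
have yE : y^~ w = ys W by apply/funext => i; rewrite /ys /W tnth_data.
have [inf root rad] := hG2 W W2.
have [sel_ge _ _ _] := geo W.
have sel0 : sel W != 0 by rewrite -l2norm_gt0.
(* The root is at most 3 R0 / 2 and |sel| >= R0 / 2, so it lies inside the search interval of the
   second step. *)
have srange : 0 <= rs W <= 4 * l2norm (sel W).
  have /andP[a b] := rs_range W; apply/andP; split; move: a b sel_ge R00; rewrite -/R0; clear; lra.
have out := @output_unique R n d m1 m2 m3 W (sel W) (rs W) m10 m20 (argmin_selP theta ex W1)
  (fun th' h => argmin_sel_unique theta span ex W1 h) sel0 inf root srange.
rewrite xE yE; split; first by eexists; apply/out.
move=> Rhat /out ->.
rewrite /qhat /Shat -/(V W) (Bhat_Bform V rs W nE).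
have /andP[ra rb] := rs_range W.
have c1 : dot (V W) (R0^-1 *: theta) <= 1 by exact: (cosa_le1 th1 V1 W).
have dd : dot (drift theta V W) (drift theta V W) = q R0 ^+ 2 * (1 - dot (V W) (R0^-1 *: theta) ^+ 2).
  have u1 : dot (R0^-1 *: theta) (R0^-1 *: theta) = 1 by apply: l2norm_unit; rewrite -l2norm_gt0.
  have py := pythagoras (R0^-1 *: theta) (V1 W).
  rewrite /drift -/R0 dotZl dotZr -l2norm_sqr mulrA -expr2; congr (_ * _).
  by move: py; rewrite {1}/l2norm u1 sqrtr1 expr1n => ->; ring.
have B3 := hG3 W W3; rewrite dd in B3.
have := estimate_close th1 ra rb (ltW (Vu W)) c1 rad B3.
move=> h; apply: le_trans h _.
have eta0 : 0 <= eta by exact: sqrtr_ge0.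
have er : 8 * radial_err theta m1 (m1 + m2) t + (8 * rho + 4 * vsumC) * (bernC + 1) * @estE R n d theta (m1 + m2) t
    <= (40 + 8 * vsumC) * Cb * (eta / R0 ^+ 2) :> R.
  have -> : (40 + 8 * vsumC) * Cb * (eta / R0 ^+ 2) = 8 * (4 * Cb * (eta / R0 ^+ 2)) + (4 + 4 * vsumC) * Cb * (2 * eta / R0 ^+ 2).
    by field; rewrite gt_eqF.
  apply: lerD; first by rewrite ler_wpM2l.
  rewrite -/Cb; apply: ler_pM => //.
  - by rewrite mulr_ge0 ?(ltW Cb0)// addr_ge0 ?mulr_ge0 ?ltW.
  - by rewrite divr_ge0 ?sqrtr_ge0// mulr_ge0 ?sqr_ge0// divr_ge0// ltW.
  - by rewrite ler_wpM2r ?(ltW Cb0)//; move: rho1; clear; lra.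
  - by rewrite /estE eL3.
have se : Num.sqrt (R0 ^+ 3 * t / n%:R) = R0 * eta.
  have -> : R0 ^+ 3 * t / n%:R = R0 ^+ 2 * (R0 * t / n%:R) by ring.
  by rewrite sqrtrM ?sqr_ge0// sqrtr_sqr ger0_norm// ltW.
rewrite se.
have k0 : 0 <= 128 * 27 / (pdf1 * q 1) * R0 ^+ 3.
  rewrite mulr_ge0 ?exprn_ge0 ?(ltW R00)// divr_ge0 ?mulr_ge0 ?(ltW p0) ?(ltW q10)//; clear; lra.
apply: le_trans (ler_wpM2l k0 er) _.
have -> : 128 * 27 / (pdf1 * q 1) * R0 ^+ 3 * ((40 + 8 * vsumC) * Cb * (eta / R0 ^+ 2)) = Kerr * (R0 * eta).
  by rewrite /Kerr; field; rewrite !gt_eqF.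
by rewrite ler_wpM2r// mulr_ge0// ltW.
Qed.
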